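(* (Discrete Gagliardo–Nirenberg type inequality.) Let $q\in(\mu_d,\mu)$. Assume that the family $\{\mathcal{T}_h\}_h$ satisfies the inverse assumption and the acuteness condition. Then there is a constant $C>0$, independent of $h$, such that $$\|v_h\|_{L^\infty}\le C\,\|A_hv_h\|_{h,q}^{\frac{d}{2q}}\,\|v_h\|_{h,q}^{1-\frac{d}{2q}},\qquad\forall v_h\in S_h.$$
   Context: $\Omega\subset\mathbb{R}^d$, $d\in\{2,3\}$, is a bounded polygonal or polyhedral domain. All functions are complex-valued; $L^q=L^q(\Omega)$, $W^{s,q}=W^{s,q}(\Omega)$, $W^{1,q}_0=\{v\in W^{1,q}: v|_{\partial\Omega}=0\}$. Shape assumption on $\Omega$ (standing): there is a fixed $\mu>d$ such that for every $q\in(1,\mu)$ there is $C>0$, depending only on $\Omega$ and $q$, with $\|v\|_{W^{2,q}}\le C\|\Delta v\|_{L^q}$ for all $v\in W^{2,q}\cap W^{1,q}_0$. Here $\mu'$ is the Hölder conjugate of $\mu$ and $\mu_d=\max\{\mu',d/2\}$. Triangulations: $\{\mathcal{T}_h\}_h$ is a fixed family of triangulations of $\Omega$: each $\mathcal{T}_h$ consists of open triangles ($d=2$) or tetrahedra ($d=3$) $K\subset\Omega$ with $\Omega=\operatorname{Int}\bigcup_{K\in\mathcal{T}_h}\overline K$, any two elements meeting only in entire common faces (when $d=3$), sides or vertices; $h_K$ is the diameter of $K$ and $h=\max_{K\in\mathcal{T}_h}h_K$. Regularity (standing): there is $\nu>0$ with $h_K\le\nu\rho_K$ for all $K\in\mathcal{T}_h$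 and all $h$, $\rho_K$ being the radius of the inscribed circle or sphere of $K$. $V_h$ is the space of continuous functions on $\Omega$ affine on each $K\in\mathcal{T}_h$; $P_1,\dots,P_{\overline N_h}$ are the nodes of $\mathcal{T}_h$, of which $P_1,\dots,P_{N_h}$ are the interior ones; $\phi_j\in V_h$ is the nodal basis function, $\phi_j(P_i)=\delta_{ij}$; $S_h=\{v_h\in V_h: v_h|_{\partial\Omega}=0\}=\operatorname{span}\{\phi_j\}_{j=1}^{N_h}$. Inverse assumption: there is $\gamma>0$ with $h\le\gamma h_K$ for all $K\in\mathcal{T}_h$ and all $h$. Acuteness condition: for each $h$ and all $i\ne j$ in $\{1,\dots,\overline N_h\}$, $\int_\Omega\nabla\phi_i\cdot\nabla\phi_j\,dx\le0$. Mass-lumping: $\Lambda_j$ is the barycentric domain of $P_j$, i.e. (up to null sets) the union over elements $K$ having $P_j$ as a vertex of the points of $K$ at which the barycentric coordinate associated with $P_j$ is the largest one; $\chi_j$ is its characteristic function; $M_hv_h=\sum_{j=1}^{N_h}v_h(P_j)\chi_j$ for $v_h\in S_h$; $\|v_h\|_{h,q}=\|M_hv_h\|_{L^q}$ and $(u_h,v_h)_h=(M_hu_h,M_hv_h)_{L^2}$. The discrete Laplacian with mass-lumping $A_h:S_h\to S_h$ is defined by $(A_hu_h,v_h)_h=-(\nabla u_h,\nabla v_h)_{L^2}$ for all $v_h\in S_h$. *)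

(* Defs.v *)
From HB Require Import structures.
From mathcomp Require Import all_boot all_order all_algebra.
From mathcomp Require Import all_classical all_reals all_analysis.
From mathcomp Require Import complex.

Set Implicit Arguments.
Unset Strict Implicit.
Unset Printing Implicit Defensive.
Import Order.TTheory GRing.Theory Num.Theory.
Import numFieldNormedType.Exports.
Local Open Scope classical_set_scope.
Local Open Scope ring_scope.
Local Open Scope complex_scope.

Section rV_measurable.
Context {R : realType}.
Variable n : nat.

Let coor : 'I_n -> 'rV[R]_n -> measurableTypeR R := fun i x => x ord0 i.

Let rV_set0 : g_sigma_preimage coor set0.
Proof. exact: sigma_algebra0. Qed.

Let rV_setC A : g_sigma_preimage coor A -> g_sigma_preimage coor (~` A).
Proof. exact: sigma_algebraC. Qed.

Let rV_bigcup (F : _^nat) : (forall i, g_sigma_preimage coor (F i)) ->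
  g_sigma_preimage coor (\bigcup_i (F i)).
Proof. exact: sigma_algebra_bigcup. Qed.

(* product (= Borel) sigma-algebra on R^n *)
HB.instance Definition _ := @isMeasurable.Build (measure_tuple_display default_measure_display)
  'rV[R]_n (g_sigma_preimage coor) rV_set0 rV_setC rV_bigcup.

Lemma measurable_coor (i : 'I_n) :
  measurable_fun [set: 'rV[R]_n] (fun x : 'rV[R]_n => (x ord0 i : measurableTypeR R)).
Proof.
move=> _ Y mY; rewrite setTI; apply: sub_sigma_algebra => /=.
rewrite -bigcup_seq/=; exists i => /=; first by rewrite mem_index_enum.
by exists Y => //; rewrite setTI.
Qed.

Lemma measurable_fun_rVP d (T : measurableType d) (f : T -> 'rV[R]_n) :
  (forall i, measurable_fun setT (fun x => (f x ord0 i : measurableTypeR R))) ->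
  measurable_fun setT f.
Proof.
move=> mf _ A mA; rewrite setTI; move: A mA.
apply: smallest_sub.
  split.
  - by rewrite /= preimage_set0.
  - by move=> A mA /=; rewrite setTD preimage_setC; apply: measurableC.
  - by move=> F mF /=; rewrite preimage_bigcup; apply: bigcupT_measurable.
rewrite -bigcup_seq/=; apply: bigcup_sub => i _ _ [B mB <-] /=.
by rewrite setTI; have := mf i measurableT B mB; rewrite setTI.
Qed.
End rV_measurable.

Section leb_step.
Context {R : realType} {n : nat}.
Variable m : {sigma_finite_measure set 'rV[R]_n -> \bar R}.

Definition rV_cons (p : measurableTypeR R * 'rV[R]_n) : 'rV[R]_n.+1 :=
  \row_i if unlift ord0 i is Some j then p.2 ord0 j else p.1.

Lemma measurable_rV_cons : measurable_fun setT rV_cons.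
Proof.
apply: measurable_fun_rVP => i; rewrite /rV_cons.
case: (unliftP ord0 i) => [j ->|->].
  rewrite (_ : (fun _ => _) = (fun x : 'rV[R]_n => x ord0 j : measurableTypeR R) \o snd).
    by apply: measurableT_comp; [exact: measurable_coor|].
  by apply/funext => x /=; rewrite mxE liftK.
rewrite (_ : (fun _ => _) = fst) //.
by apply/funext => x /=; rewrite mxE unlift_none.
Qed.

Definition leb_step : set 'rV[R]_n.+1 -> \bar R :=
  pushforward ((@lebesgue_measure R) \x m)%E rV_cons.

Let leb_step0 : leb_step set0 = 0%E.
Proof. by rewrite /leb_step /pushforward preimage_set0 measure0. Qed.

Let leb_step_ge0 A : (0 <= leb_step A)%E.
Proof. by rewrite /leb_step /pushforward; exact: measure_ge0. Qed.

Let leb_step_sigma_additive : semi_sigma_additive leb_step.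
Proof.
have mc (A : set 'rV[R]_n.+1) : measurable A -> measurable (rV_cons @^-1` A).
  by move=> mA; rewrite -[X in measurable X]setTI; exact: measurable_rV_cons.
move=> F mF tF mUF; rewrite /leb_step /pushforward preimage_bigcup.
apply: measure_semi_sigma_additive.
- by move=> k; exact: mc.
- apply/trivIsetP => /= i j _ _ ij; rewrite -preimage_setI.
  by move/trivIsetP : tF => /(_ _ _ _ _ ij) ->//; rewrite preimage_set0.
- by rewrite -preimage_bigcup; exact: mc.
Qed.

HB.instance Definition _ := isMeasure.Build _ _ _ leb_step
  leb_step0 leb_step_ge0 leb_step_sigma_additive.

Lemma leb_step_sigma_finite : sigma_finite setT leb_step.
Proof.
have /sigma_finiteP[F [TF ndF Foo]] := sigma_finiteT (@lebesgue_measure R).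
have /sigma_finiteP[G [TG ndG Goo]] := sigma_finiteT m.
pose g (x : 'rV[R]_n.+1) : measurableTypeR R * 'rV[R]_n :=
  (x ord0 ord0, \row_j x ord0 (lift ord0 j)).
have mg : measurable_fun setT g.
  apply/measurable_fun_pairP; split; first exact: measurable_coor.
  apply: measurable_fun_rVP => i.
  rewrite (_ : (fun _ => _) = (fun x : 'rV[R]_n.+1 => x ord0 (lift ord0 i) : measurableTypeR R)).
    exact: measurable_coor.
  by apply/funext => x /=; rewrite mxE.
exists (fun k => g @^-1` (F k `*` G k)).
  apply/seteqP; split => // x _.
  have : [set: measurableTypeR R] (g x).1 by [].
  have : [set: 'rV[R]_n] (g x).2 by [].
  rewrite TF TG => -[i _ Gi] [j _ Fj]; exists (maxn i j) => //; split.
    by move: Fj; exact/subsetPset/ndF/leq_maxr.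
  by move: Gi; exact/subsetPset/ndG/leq_maxl.
move=> k; have [mFk Fk] := Foo k; have [mGk Gk] := Goo k; split.
  by rewrite -[X in measurable X]setTI; apply: mg => //; exact: measurableX.
rewrite /leb_step /pushforward -comp_preimage.
rewrite (_ : g \o rV_cons = id).
  by rewrite preimage_id product_measure1E// lte_mul_pinfty// ge0_fin_numE.
apply/funext => -[a x]; rewrite /g/= /rV_cons mxE unlift_none; congr pair.
by apply/rowP => j; rewrite !mxE liftK.
Qed.

HB.instance Definition _ := Measure_isSigmaFinite.Build _ _ _ leb_step leb_step_sigma_finite.
End leb_step.

(* Lebesgue measure on R^n, as an iterated product; see leb_box *)
Fixpoint leb {R : realType} (n : nat) : {sigma_finite_measure set 'rV[R]_n -> \bar R} :=
  match n with
  | 0 => [the {sigma_finite_measure set _ -> \bar R} of dirac (0 : 'rV[R]_0)]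
  | m.+1 => [the {sigma_finite_measure set _ -> \bar R} of leb_step (leb m)]
  end.
Arguments leb {R} n.

Lemma leb_box {R : realType} (n : nat) (a b : 'rV[R]_n) :
  (forall i, a ord0 i <= b ord0 i) ->
  leb n [set x | forall i, a ord0 i <= x ord0 i <= b ord0 i] =
  (\prod_i (b ord0 i - a ord0 i))%:E.
Proof.
elim: n a b => [|n IH] a b ab /=.
  by rewrite big_ord0 /dirac indicE mem_set// => -[].
pose t (x : 'rV[R]_n.+1) : 'rV[R]_n := \row_j x ord0 (lift ord0 j).
rewrite big_ord_recl /leb_step /pushforward.
rewrite (_ : rV_cons @^-1` _ = ([set` `[a ord0 ord0, b ord0 ord0]] : set (measurableTypeR R)) `*`
    [set x : 'rV[R]_n | forall i, t a ord0 i <= x ord0 i <= t b ord0 i]); last first.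
  apply/seteqP; split => -[y x] /=.
    move=> H; split.
      by have := H ord0; rewrite mxE unlift_none in_itv.
    by move=> i; have := H (lift ord0 i); rewrite !mxE liftK.
  move=> [H1 H2] i; rewrite mxE; case: (unliftP ord0 i) => [j ->|->].
    by have := H2 j; rewrite !mxE.
  by move: H1; rewrite in_itv.
have tab i : t a ord0 i <= t b ord0 i by rewrite !mxE.
rewrite product_measure1E; last 2 first.
- exact: measurable_itv.
- rewrite (_ : [set x | _] = \bigcap_(i in [set: 'I_n])
      [set x : 'rV[R]_n | x ord0 i \in `[t a ord0 i, t b ord0 i]]); last first.
    apply/seteqP; split => x /= H i; first by move=> _; rewrite /= in_itv/=; exact: H.
    by have := H i Logic.I; rewrite /= in_itv.
  apply: fin_bigcap_measurable; first exact: finite_finset.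
  move=> i _; rewrite -[X in measurable X]setTI.
  exact: (@measurable_coor R n i measurableT _ (measurable_itv `[t a ord0 i, t b ord0 i])).
rewrite IH// EFinM; congr (_ * _)%E.
  transitivity (@lebesgue_measure R [set` `[a ord0 ord0, b ord0 ord0]]) => //.
  rewrite lebesgue_measure_itv/= lte_fin.
  have := ab ord0; rewrite le_eqVlt => /predU1P[->|->].
    by rewrite ltxx subrr.
  by rewrite EFinB.
by congr EFin; apply: eq_bigr => i _; rewrite !mxE.
Qed.

Section function_spaces.
Context {R : realType} {d : nat}.
Implicit Types (D Omega : set 'rV[R]_d) (u v g : 'rV[R]_d -> R[i]) (p q : R).

Definition boundary Omega : set 'rV[R]_d := closure Omega `\` interior Omega.

(* Complex-valued functions are measured, integrated, differentiated and tested for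
   continuity through their real and imaginary parts. *)
Definition measurable_cplx D u :=
  measurable_fun D (fun x => complex.Re (u x)) /\
  measurable_fun D (fun x => complex.Im (u x)).

Definition continuous_cplx D u :=
  {within D, continuous (fun x => complex.Re (u x))} /\
  {within D, continuous (fun x => complex.Im (u x))}.

Definition integral_cplx D u : R[i] :=
  (\int[leb d]_(x in D) complex.Re (u x)) +i*
  (\int[leb d]_(x in D) complex.Im (u x)).

Definition Lnorm_cplx D (r : \bar R) u : \bar R :=
  Lnorm (leb d) r (EFin \o ((fun x => Normc.normc (u x)) \_ D)).

Definition in_Lq D q u := measurable_cplx D u /\ (Lnorm_cplx D q%:E u < +oo)%E.

Definition L2dot D u v : R[i] := integral_cplx D (fun x => u x * conjc (v x)).

Definition partial (i : 'I_d) (f : 'rV[R]_d -> R) : 'rV[R]_d -> R :=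
  fun x => 'D_(delta_mx ord0 i) f x.

Definition partial_cplx (i : 'I_d) u : 'rV[R]_d -> R[i] := fun x =>
  partial i (fun y => complex.Re (u y)) x +i*
  partial i (fun y => complex.Im (u y)) x.

Definition grad_dot D u v : R[i] :=
  \sum_i L2dot D (partial_cplx i u) (partial_cplx i v).

Definition smooth (f : 'rV[R]_d -> R) :=
  forall (s : seq 'I_d) x, differentiable (foldr partial f s) x.

Definition test_function Omega (f : 'rV[R]_d -> R) :=
  [/\ smooth f, compact (closure [set x | f x != 0]) &
      closure [set x | f x != 0] `<=` Omega].

Definition morder (alpha : 'I_d -> nat) : nat := (\sum_i alpha i)%N.

Definition mpartial (alpha : 'I_d -> nat) (f : 'rV[R]_d -> R) :=
  foldr (fun i => iter (alpha i) (partial i)) f (enum 'I_d).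

Definition loc_integrable_cplx Omega u :=
  measurable_cplx Omega u /\
  forall K, compact K -> K `<=` Omega ->
    (\int[leb d]_(x in K) (Normc.normc (u x))%:E < +oo)%E.

Definition is_wderiv Omega (alpha : 'I_d -> nat) u g :=
  [/\ loc_integrable_cplx Omega u, loc_integrable_cplx Omega g &
      forall f, test_function Omega f ->
        integral_cplx Omega (fun x => u x * (mpartial alpha f x)%:C) =
        (-1) ^+ morder alpha * integral_cplx Omega (fun x => g x * (f x)%:C)].

(* a representative of the weak derivative, which is unique a.e. in Omega *)
Definition wderiv Omega (alpha : 'I_d -> nat) u : 'rV[R]_d -> R[i] :=
  xget (cst 0) [set g | is_wderiv Omega alpha u g].

(* a multi-index of order at most k has its entries in {0, ..., k} *)
Definition mindex (k : nat) (alpha : {ffun 'I_d -> 'I_k.+1}) : 'I_d -> nat :=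
  fun i => alpha i.

Definition in_Sobolev Omega (k : nat) q u :=
  in_Lq Omega q u /\
  forall alpha : {ffun 'I_d -> 'I_k.+1}, (morder (mindex alpha) <= k)%N ->
    exists g, is_wderiv Omega (mindex alpha) u g /\ in_Lq Omega q g.

Definition Sobolev_norm Omega (k : nat) q u : \bar R :=
  ((\sum_(alpha : {ffun 'I_d -> 'I_k.+1} | (morder (mindex alpha) <= k)%N)
      Lnorm_cplx Omega q%:E (wderiv Omega (mindex alpha) u) `^ q) `^ q^-1)%E.

(* W^{1,q}_0: the closure in W^{1,q} of the test functions *)
Definition in_Sobolev10 Omega q u :=
  in_Sobolev Omega 1 q u /\
  exists f : nat -> 'rV[R]_d -> R[i],
    (forall n, test_function Omega (fun x => complex.Re (f n x)) /\
               test_function Omega (fun x => complex.Im (f n x))) /\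
    (fun n => Sobolev_norm Omega 1 q (fun x => u x - f n x)) @ \oo --> 0%E.

Definition laplacian Omega u : 'rV[R]_d -> R[i] := fun x =>
  \sum_i wderiv Omega (fun j => if j == i then 2 else 0)%N u x.

Definition shape_assumption Omega (mu : R) :=
  d%:R < mu /\
  forall q, 1 < q < mu -> exists C : R, 0 < C /\
    forall v, in_Sobolev Omega 2 q v -> in_Sobolev10 Omega q v ->
      (Sobolev_norm Omega 2 q v <= C%:E * Lnorm_cplx Omega q%:E (laplacian Omega v))%E.

Definition holder_conj (p : R) : R := p / (p - 1).

Definition mu_ (mu : R) : R := Num.max (holder_conj mu) (d%:R / 2).

End function_spaces.
Arguments mu_ {R} d mu.

Section simplices.
Context {R : realType} {d n : nat}.
(* The simplex with vertices P i (i \in s); for s = set0 it is empty. *)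
Variables (P : 'I_n -> 'rV[R]_d) (s : {set 'I_n}).

Definition barycentric (x : 'rV[R]_d) (l : 'I_n -> R) :=
  [/\ forall i, i \notin s -> l i = 0, \sum_i l i = 1 & x = \sum_i l i *: P i].

Definition open_simplex : set 'rV[R]_d :=
  [set x | exists l, barycentric x l /\ forall i, i \in s -> 0 < l i].

Definition closed_simplex : set 'rV[R]_d :=
  [set x | exists l, barycentric x l /\ forall i, i \in s -> 0 <= l i].

Definition affinely_independent := forall c : 'I_n -> R,
  (forall i, i \notin s -> c i = 0) -> \sum_i c i = 0 ->
  \sum_i c i *: P i = 0 -> forall i, c i = 0.

(* #|s| = d + 1: a nondegenerate triangle (d = 2) or tetrahedron (d = 3) *)
Definition full_simplex := #|s| = d.+1 /\ affinely_independent.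

End simplices.

Definition polyhedral_domain {R : realType} {d : nat} (Omega : set 'rV[R]_d) :=
  [/\ Omega !=set0, connected Omega &
      exists (n : nat) (P : 'I_n -> 'rV[R]_d) (S : {set {set 'I_n}}),
        (forall s, s \in S -> full_simplex P s) /\
        Omega = interior (\bigcup_(s in [set` S]) closed_simplex P s)].

(* An element is given by the set of its vertices; K stands for the open
   simplex and two closed elements meet along the (possibly empty) closed
   simplex spanned by their common vertices. *)
Record triangulation {R : realType} {d : nat} (Omega : set 'rV[R]_d) := Triangulation {
  nnodes : nat;
  node : 'I_nnodes -> 'rV[R]_d;
  elements : {set {set 'I_nnodes}};
  node_inj : injective node;
  node_elements : forall j, exists2 s, s \in elements & j \in s;
  elements_simplex : forall s, s \in elements -> full_simplex node s;
  elements_sub : forall s, s \in elements -> open_simplex node s `<=` Omega;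
  elements_cover :
    Omega = interior (\bigcup_(s in [set` elements]) closed_simplex node s);
  elements_conforming : forall s t, s \in elements -> t \in elements ->
    closed_simplex node s `&` closed_simplex node t = closed_simplex node (s :&: t)
}.
Arguments node {R d Omega} _ _.

Section mesh_size.
Context {R : realType} {d : nat}.

Definition enorm (x : 'rV[R]_d) : R := Num.sqrt (\sum_i x ord0 i ^+ 2).

Definition diameter (K : set 'rV[R]_d) : R :=
  sup [set r | exists x y, [/\ K x, K y & r = enorm (x - y)]].

Definition inradius (K : set 'rV[R]_d) : R :=
  sup [set r | 0 < r /\ exists x, [set y | enorm (y - x) < r] `<=` K].

Variables (Omega : set 'rV[R]_d) (T : triangulation Omega).

(* Omega without the boundaries of the elements, a null set: the classical
   gradient of a function of V_h exists at every point of this set, and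
   L^2 products of such gradients over Omega are computed here *)
Definition mesh_interior : set 'rV[R]_d :=
  \bigcup_(s in [set` elements T]) open_simplex (node T) s.

Definition h_elt (s : {set 'I_(nnodes T)}) : R := diameter (open_simplex (node T) s).
Definition rho_elt (s : {set 'I_(nnodes T)}) : R := inradius (open_simplex (node T) s).
Definition mesh_size : R := \big[Num.max/0]_(s in elements T) h_elt s.

End mesh_size.

Section finite_elements.
Context {R : realType} {d : nat} {Omega : set 'rV[R]_d}.
Variable T : triangulation Omega.
Implicit Types (u v w : 'rV[R]_d -> R[i]) (q : R).

Definition affine_on (K : set 'rV[R]_d) v :=
  exists (a : R[i]) (b : 'I_d -> R[i]),
    forall x, K x -> v x = a + \sum_i b i * (x ord0 i)%:C.

(* Functions of V_h are continuous up to the boundary, so that nodal values at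
   boundary nodes make sense; their values outside the closure of Omega are
   irrelevant. *)
Definition Vh v :=
  continuous_cplx (closure Omega) v /\
  forall s, s \in elements T -> affine_on (open_simplex (node T) s) v.

Definition Sh v := Vh v /\ forall x, boundary Omega x -> v x = 0.

Definition nodal_basis (j : 'I_(nnodes T)) : 'rV[R]_d -> R[i] :=
  xget (cst 0) [set phi | Vh phi /\ forall i, phi (node T i) = (i == j)%:R].

(* ties between barycentric coordinates form a null set *)
Definition bary_domain (j : 'I_(nnodes T)) : set 'rV[R]_d :=
  [set x | exists s l, [/\ s \in elements T, j \in s,
     barycentric (node T) s x l, forall i, i \in s -> 0 < l i &
     forall i, i \in s -> l i <= l j]].

Definition lumping v : 'rV[R]_d -> R[i] := fun x =>
  \sum_(j | node T j \in Omega) v (node T j) * (\1_(bary_domain j) x)%:C.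

Definition lumped_norm q v : \bar R := Lnorm_cplx Omega q%:E (lumping v).

Definition lumped_dot u v : R[i] := L2dot Omega (lumping u) (lumping v).

(* A_h v; it is unique as a function on the closure of Omega. *)
Definition discrete_laplacian v : 'rV[R]_d -> R[i] :=
  xget (cst 0)
    [set w | Sh w /\ forall z, Sh z -> lumped_dot w z = - grad_dot (mesh_interior T) v z].

End finite_elements.

Section mesh_families.
Context {R : realType} {d : nat} {Omega : set 'rV[R]_d} {I : Type}.
Variable T : I -> triangulation Omega.

Definition regular_family := exists nu : R, 0 < nu /\
  forall h s, s \in elements (T h) -> h_elt s <= nu * rho_elt s.

Definition inverse_assumption := exists gamma : R, 0 < gamma /\
  forall h s, s \in elements (T h) -> mesh_size (T h) <= gamma * h_elt s.

Definition acute_family := forall h (i j : 'I_(nnodes (T h))), i != j ->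
  complex.Re (grad_dot (mesh_interior (T h)) (nodal_basis i) (nodal_basis j)) <= 0.

End mesh_families.

(* Main.v *)
Require Import Defs.
From mathcomp Require Import all_boot all_order all_algebra.
From mathcomp Require Import all_classical all_reals all_analysis.
From mathcomp Require Import complex measurable_realfun ess_sup_inf.
From mathcomp Require Import ring lra zify.
Import Order.TTheory GRing.Theory Num.Theory.
Import numFieldNormedType.Exports.
Local Open Scope classical_set_scope.
Local Open Scope ring_scope.

(* The estimate is a discrete De Giorgi-Stampacchia bound. Multiply v by a unit complex
   number that makes it positive at the node where |v| is to be bounded, let a and f be
   the real parts of v and - A_h v and, for levels k, l > 0, put
   w = min (max (a - k) 0) l. Since the stiffness matrix has nonpositive
   off-diagonal entries (acuteness) and zero row sums, testing the equation of A_h with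
   w gives
     |grad w|^2 <= (grad a, grad w) = (f, w)_h <= C l |f|_q phi(k)^(1 - 1/q)
   where phi(k) is h^d times the number of nodes at which a > k. The Faber-Krahn
   inequality l^2 phi(k + l) <= C phi(k)^(2/d) |grad w|^2 turns this into
     l phi(k + l) <= C |f|_q phi(k)^(1 + b),   b = 2/d - 1/q > 0,
   and Stampacchia's iteration gives a <= k + C |f|_q phi(k)^b. Markov's inequality
   phi(k) <= C (|v|_q / k)^q and the choice k = |f|_q^(d/2q) |v|_q^(1 - d/2q) conclude.

   The Faber-Krahn inequality is proved by sampling w on a lattice of step comparable to
   h: a function g on a discrete torus whose support fills at most half of a cube of side
   n satisfies |g|_2 <= C n |D g|_2, because each translation by a vector of that cube
   costs at most C n |D g|_2 and half of these translations take a point out of the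
   support. Differences of w along a lattice edge are controlled by the oscillations of
   w on the boundedly many elements that the edge meets. *)

Set Implicit Arguments.
Unset Strict Implicit.
Unset Printing Implicit Defensive.


(** * Faber-Krahn inequality on a discrete torus *)

(** The estimate has to be uniform in h, so every length is measured in units of the mesh size [H].
    Regularity and the inverse assumption place a cube of half-width [r = H * ka] in each element;
    the lattice step is [r / 2], and all multiplicities are bounded by one number [M = (2m + 1)^d]
    with [m >= 4 / ka + 1], which involves no mesh. The weight h^d in phi absorbs the powers of [H]
    that are left. The exponents come from q b = 2q/d - 1 = 1/th - 1 with th = d/(2q): Markov's
    bound raised to the power b is a multiple of (|v|_q / k)^(1/th - 1), and the final k balances
    the two terms of the bound on a. Truncation acts on nodal values, since truncating the function
    would leave the piecewise affine functions. Translations of a torus are bijections, which makes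
    energies of shifts subadditive; the lattice is so wide that both ends of an edge that wraps
    around lie off the mesh. As Omega need not be convex, other edges may leave it and return, hence
    the zero extension of w. *)

Lemma sqr_sum_le_card (R : realFieldType) (J : finType) (P : pred J) (a : J -> R) :
  (\sum_(i | P i) a i) ^+ 2 <= #|P|%:R * \sum_(i | P i) a i ^+ 2.
Proof.
set S := \sum_(i | P i) a i; set Q := \sum_(i | P i) _; set m : R := #|P|%:R.
have [P0|P0] := posnP #|P|.
  have P0' i : P i = false by have := card0_eq P0 i; rewrite inE.
  by rewrite /m P0 mul0r /S big_pred0// expr0n.
have m0 : 0 < m by rewrite ltr0n.
have : 0 <= \sum_(i | P i) (m * a i - S) ^+ 2.
  by apply: sumr_ge0 => i _; exact: sqr_ge0.
have -> : \sum_(i | P i) (m * a i - S) ^+ 2 = m * (m * Q - S ^+ 2).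
  have -> : \sum_(i | P i) (m * a i - S) ^+ 2 =
    \sum_(i | P i) (m ^+ 2 * a i ^+ 2 - 2 * m * S * a i + S ^+ 2).
    by apply: eq_bigr => i _; ring.
  rewrite big_split/= sumrB -!mulr_sumr -/S -/Q sumr_const.
  rewrite -[_ *+ #|P|]mulr_natl -/m; ring.
by rewrite pmulr_rge0// subr_ge0.
Qed.

Section torus.
Variables (R : realFieldType) (G : finZmodType) (g : G -> R).

Definition shift_energy (y : G) : R := \sum_z (g (z + y) - g z) ^+ 2.

(** Telescope along the partial sums of [a]. Cauchy-Schwarz costs one factor [m]; translation
    invariance of sums over the group turns each of the [m] increments into the energy of a single
    [a i], which costs the other. *)
Lemma shift_energy_sum (m : nat) (a : 'I_m -> G) (D : R) :
  (forall i, shift_energy (a i) <= D) ->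
  shift_energy (\sum_i a i) <= m%:R ^+ 2 * D.
Proof.
move=> aD.
have tel (z : G) : g (z + \sum_i a i) - g z =
    \sum_(i < m) (g (z + \sum_(j < m | (j < i)%N) a j + a i)
                  - g (z + \sum_(j < m | (j < i)%N) a j)).
  pose S (k : nat) := \sum_(j < m | (j < k)%N) a j.
  have SS (i : 'I_m) : S i.+1 = S i + a i.
    rewrite /S [LHS](bigD1 i)//= addrC; congr (_ + _).
    apply: eq_bigl => j; rewrite ltnS; have [->|ji] := eqVneq j i.
      by rewrite ltnn andbF.
    by rewrite andbT ltn_neqAle -[_ != _ :> nat]/(j != i) ji.
  transitivity (\sum_(i < m) (g (z + S i.+1) - g (z + S i))); last first.
    by apply: eq_bigr => i _; rewrite -addrA -SS.
  rewrite -(big_mkord xpredT (fun i => g (z + S i.+1) - g (z + S i))).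
  rewrite telescope_sumr//; congr (g (z + _) - g _).
    by rewrite /S; apply: eq_bigl => j; rewrite ltn_ord.
  by rewrite /S big1 ?addr0.
rewrite /shift_energy; under eq_bigr do rewrite tel.
apply: (@le_trans _ _ (\sum_z (m%:R * \sum_(i < m)
   (g (z + \sum_(j < m | (j < i)%N) a j + a i)
                  - g (z + \sum_(j < m | (j < i)%N) a j)) ^+ 2))).
  apply: ler_sum => z _; apply: (le_trans (sqr_sum_le_card _ _)).
  by rewrite cardT size_enum_ord.
rewrite -mulr_sumr exchange_big/= expr2 -mulrA ler_wpM2l//.
rewrite mulr_natl -[X in D *+ X]card_ord -sumr_const ler_sum// => i _.
apply: (le_trans _ (aD i)).
rewrite /shift_energy.
rewrite [leRHS](reindex_inj (addIr (\sum_(j < m | (j < i)%N) a j)))/=.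
exact: lexx.
Qed.
End torus.

Section torus_faber_krahn.
Variables (R : realFieldType) (d N : nat).
Local Notation G := 'rV['I_N.+1]_d.
Variable g : G -> R.

Definition unit_step (k : 'I_d) : G := \row_i (if i == k then inord 1 else 0).

Lemma inord1_mulrn (m : nat) : (m <= N)%N -> (inord 1 *+ m : 'I_N.+1) = m :> nat.
Proof.
move=> mN.
case: N mN => [|M] mM; first by rewrite ord1/=; lia.
elim: m mM => [|m IH] mM; first by rewrite mulr0n.
rewrite mulrS /= IH; last by lia.
by rewrite inordK// modn_small// add1n.
Qed.

Lemma torus_faber_krahn (n : nat) (D : R) : (n <= N.+1)%N ->
  (forall k, shift_energy g (unit_step k) <= D) ->
  (2 * #|[set z | g z != 0%R]%SET| <= n ^ d)%N ->
  \sum_z g z ^+ 2 <= 2 * d%:R ^+ 2 * n%:R ^+ 2 * D.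
Proof.
move=> nN gD sg.
(* An empty cube forces an empty support: [n ^ d] is 0, or 1 when [d = 0], and twice a cardinal
   bounded by 1 vanishes. *)
have [n0|n0] := posnP n.
  have /eqP : #|[set z | g z != 0%R]%SET| = 0%N.
    have [d0|d0] := posnP d.
      by have E : (n ^ d = 1)%N; [rewrite d0|move: sg; rewrite E; case: #|_| => [|m]; rewrite ?mulnS].
    by move: sg; rewrite n0 exp0n//; case: #|_| => [|m]; rewrite ?mulnS.
  rewrite cards_eq0 => /eqP E; rewrite big1 ?n0 ?expr0n/= ?mulr0 ?mul0r// => z _.
  by have /negbT := finset.in_set0 z; rewrite -E inE negbK => /eqP ->; rewrite expr0n.
pose emb (y : {ffun 'I_d -> 'I_n}) : G := \row_k inord (y k).
have embE y : emb y = \sum_k (unit_step k *+ y k).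
  apply/rowP => k; rewrite summxE mxE (bigD1 k)//= big1 ?addr0; last first.
    move=> i ik; rewrite mulmxnE mxE.
    by rewrite eq_sym (negbTE ik) mul0rn.
  rewrite mulmxnE mxE eqxx; apply: val_inj => /=.
  have yN : (y k <= N)%N by rewrite -ltnS (leq_trans (ltn_ord (y k))).
  by rewrite inordK// inord1_mulrn.
have D0 (k : 'I_d) : 0 <= D.
  by apply: le_trans (gD k); apply: sumr_ge0 => z _; exact: sqr_ge0.
(* [shift_energy_sum] is used on two levels: a cube vector is a sum of [d] multiples of unit steps,
   and each multiple is a sum of fewer than [n] unit steps. *)
have en y : shift_energy g (emb y) <= (d%:R * n%:R) ^+ 2 * D.
  rewrite embE exprMn -mulrA; apply: shift_energy_sum => k.
  apply: (@le_trans _ _ ((y k)%:R ^+ 2 * D)).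
    by rewrite -[X in _ *+ X]card_ord -sumr_const; exact: shift_energy_sum.
  rewrite ler_wpM2r ?(D0 k)// lerXn2r ?nnegrE// ler_nat.
  exact: ltnW.
have embI : injective emb.
  move=> y y' /rowP E; apply/ffunP => k; apply: val_inj => /=.
  have := congr1 val (E k); rewrite !mxE/= !inordK//.
    exact: (leq_trans (ltn_ord _)).
  exact: (leq_trans (ltn_ord _)).
(* The translates of [z] by the [n ^ d] cube vectors are distinct, so at most half of them hit the
   support; for each of the others the difference is exactly [- g z]. *)
have cnt z : (n ^ d)%:R * g z ^+ 2 <= 2 * \sum_y (g (z + emb y) - g z) ^+ 2.
  set W := [set y | (g (z + emb y) != 0)%R]%SET.
  have W1 : (#|W| <= #|[set z | g z != 0%R]%SET|)%N.
    rewrite -(@card_imset _ _ (fun y => z + emb y)).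
      apply/subset_leq_card/fintype.subsetP => _ /imsetP[y yW ->].
      by move: yW; rewrite !inE.
    by move=> y y' /addrI /embI.
  have W2 : (n ^ d <= 2 * #|~: W|)%N.
    have := cardsC W; rewrite card_ffun !card_ord; lia.
  apply: (@le_trans _ _ (2 * \sum_(y in ~: W) g z ^+ 2)).
    rewrite sumr_const mulrnAr -mulrnAl -[X in _ <= X * _]mulr_natr.
    by rewrite ler_wpM2r ?sqr_ge0// -natrM ler_nat.
  rewrite ler_wpM2l// [leRHS](bigID (mem (~: W)))/= ler_wpDr//.
    by apply: sumr_ge0 => y _; exact: sqr_ge0.
  apply: ler_sum => y; rewrite inE inE negbK => /eqP ->.
  by rewrite sub0r sqrrN.
have n0' : 0 < (n ^ d)%:R :> R by rewrite ltr0n expn_gt0 n0.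
rewrite -(ler_pM2l n0').
apply: (@le_trans _ _ (2 * \sum_y shift_energy g (emb y))).
  rewrite exchange_big/= !mulr_sumr; apply: ler_sum => z _; exact: cnt.
apply: (@le_trans _ _ (2 * \sum_(y : {ffun 'I_d -> 'I_n}) ((d%:R * n%:R) ^+ 2 * D))).
  by rewrite ler_wpM2l// ler_sum.
rewrite sumr_const card_ffun !card_ord -[_ *+ (n ^ d)%N]mulr_natl.
move: ((n ^ d)%:R) => M; rewrite le_eqVlt; apply/orP; left; apply/eqP; ring.
Qed.

(** Counts offsets from [z0], raised by [m] to be natural numbers. All multiplicities below come
    from it: elements met by an edge, edges meeting an element, lattice points around a node. *)
Lemma card_grid_box (m : nat) (S : {set G}) (z0 : G) :
  (forall z k, z \in S -> (z ord0 k <= z0 ord0 k + m)%N /\ (z0 ord0 k <= z ord0 k + m)%N) ->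
  (#|S| <= m.*2.+1 ^ d)%N.
Proof.
move=> Sm; have -> : (m.*2.+1 ^ d)%N = #|{ffun 'I_d -> 'I_m.*2.+1}|.
  by rewrite card_ffun !card_ord.
pose f (z : G) : {ffun 'I_d -> 'I_m.*2.+1} := [ffun k => inord (z ord0 k + m - z0 ord0 k)].
rewrite -(@card_in_imset _ _ f S); first exact: max_card.
move=> z z' zS z'S /ffunP E; apply/rowP => k; rewrite (_ : 0 = ord0); last exact: val_inj.
apply: val_inj => /=.
have := congr1 val (E k); rewrite !ffunE/= !inordK.
all: have [] := Sm z k zS; have [] := Sm z' k z'S.
all: move: (nat_of_ord (z ord0 k)) (nat_of_ord (z' ord0 k)) (nat_of_ord (z0 ord0 k)) => a b c; lia.
Qed.
End torus_faber_krahn.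

(** * Stampacchia's iteration *)

Lemma le0_geometric (R : realType) (x a r : R) : 0 <= r < 1 ->
  (forall n : nat, x <= a * r ^+ n) -> x <= 0.
Proof.
move=> /andP[r0 r1] xa.
have c : (fun n => a * r ^+ n) @ \oo --> (0 : R).
  rewrite -[X in _ --> X](mulr0 a); apply: cvgMr; apply: cvg_expr.
  by rewrite ger0_norm.
apply: (@ler_cvg_to _ _ _ _ (cst x) _ _ _ (cvg_cst _) c).
by near=> n; exact: xa.
Unshelve. all: by end_near. Qed.

(** Along the levels [k0 + D * (1 - 2^-1 ^+ n)] the decay [phi k0 * r ^+ n] reproduces itself: [r]
    satisfies [r ^ beta = 1/2], so the superlinear power gains a factor [2^-n], which pays for the
    increment [D * 2^-(n+1)] between consecutive levels. *)
Lemma stampacchia (R : realType) (phi : R -> R) (k0 M beta D : R) :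
  0 < beta -> 0 <= M -> 0 < D -> (forall k, 0 <= phi k) ->
  {homo phi : x y / x <= y >-> y <= x} ->
  (forall k l, k0 <= k -> 0 < l -> l * phi (k + l) <= M * (phi k) `^ (1 + beta)) ->
  2 * M * (phi k0) `^ beta <= 2 `^ (- beta^-1) * D ->
  phi (k0 + D) = 0.
Proof.
move=> b0 M0 D0 p0 pm H; set r := 2 `^ _ => HD.
have r0 : 0 < r by rewrite powR_gt0.
have r1 : r < 1.
  rewrite /r powRN invf_lt1 ?powR_gt0// -[X in X < _](_ : 1 `^ beta^-1 = 1).
    by rewrite gt0_ltr_powR ?invr_gt0 ?nnegrE ?ltr1n.
  by rewrite powR1.
have rb : r `^ beta = 2^-1.
  by rewrite /r -powRrM mulNr mulVf ?gt_eqF// powR_inv1.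
have step (n : nat) : phi (k0 + D * (1 - 2^-1 ^+ n)) <= phi k0 * r ^+ n.
  elim: n => [|n IH]; first by rewrite !expr0 subrr mulr0 addr0 mulr1.
  set k := k0 + _ in IH.
  have l0 : 0 < D * 2^-1 ^+ n.+1 by rewrite mulr_gt0// exprn_gt0// invr_gt0.
  have kk : k0 <= k.
    rewrite /k lerDl mulr_ge0 ?(ltW D0)// subr_ge0 exprn_ile1// ?invr_ge0//.
    by rewrite invf_le1// ler1n.
  have := H k _ kk l0.
  rewrite (_ : k + _ = k0 + D * (1 - 2^-1 ^+ n.+1)); last first.
    by rewrite /k exprS; field.
  move=> H1; rewrite -(ler_pM2l l0); apply: (le_trans H1).
  have pr0 : 0 <= phi k0 * r ^+ n by rewrite mulr_ge0// exprn_ge0// ltW.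
  apply: (@le_trans _ _ (M * (phi k0 * r ^+ n) `^ (1 + beta))).
    by rewrite ler_wpM2l// ge0_ler_powR// ?nnegrE// addr_ge0// ltW.
  rewrite powRD; last by rewrite gt_eqF ?addr_gt0.
  rewrite powRr1// [X in _ * (_ * X)]powRM// ?exprn_ge0 ?(ltW r0)//.
  have -> : (r ^+ n) `^ beta = 2^-1 ^+ n.
    by rewrite -[r ^+ n]powR_mulrn ?(ltW r0)// -powRrM mulrC powRrM rb powR_mulrn.
  have -> : M * (phi k0 * r ^+ n * (phi k0 `^ beta * 2^-1 ^+ n)) =
     (phi k0 * r ^+ n * 2^-1 ^+ n.+1) * (2 * M * phi k0 `^ beta).
    by rewrite exprS; field.
  have -> : D * 2^-1 ^+ n.+1 * (phi k0 * r ^+ n.+1) =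
     (phi k0 * r ^+ n * 2^-1 ^+ n.+1) * (r * D).
    by rewrite [r ^+ _]exprS; ring.
  by rewrite ler_wpM2l// mulr_ge0// exprn_ge0// invr_ge0.
apply/eqP; rewrite eq_le p0 andbT.
apply: (@le0_geometric _ _ (phi k0) r); first by rewrite r1 ltW.
move=> n; apply: le_trans (step n); apply: pm.
rewrite lerD2l ler_piMr ?(ltW D0)// gerBl exprn_ge0// invr_ge0//.
Qed.

(** The choice [k0 = F ^ th * V ^ (1 - th)] gives [V / k0 = (V / F) ^ th] and turns the second term
    into [K * k0]. If [F] or [V] vanishes this [k0] is not positive, and an arbitrarily small [k0]
    is taken instead. *)
Lemma le_interpolation (R : realType) (X F V K th : R) :
  0 < th < 1 -> 0 <= F -> 0 <= V -> 0 <= K ->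
  (forall k0, 0 < k0 -> X <= k0 + K * F * (V / k0) `^ (th^-1 - 1)) ->
  X <= (1 + K) * F `^ th * V `^ (1 - th).
Proof.
move=> /andP[t0 t1] F0 V0 K0 H.
have g0 : 0 < th^-1 - 1 by rewrite subr_gt0 invf_gt1.
have [F00|F00] := eqVneq F 0.
  rewrite F00 powR0 ?gt_eqF// mulr0 mul0r; apply/ler_addgt0Pr => e e0.
  by have := H e e0; rewrite F00 mulr0 mul0r addr0 add0r.
have [V00|V00] := eqVneq V 0.
  rewrite V00 powR0 ?subr_eq0 ?gt_eqF// mulr0; apply/ler_addgt0Pr => e e0.
  by have := H e e0; rewrite V00 mul0r powR0 ?gt_eqF// mulr0 addr0 add0r.
have Fp : 0 < F by rewrite lt_def F00.
have Vp : 0 < V by rewrite lt_def V00.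
set k0 := F `^ th * V `^ (1 - th).
have k0p : 0 < k0 by rewrite mulr_gt0 ?powR_gt0.
have := H k0 k0p.
have -> : V / k0 = (V / F) `^ th.
  rewrite /k0 powRM// ?invr_ge0// ?ltW// invfM mulrCA mulrA.
  rewrite -!powRN -powR_inv1 ?ltW// -powRrM mulN1r [X in _ = X * _](_ : _ = V * V `^ (- (1 - th))).
    by ring.
  rewrite -[X in X * _]powRr1 ?ltW// -powRD ?V00 ?implybT//.
  by congr (_ `^ _); ring.
rewrite -powRrM [X in _ `^ X](_ : _ = 1 - th); last first.
  by rewrite mulrBr mulr1 mulfV// gt_eqF.
have -> : K * F * (V / F) `^ (1 - th) = K * k0.
  rewrite -mulrA; congr (_ * _); rewrite /k0.
  rewrite powRM// ?invr_ge0// ?ltW// mulrCA mulrC; congr (_ * _).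
  rewrite -powR_inv1 ?ltW// -powRrM -[X in X * _]powRr1 ?ltW// -powRD ?F00 ?implybT//.
  by congr (_ `^ _); ring.
by rewrite -[X in X + _]mul1r -mulrDl -mulrA.
Qed.

(** * Barycentric coordinates *)

Section barycentric_coordinates.
Context {R : realType} {d n : nat}.
Variables (P : 'I_n -> 'rV[R]_d) (s : {set 'I_n}).

(** The rows are the vertices in homogeneous coordinates [(1, P i)]: barycentric coordinates of [x]
    are the coefficients of [(1, x)] in these rows. A pseudo-inverse keeps [lam] total; it inverts
    [vertex_mx] when the simplex is full. *)
Definition vertex_mx : 'M[R]_(#|s|, 1 + d) :=
  \matrix_(m, k) row_mx (1%:M : 'M[R]_1) (P (enum_val m)) 0 k.

Definition grad_lam (i : 'I_n) (k : 'I_d) : R :=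
  \sum_(m < #|s|) (enum_val m == i)%:R * pinvmx vertex_mx (rshift 1 k) m.

(** Written as a constant plus a linear form, so that it is visibly affine on the whole space, with
    constant gradient [grad_lam]; indices outside [s] get 0. *)
Definition lam (i : 'I_n) (x : 'rV[R]_d) : R :=
  \sum_(m < #|s|) (enum_val m == i)%:R * pinvmx vertex_mx (lshift d 0) m +
  \sum_k x ord0 k * grad_lam i k.

Lemma lamE i x : lam i x =
  \sum_(m < #|s|) (enum_val m == i)%:R * (row_mx (1%:M : 'M[R]_1) x *m pinvmx vertex_mx) 0 m.
Proof.
under [RHS]eq_bigr => m _.
  rewrite mxE big_split_ord big_ord1/= row_mxEl mxE eqxx mul1r mulrDr mulr_sumr.
  over.
rewrite big_split/=; congr (_ + _).
rewrite exchange_big/=; apply: eq_bigr => k _.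
rewrite /grad_lam mulr_sumr; apply: eq_bigr => m _.
by rewrite row_mxEr mulrCA.
Qed.

Hypothesis hs : full_simplex P s.

Lemma sum_over_simplex (V : nmodType) (F : 'I_n -> V) :
  (forall i, i \notin s -> F i = 0) -> \sum_i F i = \sum_(m < #|s|) F (enum_val m).
Proof.
move=> F0; rewrite (bigID (mem s))/= [X in _ + X]big1 ?addr0//.
by rewrite big_enum_val.
Qed.

(** A row vector killing the matrix, extended by 0 off [s], is an affine dependence: the first
    column says that its sum is 0, the others that the combination of the vertices is 0. *)
Lemma vertex_mx_free : row_free vertex_mx.
Proof.
apply: inj_row_free => u u0.
have [_ ai] := hs.
pose c (i : 'I_n) : R := \sum_(m < #|s|) (enum_val m == i)%:R * u 0 m.
have cE m : c (enum_val m) = u 0 m.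
  rewrite /c (bigD1 m)//= eqxx mul1r big1 ?addr0// => m' mm'.
  by rewrite (inj_eq enum_val_inj) (negbTE mm') mul0r.
have c0 i : i \notin s -> c i = 0.
  move=> si; rewrite /c big1// => m _; case: eqP => [mi|]; last by rewrite mul0r.
  by move: si; rewrite -mi enum_valP.
have u0' k : \sum_(m < #|s|) u 0 m * vertex_mx m k = 0.
  by have /rowP/(_ k) := u0; rewrite !mxE.
have C i : c i = 0.
  apply: ai => //.
    rewrite sum_over_simplex//; under eq_bigr do rewrite cE.
    rewrite -[RHS](u0' (lshift d 0)); apply: eq_bigr => m _.
    by rewrite mxE row_mxEl [_%:M _ _]mxE eqxx mulr1.
  rewrite sum_over_simplex; last by move=> j /c0 ->; rewrite scale0r.
  apply/rowP => k; rewrite summxE [RHS]mxE -[RHS](u0' (rshift 1 k)).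
  by apply: eq_bigr => m _; rewrite mxE cE [vertex_mx _ _]mxE row_mxEr.
by apply/rowP => m; rewrite -cE C mxE.
Qed.

Lemma vertex_mx_full : row_full vertex_mx.
Proof.
rewrite /row_full; have := vertex_mx_free; rewrite /row_free => /eqP ->.
by have [-> _] := hs.
Qed.

Lemma barycentric_lam x : barycentric P s x (lam ^~ x).
Proof.
set u := row_mx (1%:M : 'M[R]_1) x *m pinvmx vertex_mx.
have uV : u *m vertex_mx = row_mx 1 x.
  by rewrite /u -mulmxA mulVpmx ?mulmx1// vertex_mx_full.
have lE m : lam (enum_val m) x = u 0 m.
  rewrite lamE (bigD1 m)//= eqxx mul1r big1 ?addr0// => m' mm'.
  by rewrite (inj_eq enum_val_inj) (negbTE mm') mul0r.
have l0 i : i \notin s -> lam i x = 0.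
  move=> si; rewrite lamE big1// => m _; case: eqP => [mi|]; last by rewrite mul0r.
  by move: si; rewrite -mi enum_valP.
split => //.
  rewrite sum_over_simplex//.
  have /rowP/(_ (lshift d 0)) := uV; rewrite row_mxEl [RHS]mxE eqxx mulr1n mxE => <-.
  by apply: eq_bigr => m _; rewrite lE [vertex_mx _ _]mxE row_mxEl [_%:M _ _]mxE eqxx mulr1.
rewrite sum_over_simplex; last by move=> j /l0 ->; rewrite scale0r.
apply/rowP => k; rewrite summxE.
have /rowP/(_ (rshift 1 k)) := uV; rewrite row_mxEr mxE => <-.
by apply: eq_bigr => m _; rewrite [RHS]mxE lE [vertex_mx _ _]mxE row_mxEr.
Qed.

Lemma lam_notin i x : i \notin s -> lam i x = 0.
Proof. by have [+ _ _] := barycentric_lam x; apply. Qed.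

Lemma sum_lam x : \sum_i lam i x = 1.
Proof. by have [] := barycentric_lam x. Qed.

Lemma sum_lam_vertex x : \sum_i lam i x *: P i = x.
Proof. by have [_ _ <-] := barycentric_lam x. Qed.

Lemma barycentric_uniq x l : barycentric P s x l -> forall i, l i = lam i x.
Proof.
move=> [l0 l1 lx] i; apply/eqP; rewrite -subr_eq0; apply/eqP.
have [_ ai] := hs; apply: (ai (fun i => l i - lam i x)).
- by move=> j js; rewrite l0// lam_notin// subrr.
- by rewrite sumrB l1 sum_lam subrr.
- under eq_bigr do rewrite scalerBl.
  by rewrite sumrB -lx sum_lam_vertex subrr.
Qed.

Lemma in_closed_simplex x :
  closed_simplex P s x <-> forall i, 0 <= lam i x.
Proof.
split=> [[l [bl l0]] i|H]; last by exists (lam ^~ x); split; [exact: barycentric_lam|].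
have [/l0|si] := boolP (i \in s); first by rewrite (barycentric_uniq bl).
by rewrite lam_notin.
Qed.

Lemma in_open_simplex x :
  open_simplex P s x <-> forall i, i \in s -> 0 < lam i x.
Proof.
split=> [[l [bl l0]] i /l0|H].
  by rewrite (barycentric_uniq bl).
by exists (lam ^~ x); split; [exact: barycentric_lam|].
Qed.

Lemma open_simplex_closed : open_simplex P s `<=` closed_simplex P s.
Proof.
move=> x /in_open_simplex H; apply/in_closed_simplex => i.
by have [/H/ltW//|/lam_notin->] := boolP (i \in s).
Qed.

Lemma lam_vertex i j : i \in s -> lam j (P i) = (i == j)%:R.
Proof.
move=> si; rewrite -(@barycentric_uniq (P i) (fun j => (i == j)%:R))//; split.
- by move=> k; case: eqP => // <-; rewrite si.
- by rewrite (bigD1 i)//= eqxx big1 ?addr0// => k; rewrite eq_sym => /negbTE ->.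
- rewrite (bigD1 i)//= eqxx scale1r big1 ?addr0// => k.
  by rewrite eq_sym => /negbTE ->; rewrite scale0r.
Qed.

Lemma lam_conv i (t : R) x y :
  lam i (x + t *: (y - x)) = lam i x + t * (lam i y - lam i x).
Proof.
rewrite /lam; set c := \sum_(m < #|s|) _.
have -> : \sum_k (x + t *: (y - x)) ord0 k * grad_lam i k =
   \sum_k x ord0 k * grad_lam i k +
   t * (\sum_k y ord0 k * grad_lam i k - \sum_k x ord0 k * grad_lam i k).
  rewrite -sumrB mulr_sumr -big_split/=.
  by apply: eq_bigr => k _; rewrite !mxE; ring.
by ring.
Qed.

Lemma lam_comb_vertices (l : 'I_n -> R) i : (forall j, j \notin s -> l j = 0) ->
  \sum_j l j = 1 -> lam i (\sum_j l j *: P j) = l i.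
Proof. by move=> l0 l1; rewrite -(@barycentric_uniq _ l). Qed.

Lemma lam_le1 i x : closed_simplex P s x -> lam i x <= 1.
Proof.
move=> /in_closed_simplex H; rewrite -(sum_lam x) (bigD1 i)//= lerDl.
by rewrite sumr_ge0.
Qed.

Lemma lam_pair_le1 i j x : i != j -> closed_simplex P s x ->
  lam i x + lam j x <= 1.
Proof.
move=> ij /in_closed_simplex xs; rewrite -(sum_lam x) (bigD1 i)//= (bigD1 j)/=.
  by rewrite addrA lerDl sumr_ge0.
by rewrite eq_sym.
Qed.

Lemma lam_continuous i : continuous (lam i : 'rV[R]_d -> R).
Proof.
rewrite /lam => x; set c := \sum_(m < #|s|) _.
apply: (@continuousD _ _ _ (cst c)); first exact: cst_continuous.
apply: (@continuous_big _ _ _ _ _ add_continuous) => k _ {}x.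
by apply: continuousM; [exact: coord_continuous|exact: cst_continuous].
Qed.

Lemma closed_closed_simplex : closed (closed_simplex P s).
Proof.
have -> : closed_simplex P s = \bigcap_i [set x | 0 <= lam i x].
  apply/seteqP; split => x.
    by move=> /in_closed_simplex H i _; exact: H.
  by move=> H; apply/in_closed_simplex => i; exact: H.
apply: closed_bigI => i _.
have /continuous_closedP/(_ [set y | 0 <= y]) := @lam_continuous i; apply.
exact: closed_ge.
Qed.

Lemma open_open_simplex : open (open_simplex P s).
Proof.
have -> : open_simplex P s = ~` \bigcup_(i in [set` s]) [set x | lam i x <= 0].
  apply/seteqP; split => x.
    by move=> /in_open_simplex H [i si] /=; rewrite leNgt H.
  move=> H; apply/in_open_simplex => i si; rewrite ltNge; apply/negP => li.
  by apply: H; exists i.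
apply: closed_openC; apply: closed_bigcup; first exact: finite_finset.
move=> i _.
have /continuous_closedP/(_ [set y | y <= 0]) := @lam_continuous i; apply.
exact: closed_le.
Qed.

Definition centroid : 'rV[R]_d := \sum_i (if i \in s then d.+1%:R^-1 else 0) *: P i.

Lemma lam_centroid i : i \in s -> lam i centroid = d.+1%:R^-1.
Proof.
move=> si; rewrite lam_comb_vertices ?si//.
  by move=> j /negbTE ->.
rewrite -big_mkcond/= sumr_const; have [-> _] := hs.
by rewrite -[LHS]mulr_natl mulfV// pnatr_eq0.
Qed.

(** Each coordinate of the moved point is [1 - t] times a nonnegative number plus [t] times a
    positive one. Statements about open simplices pass to closed ones by letting [t] tend to 0. *)
Lemma open_simplex_toward y x (t : R) : open_simplex P s y -> closed_simplex P s x ->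
  0 < t <= 1 -> open_simplex P s (x + t *: (y - x)).
Proof.
move=> /in_open_simplex yo /in_closed_simplex xc /andP[t0 t1].
apply/in_open_simplex => i si; rewrite lam_conv.
have -> : lam i x + t * (lam i y - lam i x) = (1 - t) * lam i x + t * lam i y by ring.
by rewrite ltr_wpDl ?mulr_gt0 ?yo// mulr_ge0// subr_ge0.
Qed.

Lemma centroid_open : open_simplex P s centroid.
Proof. by apply/in_open_simplex => i si; rewrite lam_centroid// invr_gt0. Qed.

Lemma closed_simplex_closure : closed_simplex P s `<=` closure (open_simplex P s).
Proof.
move=> x xc; apply: (@closure_subset _ [set x + t *: (centroid - x) | t in `]0, 1]]).
  move=> _ [t /= + <-]; rewrite in_itv/= => t01.
  exact: (open_simplex_toward centroid_open).
have f_cont : (fun t : R => x + t *: (centroid - x)) @ 0^'+ --> x.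
  rewrite -[X in _ --> X]addr0; apply: cvgD; first exact: cvg_cst.
  rewrite -[X in _ --> X](scale0r (centroid - x)); apply: cvgZl.
  exact: cvg_at_right_filter.
move=> B /f_cont nB.
have {nB} : \forall t \near (0 : R)^'+, B (x + t *: (centroid - x)) by exact: nB.
have : \forall t \near (0 : R)^'+, 0 < t <= 1.
  by near=> t; apply/andP; split; near: t; [exact: nbhs_right_gt|exact: nbhs_right_le].
move=> /filterI /[apply] /filter_ex [t /= [t01 Bt]].
exists (x + t *: (centroid - x)); split => //.
by exists t => //=; rewrite in_itv.
Unshelve. all: by end_near. Qed.

End barycentric_coordinates.

(** * The mesh and its hat functions *)

Lemma within_bigcup_continuous (S : topologicalType) (V : topologicalType)
    (J : choiceType) (r : seq J) (F : J -> set S) (f : S -> V) :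
  (forall j, j \in r -> closed (F j) /\ {within F j, continuous f}) ->
  {within \bigcup_(j in [set` r]) F j, continuous f}.
Proof.
rewrite bigcup_seq; elim: r => [|j r IH] H.
  by rewrite big_nil; move=> x; exact: continuous_subspace0.
rewrite big_cons.
have [cj wj] := H j (mem_head _ _).
apply: withinU_continuous => //.
  apply: closed_bigsetU => k kr; have [] := H k; by rewrite ?inE ?kr ?orbT.
by apply: IH => k kr; apply: H; rewrite inE kr orbT.
Qed.

Section triangulation.
Context {R : realType} {d : nat} {Omega : set 'rV[R]_d}.
Variable T : triangulation Omega.
Local Notation n := (nnodes T).
Local Notation P := (node T).
Local Notation el := (elements T).

(** Conformity places [x] in the simplex of the common vertices; its coordinates there, extended by
    0, are barycentric for both elements. *)
Lemma lam_conforming s t i x : s \in el -> t \in el ->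
  closed_simplex P s x -> closed_simplex P t x -> lam P s i x = lam P t i x.
Proof.
move=> sel tel xs xt.
have fs := elements_simplex sel; have ft := elements_simplex tel.
have : (closed_simplex P s `&` closed_simplex P t) x by [].
rewrite (elements_conforming sel tel) => -[l [[l0 l1 lx] lge]].
rewrite -(@barycentric_uniq _ _ _ _ _ fs x l) -?(@barycentric_uniq _ _ _ _ _ ft x l)//.
all: by split=> // j js; apply: l0; rewrite finset.in_setI (negbTE js) ?andbF.
Qed.

(** The coordinates of [x] in [s] are positive and agree with those in [t], so every vertex of [s]
    is one of [t]; both have [d + 1] vertices. *)
Lemma open_simplex_inj s t x : s \in el -> t \in el ->
  open_simplex P s x -> closed_simplex P t x -> s = t.
Proof.
move=> sel tel xs xt.
have fs := elements_simplex sel; have ft := elements_simplex tel.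
have xs' := open_simplex_closed fs xs.
apply/eqP; rewrite eqEcard; apply/andP; split; last first.
  by have [-> _] := fs; have [-> _] := ft.
apply/fintype.subsetP => i si; apply/negPn/negP => ti.
have /(in_open_simplex fs) /(_ i si) := xs.
by rewrite (lam_conforming i sel tel xs' xt) (lam_notin ft _ ti) ltxx.
Qed.

Definition mesh_union := \bigcup_(s in [set` el]) closed_simplex P s.

Lemma closed_mesh_union : closed mesh_union.
Proof.
apply: closed_bigcup; first exact: finite_finset.
by move=> s /= sel; apply: closed_closed_simplex; exact: elements_simplex.
Qed.

Lemma mesh_domainE : Omega = interior mesh_union.
Proof. exact: elements_cover. Qed.

Lemma domain_open : open Omega.
Proof. by rewrite mesh_domainE; exact: open_interior. Qed.

Lemma domain_sub : Omega `<=` mesh_union.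
Proof. by rewrite [X in X `<=` _]mesh_domainE; exact: interior_subset. Qed.

Lemma closure_domain : closure Omega = mesh_union.
Proof.
apply/seteqP; split.
  rewrite closureE => x; apply; split; [exact: closed_mesh_union|exact: domain_sub].
move=> x [s /= sel xs]; apply: (closure_subset (@elements_sub _ _ _ T s sel)).
by apply: closed_simplex_closure => //; exact: elements_simplex.
Qed.

Lemma boundary_domain x : boundary Omega x <-> mesh_union x /\ ~ Omega x.
Proof.
have /interior_id oO := domain_open.
by rewrite /boundary closure_domain oO.
Qed.

Lemma node_closed j s : s \in el -> j \in s -> closed_simplex P s (P j).
Proof.
move=> sel js; have fs := elements_simplex sel.
by apply/(in_closed_simplex fs) => i; rewrite (lam_vertex fs).
Qed.

Lemma node_mesh_union j : mesh_union (P j).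
Proof. by have [s sel js] := node_elements j; exists s => //; exact: node_closed. Qed.

(** By [lam_conforming] the picked element does not matter. The value 0 off the mesh makes hats
    functions on the whole space, as sampling on a lattice requires. *)
Definition hat (i : 'I_n) (x : 'rV[R]_d) : R :=
  if [pick s | (s \in el) && `[< closed_simplex P s x >]] is Some s
  then lam P s i x else 0.

Lemma hatE s i x : s \in el -> closed_simplex P s x -> hat i x = lam P s i x.
Proof.
move=> sel xs; rewrite /hat; case: pickP => [t /andP[tel /asboolP xt]|/(_ s)].
  exact: lam_conforming.
by rewrite sel/=; move/negP; case; apply/asboolP.
Qed.

Lemma hat_out i x : ~ mesh_union x -> hat i x = 0.
Proof.
move=> xD; rewrite /hat; case: pickP => // t /andP[tel /asboolP xt].
by case: xD; exists t.
Qed.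

Lemma hat_ge0 i x : 0 <= hat i x.
Proof.
rewrite /hat; case: pickP => // t /andP[tel /asboolP].
by move=> /(in_closed_simplex (elements_simplex tel)).
Qed.

Lemma hat_node i j : hat i (P j) = (j == i)%:R.
Proof.
have [s sel js] := node_elements j.
by rewrite (hatE _ sel (node_closed sel js)) lam_vertex//; exact: elements_simplex.
Qed.

(* Near [P i] only the elements with vertex [P i] matter, and they cover a neighborhood
   of [P i]. The homothety [zz] centered at [P i] carries this covering to a neighborhood
   of [x], since no barycentric coordinate but the i-th can become negative under its
   inverse. *)
Lemma hat_gt0_domain i x : Omega (P i) -> 0 < hat i x -> Omega x.
Proof.
move=> Oi xi.
have [s sel xs] : mesh_union x.
  by apply: contrapT => /(hat_out i) h; rewrite h ltxx in xi.
rewrite (hatE _ sel xs) in xi.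
have fs := elements_simplex sel.
have is_ : i \in s.
  by apply/negPn/negP => /(lam_notin fs x) h; rewrite h ltxx in xi.
have nW : \forall y \near P i, Omega y /\
    forall t, t \in el -> i \notin t -> ~ closed_simplex P t y.
  apply: filterI; first exact: (open_nbhs_nbhs (conj domain_open Oi)).
  apply: (@filter_forall _ _
    (fun t y => t \in el -> i \notin t -> ~ closed_simplex P t y)
    (nbhs _) (nbhs_filter _)) => t.
  have [tel|] := boolP (t \in el); last by move=> _; apply: nearW.
  have [it|it] := boolP (i \in t); first by apply: nearW.
  have ft := elements_simplex tel.
  have : ~ closed_simplex P t (P i).
    move=> Pt; have := lam_conforming i tel sel Pt (node_closed sel is_).
    by rewrite (lam_notin ft _ it) (lam_vertex fs)// eqxx => /eqP; rewrite eq_sym oner_eq0.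
  have := closed_closed_simplex ft; rewrite -openC => oC Pt.
  by have := open_nbhs_nbhs (conj oC Pt); apply: filterS => y yt _ _.
have zcont (y : 'rV[R]_d) : (fun t : R => P i + t *: (y - P i)) @ 0^'+ --> P i.
  rewrite -[X in _ --> X]addr0; apply: cvgD; first exact: cvg_cst.
  rewrite -[X in _ --> X](scale0r (y - P i)); apply: cvgZl.
  exact: cvg_at_right_filter.
have [e [[Wz Wt] /andP[e0 e1]]] : exists e : R, (Omega (P i + e *: (x - P i)) /\
   (forall t, t \in el -> i \notin t -> ~ closed_simplex P t (P i + e *: (x - P i)))) /\
   0 < e <= 1.
  have nW' : \forall t \near (0 : R)^'+, Omega (P i + t *: (x - P i)) /\
    (forall s', s' \in el -> i \notin s' -> ~ closed_simplex P s' (P i + t *: (x - P i))).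
    exact: (zcont x _ nW).
  have : \forall t \near (0 : R)^'+, 0 < t <= 1.
    by near=> t; apply/andP; split; near: t; [exact: nbhs_right_gt|exact: nbhs_right_le].
  by move=> /(filterI nW') /filter_ex [e [[H0 H1] H2]]; exists e; split.
set zz := fun y => P i + e *: (y - P i).
have zzc : continuous zz.
  move=> y; rewrite /zz; apply: (@cvgD _ _ _ (nbhs y)); first exact: cvg_cst.
  apply: (@cvgZ _ _ _ (nbhs y)); first exact: cvg_cst.
  by apply: (@cvgB _ _ _ (nbhs y)); [exact: cvg_id|exact: cvg_cst].
have zs : closed_simplex P s (zz x).
  apply/(in_closed_simplex fs) => j; rewrite lam_conv (lam_vertex fs)//.
  have := (in_closed_simplex fs x).1 xs j.
  have [_|_] := eqVneq i j; last by rewrite add0r subr0 => ?; rewrite mulr_ge0// ltW.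
  rewrite mulr1n => lj; rewrite mulrBr mulr1 addrA addrAC addr_ge0 ?subr_ge0 ?mulr_ge0 ?(ltW e0)//.
rewrite mesh_domainE.
have nW2 : \forall y \near x, Omega (zz y) /\
    forall t, t \in el -> i \notin t -> ~ closed_simplex P t (zz y).
  suff : \forall z \near zz x, Omega z /\
      forall t, t \in el -> i \notin t -> ~ closed_simplex P t z.
    exact: zzc.
  apply: filterI.
    exact: (open_nbhs_nbhs (conj domain_open Wz)).
  apply: (@filter_forall _ _
    (fun t y => t \in el -> i \notin t -> ~ closed_simplex P t y)
    (nbhs _) (nbhs_filter _)) => t.
  have [tel|] := boolP (t \in el); last by move=> _; apply: nearW.
  have [it|it] := boolP (i \in t); first by apply: nearW.
  have := closed_closed_simplex (elements_simplex tel); rewrite -openC => oC.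
  by have := open_nbhs_nbhs (conj oC (Wt t tel it)); apply: filterS => y yt _ _.
have nT : \forall y \near x, forall t, t \in el -> i \in t ->
    closed_simplex P t (zz y) -> 0 < lam P t i y.
  apply: (@filter_forall _ _
    (fun t y => t \in el -> i \in t -> closed_simplex P t (zz y) ->
      0 < lam P t i y)
    (nbhs _) (nbhs_filter _)) => t.
  have [tel|] := boolP (t \in el); last by move=> _; apply: nearW.
  have [it|] := boolP (i \in t); last by move=> _; apply: nearW.
  have ft := elements_simplex tel.
  have [zt|zt] := pselect (closed_simplex P t (zz x)).
    have xt : 0 < lam P t i x.
      have := lam_conforming i tel sel zt zs.
      rewrite !lam_conv (lam_vertex ft)// (lam_vertex fs)// => /addrI/mulfI.
      by rewrite gt_eqF// => /(_ isT)/addIr ->.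
    have H : \forall y \near x, 0 < lam P t i y.
      exact: @lam_continuous _ _ _ P t i x _ (open_nbhs_nbhs (conj (@open_gt _ 0) xt)).
    by apply: filterS H => y yi _ _ _.
  have := closed_closed_simplex ft; rewrite -openC => oC.
  have H : \forall y \near x, ~ closed_simplex P t (zz y).
    exact: (zzc x _ (open_nbhs_nbhs (conj oC zt))).
  by apply: filterS H => y /= yt _ _ //.
near=> y.
have [Ozy ny] : Omega (zz y) /\ forall t, t \in el -> i \notin t -> ~ closed_simplex P t (zz y).
  by near: y.
have [t /= tel zt] := domain_sub Ozy.
have it : i \in t by apply/negPn/negP => /(ny t tel).
have ft := elements_simplex tel.
have yi : 0 < lam P t i y by move: t tel it zt {ft}; near: y.
exists t => //; apply/(in_closed_simplex ft) => j.
have [<-|ij] := eqVneq i j; first exact: ltW.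
have := (in_closed_simplex ft (zz y)).1 zt j.
by rewrite lam_conv (lam_vertex ft)// (negbTE ij) add0r subr0 pmulr_rge0.
Unshelve. all: by end_near. Qed.
End triangulation.

Section complex_parts.
Local Open Scope complex_scope.
Context {R : rcfType}.
Implicit Types x y : R[i].

Lemma ReD x y : complex.Re (x + y) = complex.Re x + complex.Re y.
Proof. by case: x y => ? ? []. Qed.

Lemma ImD x y : complex.Im (x + y) = complex.Im x + complex.Im y.
Proof. by case: x y => ? ? []. Qed.

Lemma Re_sum (J : Type) (r : seq J) (Q : pred J) (f : J -> R[i]) :
  complex.Re (\sum_(j <- r | Q j) f j) = \sum_(j <- r | Q j) complex.Re (f j).
Proof. exact: (big_morph _ ReD). Qed.

Lemma Im_sum (J : Type) (r : seq J) (Q : pred J) (f : J -> R[i]) :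
  complex.Im (\sum_(j <- r | Q j) f j) = \sum_(j <- r | Q j) complex.Im (f j).
Proof. exact: (big_morph _ ImD). Qed.

Lemma ReM_real x (t : R) : complex.Re (x * t%:C) = complex.Re x * t.
Proof. by case: x => a b; rewrite /= mulr0 subr0. Qed.

Lemma ImM_real x (t : R) : complex.Im (x * t%:C) = complex.Im x * t.
Proof. by case: x => a b; rewrite /= mulr0 add0r. Qed.

Lemma complexP x y : complex.Re x = complex.Re y -> complex.Im x = complex.Im y -> x = y.
Proof. by case: x y => ? ? [? ?] /= -> ->. Qed.

End complex_parts.

(** * Interpolation of nodal values and its zero extension *)

Section interpolation.
Local Open Scope complex_scope.
Context {R : realType} {d : nat} {Omega : set 'rV[R]_d}.
Variable T : triangulation Omega.
Local Notation n := (nnodes T).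
Local Notation P := (node T).
Local Notation el := (elements T).
Implicit Types (a : 'I_n -> R) (s : {set 'I_n}).

Definition interp a (x : 'rV[R]_d) : R := \sum_i a i * hat i x.

Lemma interpE a s x : s \in el -> closed_simplex P s x ->
  interp a x = \sum_i a i * lam P s i x.
Proof. by move=> sel xs; apply: eq_bigr => i _; rewrite (hatE _ sel xs). Qed.

Lemma interp_node a j : interp a (P j) = a j.
Proof.
rewrite /interp (bigD1 j)//= hat_node eqxx mulr1 big1 ?addr0// => i ij.
by rewrite hat_node eq_sym (negbTE ij) mulr0.
Qed.

(** Hats of interior nodes vanish off [Omega] by [hat_gt0_domain], and the other nodes carry the
    value 0. *)
Lemma interp_out a x : (forall j, ~ Omega (P j) -> a j = 0) -> ~ Omega x ->
  interp a x = 0.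
Proof.
move=> a0 xO; rewrite /interp big1// => i _.
have [Oi|/a0 ->] := pselect (Omega (P i)); last by rewrite mul0r.
have [/eqP ->|hi] := boolP (hat i x == 0); first by rewrite mulr0.
by case: xO; apply: (hat_gt0_domain Oi); rewrite lt_def hi hat_ge0.
Qed.

Lemma sum_lam_continuous a s : continuous (fun x : 'rV[R]_d => \sum_i a i * lam P s i x).
Proof.
apply: (@continuous_big _ _ _ _ _ add_continuous) => i _ x.
by apply: continuousM; [exact: cst_continuous|exact: lam_continuous].
Qed.

Lemma interp_within_continuous a : {within mesh_union T, continuous (interp a)}.
Proof.
have E : [set` enum el] = [set` el] by apply/seteqP; split => s /=; rewrite mem_enum.
rewrite /mesh_union -E.
apply: within_bigcup_continuous => s; rewrite mem_enum => sel; split.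
  by apply: closed_closed_simplex; exact: elements_simplex.
apply: (@subspace_eq_continuous _ _ _ (fun x => \sum_i a i * lam P s i x)).
  by move=> x; rewrite inE => xs; exact/esym/(interpE a sel xs).
exact/continuous_subspaceT/sum_lam_continuous.
Qed.

(** The closed sets [mesh_union T] and the complement of [Omega] cover the space; the function is
    piecewise affine on the first and 0 on the second, so it can be glued. *)
Lemma interp_continuous a : (forall j, ~ Omega (P j) -> a j = 0) ->
  continuous (interp a).
Proof.
move=> a0; apply/continuous_subspace_setT.
have -> : [set: 'rV[R]_d] = mesh_union T `|` ~` Omega.
  apply/seteqP; split => // x _.
  by have [/domain_sub|] := pselect (Omega x); [left|right].
apply: withinU_continuous.
- exact: closed_mesh_union.
- by apply: open_closedC; exact: (domain_open T).
- exact: interp_within_continuous.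
- apply: (@subspace_eq_continuous _ _ _ (fun=> 0)); last exact/continuous_subspaceT/cst_continuous.
  by move=> x; rewrite inE => xO; exact/esym/(interp_out a0 xO).
Qed.

Definition cinterp (a : 'I_n -> R[i]) (x : 'rV[R]_d) : R[i] :=
  interp (fun j => complex.Re (a j)) x +i* interp (fun j => complex.Im (a j)) x.

Lemma cinterp_node (a : 'I_n -> R[i]) j : cinterp a (P j) = a j.
Proof. by rewrite /cinterp !interp_node; case: (a j). Qed.

Lemma lam_affineE s i x : lam P s i x = lam P s i 0 + \sum_k grad_lam P s i k * x ord0 k.
Proof.
rewrite /lam [X in _ = _ + X + _]big1 ?addr0.
  by congr (_ + _); apply: eq_bigr => k _; rewrite mulrC.
by move=> k _; rewrite mxE mul0r.
Qed.

Lemma sum_lam_affineE a s x : \sum_i a i * lam P s i x =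
  \sum_i a i * lam P s i 0 + \sum_k (\sum_i a i * grad_lam P s i k) * x ord0 k.
Proof.
under eq_bigr do rewrite lam_affineE mulrDr.
rewrite big_split/=; congr (_ + _).
under [RHS]eq_bigr do rewrite mulr_suml.
rewrite exchange_big/=; apply: eq_bigr => i _; rewrite mulr_sumr.
by apply: eq_bigr => k _; rewrite mulrA.
Qed.

Lemma Vh_cinterp (a : 'I_n -> R[i]) : Vh T (cinterp a).
Proof.
split.
  rewrite /continuous_cplx (closure_domain T).
  by split; exact: interp_within_continuous.
move=> s sel; have fs := elements_simplex sel.
set ar := fun j => complex.Re (a j); set ai := fun j => complex.Im (a j).
exists ((\sum_i ar i * lam P s i 0) +i* (\sum_i ai i * lam P s i 0)),
  (fun k => (\sum_i ar i * grad_lam P s i k) +i* (\sum_i ai i * grad_lam P s i k)).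
move=> x /(open_simplex_closed fs) xs.
rewrite /cinterp !(interpE _ sel xs) sum_lam_affineE [X in _ +i* X]sum_lam_affineE.
apply: complexP.
  by rewrite ReD Re_sum; congr (_ + _); apply: eq_bigr => k _; rewrite ReM_real.
by rewrite ImD Im_sum; congr (_ + _); apply: eq_bigr => k _; rewrite ImM_real.
Qed.

Lemma Sh_cinterp (a : 'I_n -> R[i]) : (forall j, ~ Omega (P j) -> a j = 0) -> Sh T (cinterp a).
Proof.
move=> a0; split; first exact: Vh_cinterp.
move=> x /boundary_domain-/(_ T)[_ xO].
by rewrite /cinterp !interp_out// => j /a0 ->.
Qed.

(** Both functions are followed along the segment from [x] to the centroid, open at its far side. As
    [f] is continuous only within the mesh, the limit is taken in the subspace topology. *)
Lemma affine_closed_simplex (f g : 'rV[R]_d -> R) s : s \in el ->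
  {within mesh_union T, continuous f} -> continuous g ->
  {in open_simplex P s, f =1 g} -> {in closed_simplex P s, f =1 g}.
Proof.
move=> sel cf cg fg x; rewrite inE => xs.
have fs := elements_simplex sel.
have xD : mesh_union T x by exists s.
have cfg : {within mesh_union T, continuous (fun x => f x - g x)}.
  by move=> y; apply: continuousB; [exact: cf|exact: (continuous_subspaceT cg)].
have xt : (fun t : R => x + t *: (centroid P s - x)) @ 0^'+ --> x.
  rewrite -[X in _ --> X]addr0; apply: cvgD; first exact: cvg_cst.
  rewrite -[X in _ --> X](scale0r (centroid P s - x)); apply: cvgZl.
  exact: cvg_at_right_filter.
have to : \forall t \near (0 : R)^'+, open_simplex P s (x + t *: (centroid P s - x)).
  near=> t; apply: (open_simplex_toward fs (centroid_open fs) xs).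
  by apply/andP; split; near: t; [exact: nbhs_right_gt|exact: nbhs_right_le].
have /subspace_continuousP/(_ x xD) H := cfg.
have H1 : (fun t : R => f (x + t *: (centroid P s - x)) - g (x + t *: (centroid P s - x)))
   @ 0^'+ --> f x - g x.
  apply: (cvg_comp _ _ _ H) => B nB.
  have nB' : \forall t \near (0 : R)^'+, mesh_union T (x + t *: (centroid P s - x)) ->
      B (x + t *: (centroid P s - x)) by exact: (xt _ nB).
  apply: filterS (filterI nB' to) => t [h ot]; apply: h.
  by exists s => //; exact: open_simplex_closed.
have H2 : (fun t : R => f (x + t *: (centroid P s - x)) - g (x + t *: (centroid P s - x)))
   @ 0^'+ --> (0 : R).
  apply: cvg_near_cst; apply: filterS to => t ot.
  by rewrite fg ?subrr// inE.
by apply/eqP; rewrite -subr_eq0; apply/eqP; exact: (cvg_unique _ H1 H2).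
Unshelve. all: by end_near. Qed.

End interpolation.

(** * Functions of V_h and their gradients in terms of nodal values *)

Section nodal_values.
Local Open Scope complex_scope.
Context {R : realType} {d : nat} {Omega : set 'rV[R]_d}.
Variable T : triangulation Omega.
Local Notation n := (nnodes T).
Local Notation P := (node T).
Local Notation el := (elements T).
Implicit Types (a : 'I_n -> R) (s : {set 'I_n}).

Lemma affine_barycentric (al : R) (be : 'I_d -> R) s (x : 'rV[R]_d) : s \in el ->
  al + \sum_k be k * x ord0 k =
  \sum_i (al + \sum_k be k * P i ord0 k) * lam P s i x.
Proof.
move=> sel; have fs := elements_simplex sel.
under [RHS]eq_bigr do rewrite mulrDl mulr_suml.
rewrite big_split/= -mulr_sumr (sum_lam fs) mulr1; congr (_ + _).
rewrite exchange_big/=; apply: eq_bigr => k _.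
rewrite -{1}(sum_lam_vertex fs x) summxE mulr_sumr; apply: eq_bigr => i _.
by rewrite mxE mulrAC mulrA.
Qed.

Lemma nodal_expansion (f : 'rV[R]_d -> R) (al : R) (be : 'I_d -> R) s (x : 'rV[R]_d) : s \in el ->
  {within mesh_union T, continuous f} ->
  (forall y, open_simplex P s y -> f y = al + \sum_k be k * y ord0 k) ->
  closed_simplex P s x -> f x = \sum_i f (P i) * lam P s i x.
Proof.
move=> sel cf fE xs; have fs := elements_simplex sel.
have cg : continuous (fun y : 'rV[R]_d => al + \sum_k be k * y ord0 k).
  move=> y; apply: (@continuousD _ _ _ (cst al)); first exact: cst_continuous.
  apply: (@continuous_big _ _ _ _ _ add_continuous) => k _ {}y.
  by apply: continuousM; [exact: cst_continuous|exact: coord_continuous].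
have fg : {in closed_simplex P s, f =1 (fun y : 'rV[R]_d => al + \sum_k be k * y ord0 k)}.
  by apply: affine_closed_simplex => // y; rewrite inE; exact: fE.
rewrite fg ?inE// (affine_barycentric _ _ _ sel); apply: eq_bigr => i _.
have [si|si] := boolP (i \in s); last by rewrite (lam_notin fs _ si) !mulr0.
by rewrite [in RHS]fg// inE; exact: node_closed.
Qed.

Lemma Vh_expansion (v : 'rV[R]_d -> R[i]) s x : Vh T v -> s \in el ->
  closed_simplex P s x ->
  complex.Re (v x) = \sum_i complex.Re (v (P i)) * lam P s i x /\
  complex.Im (v x) = \sum_i complex.Im (v (P i)) * lam P s i x.
Proof.
move=> [[cr ci] aff] sel xs; have [a [b ab]] := aff _ sel.
move: cr ci; rewrite (closure_domain T) => cr ci; split.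
  apply: (nodal_expansion (f := fun x => complex.Re (v x))
      (al := complex.Re a) (be := fun k => complex.Re (b k))) => // y /ab ->.
  by rewrite ReD Re_sum; congr (_ + _); apply: eq_bigr => k _; rewrite ReM_real.
apply: (nodal_expansion (f := fun x => complex.Im (v x))
    (al := complex.Im a) (be := fun k => complex.Im (b k))) => // y /ab ->.
by rewrite ImD Im_sum; congr (_ + _); apply: eq_bigr => k _; rewrite ImM_real.
Qed.

Lemma Sh_node0 (v : 'rV[R]_d -> R[i]) j : Sh T v -> ~ Omega (P j) -> v (P j) = 0.
Proof.
move=> [_ v0] jO; apply: v0; apply/(boundary_domain T); split => //.
exact: node_mesh_union.
Qed.

Definition grad a s (k : 'I_d) : R := \sum_i a i * grad_lam P s i k.

(** The element is open, so the difference quotient is constant near 0 and the classical derivative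
    is read off without any limit. *)
Lemma partial_affine (f : 'rV[R]_d -> R) a s x k : s \in el ->
  (forall y, open_simplex P s y -> f y = \sum_i a i * lam P s i y) ->
  open_simplex P s x -> partial k f x = grad a s k.
Proof.
move=> sel fE xs; have fs := elements_simplex sel.
rewrite /partial /derive; apply: cvg_lim; first exact: Rhausdorff.
apply: cvg_near_cst.
have c0 : (fun h : R => h *: (delta_mx ord0 k : 'rV[R]_d) + x) @ 0^' --> x.
  rewrite -[X in _ --> X]add0r; apply: cvgD; last exact: cvg_cst.
  rewrite -[X in _ --> X](scale0r (delta_mx ord0 k : 'rV[R]_d)); apply: cvgZl.
  exact: cvg_within.
have no : \forall h \near (0 : R)^', open_simplex P s (h *: (delta_mx ord0 k : 'rV[R]_d) + x).
  exact: (c0 _ (open_nbhs_nbhs (conj (open_open_simplex fs) xs))).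
near=> h.
rewrite /= /shift !fE//; last by near: h.
have aE (y : 'rV[R]_d) : \sum_i a i * lam P s i y =
    \sum_i a i * lam P s i 0 + \sum_k grad a s k * y ord0 k by exact: sum_lam_affineE.
rewrite aE [X in _ - X]aE opprD addrACA subrr add0r -sumrB.
rewrite (bigD1 k)//= big1 ?addr0; last first.
  by move=> i ik; rewrite !mxE (negbTE ik) andbF mulr0 add0r subrr.
rewrite !mxE !eqxx mulr1 -mulrBr addrK mulrC /GRing.scale/= mulKf//.
by near: h; exact: nbhs_dnbhs_neq.
Unshelve. all: by end_near. Qed.

Lemma partial_cplx_Vh (v : 'rV[R]_d -> R[i]) s x k : Vh T v -> s \in el ->
  open_simplex P s x ->
  partial_cplx k v x = grad (fun i => complex.Re (v (P i))) s k +i*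
                       grad (fun i => complex.Im (v (P i))) s k.
Proof.
move=> vV sel xs; rewrite /partial_cplx; congr (_ +i* _).
  apply: partial_affine => // y /(open_simplex_closed (elements_simplex sel)) ys.
  by have [] := Vh_expansion vV sel ys.
apply: partial_affine => // y /(open_simplex_closed (elements_simplex sel)) ys.
by have [] := Vh_expansion vV sel ys.
Qed.

End nodal_values.

(** * Integrals of step functions *)

Section step_functions.
Local Open Scope complex_scope.
Context {disp : measure_display} {X : measurableType disp} {R : realType}.
Variable mu : {measure set X -> \bar R}.
Variables (J : finType) (A : J -> set X).
Hypothesis mA : forall j, measurable (A j).
Hypothesis fA : forall j, (mu (A j) < +oo)%E.

(** The sets may overlap, as barycentric domains do at ties. A product of two step functions is a
    step function on the pairwise intersections. *)
Definition stepfun (c : J -> R) (x : X) : R := \sum_j c j * \1_(A j) x.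

Lemma measurable_stepfun c : measurable_fun setT (stepfun c).
Proof.
apply: measurable_sum => j.
by apply: measurable_funM => //; exact: measurable_indic.
Qed.

Lemma integrable_indic_fin j : mu.-integrable setT (fun x => (\1_(A j) x)%:E).
Proof.
apply/integrableP; split; first exact/measurable_EFinP.
rewrite (eq_integral (fun x => (\1_(A j) x)%:E)); last first.
  by move=> x _; rewrite gee0_abs// lee_fin.
by rewrite integral_indic// setIT.
Qed.

Lemma integrable_indicZ j (r : R) : mu.-integrable setT (fun x => (r * \1_(A j) x)%:E).
Proof. exact: (integrableZl measurableT r (integrable_indic_fin j)). Qed.

Lemma integrable_stepfun c : mu.-integrable setT (EFin \o stepfun c).
Proof.
rewrite (_ : EFin \o _ = fun x => (\sum_j (c j * \1_(A j) x)%:E)%E).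
  by apply: integrable_sum => // j _; exact: integrable_indicZ.
by apply/funext => x /=; rewrite /stepfun sumEFin.
Qed.

Lemma stepfun_out c x : (forall j, ~ A j x) -> stepfun c x = 0.
Proof.
by move=> Ax; rewrite /stepfun big1// => j _; rewrite indicE memNset ?mulr0.
Qed.

Lemma stepfunN c x : stepfun (fun j => - c j) x = - stepfun c x.
Proof. by rewrite /stepfun -sumrN; apply: eq_bigr => j _; rewrite mulNr. Qed.

Lemma integral_stepfun c :
  (\int[mu]_x (stepfun c x)%:E)%E = (\sum_j c j * fine (mu (A j)))%:E.
Proof.
under eq_integral => x _ do rewrite /stepfun -sumEFin.
rewrite integral_sum//; last by move=> j; exact: integrable_indicZ.
rewrite -sumEFin; apply: eq_bigr => j _.
under eq_integral => x _ do rewrite EFinM.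
rewrite integralZl//; last exact: integrable_indic_fin.
rewrite integral_indic// setIT EFinM fineK// ge0_fin_numE//.
Qed.

Lemma Rintegral_stepfun (D : set X) c : (forall j, A j `<=` D) ->
  \int[mu]_(x in D) stepfun c x = \sum_j c j * fine (mu (A j)).
Proof.
move=> AD; rewrite Rintegral_mkcond.
have -> : stepfun c \_ D = stepfun c.
  apply/funext => x; rewrite patchE; case: ifPn => // xD.
  rewrite /stepfun big1// => j _; rewrite indicE memNset ?mulr0//.
  by move=> /AD h; move/negP: xD; apply; rewrite inE.
by rewrite /Rintegral integral_stepfun.
Qed.

End step_functions.

Section products_of_step_functions.
Local Open Scope complex_scope.
Context {disp : measure_display} {X : measurableType disp} {R : realType}.
Variable mu : {measure set X -> \bar R}.
Variables (J : finType) (A : J -> set X) (a b : J -> R).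
Hypothesis mA : forall j, measurable (A j).
Hypothesis fA : forall j, (mu (A j) < +oo)%E.

Let A2 (p : J * J) := A p.1 `&` A p.2.

Let stepfunM x : stepfun A a x * stepfun A b x = stepfun A2 (fun p => a p.1 * b p.2) x.
Proof.
rewrite /stepfun mulr_suml.
under eq_bigr do rewrite mulr_sumr.
rewrite pair_big/=; apply: eq_bigr => -[i j] _ /=.
by rewrite mulrACA /A2/= indicI.
Qed.

Let mA2 p : measurable (A2 p). Proof. exact: measurableI. Qed.

Let fA2 p : (mu (A2 p) < +oo)%E.
Proof.
apply: le_lt_trans (fA p.1).
by apply: le_measure; rewrite ?inE; [exact: mA2|exact: mA|move=> x []].
Qed.

Lemma integrable_stepfunM :
  mu.-integrable setT (EFin \o (fun x => stepfun A a x * stepfun A b x)).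
Proof.
rewrite (_ : (fun x => _) = stepfun A2 (fun p => a p.1 * b p.2)).
  by apply: integrable_stepfun; [exact: mA2|exact: fA2].
by apply/funext => x; exact: stepfunM.
Qed.

Lemma integral_stepfunM :
  (\int[mu]_x (stepfun A a x * stepfun A b x)%:E)%E =
  (\sum_i \sum_j a i * b j * fine (mu (A i `&` A j)))%:E.
Proof.
under eq_integral => x _ do rewrite stepfunM.
rewrite integral_stepfun; [|exact: mA2|exact: fA2].
by rewrite [in RHS]pair_big.
Qed.

Lemma Rintegral_stepfunM (D : set X) : (forall j, A j `<=` D) ->
  \int[mu]_(x in D) (stepfun A a x * stepfun A b x) =
  \sum_i \sum_j a i * b j * fine (mu (A i `&` A j)).
Proof.
move=> AD; under eq_Rintegral do rewrite stepfunM.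
rewrite Rintegral_stepfun; [|exact: mA2|exact: fA2|by move=> p x [/AD]].
by rewrite [RHS]pair_big.
Qed.

End products_of_step_functions.

Lemma Rintegral_stepfunMD {disp} {X : measurableType disp} {R : realType}
    (mu : {measure set X -> \bar R}) (J : finType) (A : J -> set X)
    (a b c e : J -> R) (D : set X) :
  (forall j, measurable (A j)) -> (forall j, (mu (A j) < +oo)%E) ->
  (forall j, A j `<=` D) ->
  \int[mu]_(x in D) (stepfun A a x * stepfun A b x + stepfun A c x * stepfun A e x) =
  \sum_i \sum_j a i * b j * fine (mu (A i `&` A j)) +
  \sum_i \sum_j c i * e j * fine (mu (A i `&` A j)).
Proof.
move=> mA fA AD; rewrite Rintegral_mkcond (_ : _ \_ D = fun x =>
    stepfun A a x * stepfun A b x + stepfun A c x * stepfun A e x); last first.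
  apply/funext => x; rewrite patchE; case: ifPn => // xD.
  have out j : ~ A j x by move=> /AD h; move/negP: xD; apply; rewrite inE.
  by rewrite !stepfun_out// !mul0r addr0.
rewrite RintegralD//; [|exact: integrable_stepfunM|exact: integrable_stepfunM].
by rewrite !Rintegral_stepfunM.
Qed.

Lemma le_measure_bigsetU {disp} {X : measurableType disp} {R : realType}
    (mu : {measure set X -> \bar R}) (J : Type) (r : seq J) (F : J -> set X) :
  (forall j, measurable (F j)) ->
  measurable (\big[setU/set0]_(j <- r) F j) /\
  (mu (\big[setU/set0]_(j <- r) F j) <= \sum_(j <- r) mu (F j))%E.
Proof.
move=> mF; elim: r => [|j r [IHm IH]].
  by rewrite !big_nil measure0; split => //; exact: measurable0.
rewrite !big_cons; split; first exact: measurableU.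
by apply: (le_trans (measureU2 _ _ _)); [exact: mF|exact: IHm|exact: leeD2l].
Qed.

Section leb_simplices.
Local Open Scope complex_scope.
Context {R : realType} {d : nat}.

Definition box (c : 'rV[R]_d) (r : R) : set 'rV[R]_d :=
  [set x | forall k, `|x ord0 k - c ord0 k| <= r].

Lemma boxE c r : box c r = [set x | forall k,
  (c - const_mx r) ord0 k <= x ord0 k <= (c + const_mx r) ord0 k].
Proof.
apply/seteqP; split => x H k; have := H k; rewrite /= !mxE ler_distl//.
Qed.

Lemma leb_boxE c r : 0 <= r -> leb d (box c r) = ((2 * r) ^+ d)%:E.
Proof.
move=> r0; rewrite boxE leb_box; last first.
  by move=> i; rewrite !mxE; lra.
congr EFin; rewrite (eq_bigr (fun=> 2 * r)); last by move=> i _; rewrite !mxE; ring.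
by rewrite prodr_const card_ord.
Qed.

Lemma measurable_box c r : measurable (box c r).
Proof.
have -> : box c r = \bigcap_(k in [set: 'I_d])
    [set x : 'rV[R]_d | x ord0 k \in `[c ord0 k - r, c ord0 k + r]].
  apply/seteqP; split => x /= H k.
    by move=> _; have := H k; rewrite ler_distl /= in_itv.
  by have := H k Logic.I; rewrite /= in_itv/= ler_distl.
apply: fin_bigcap_measurable; first exact: finite_finset.
move=> k _; rewrite -[X in measurable X]setTI.
exact: (@measurable_coor R d k measurableT _ (measurable_itv `[_, _])).
Qed.

Lemma measurable_lam n (P : 'I_n -> 'rV[R]_d) s i : measurable_fun setT (lam P s i).
Proof.
rewrite /lam; set c := \sum_(m < _) _; apply: (@measurable_funD _ _ _ _ (cst c)) => //.
apply: measurable_sum => k; apply: measurable_funM; last exact: measurable_cst.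
exact: measurable_coor.
Qed.

Lemma measurable_open_simplex n (P : 'I_n -> 'rV[R]_d) s : full_simplex P s ->
  measurable (open_simplex P s).
Proof.
move=> fs.
have -> : open_simplex P s = \bigcap_(i in [set` s]) [set x | lam P s i x \in `]0, +oo[].
  apply/seteqP; split => x.
    by move=> /(in_open_simplex fs) H i /H /=; rewrite in_itv/= andbT.
  move=> H; apply/(in_open_simplex fs) => i si.
  by have := H i si; rewrite /= in_itv/= andbT.
apply: fin_bigcap_measurable; first exact: finite_finset.
move=> i _; rewrite -[X in measurable X]setTI.
exact: (@measurable_lam n P s i measurableT _ (measurable_itv `]0, +oo[)).
Qed.
End leb_simplices.

(** * The Dirichlet form on nodal values *)

Section energy.
Local Open Scope complex_scope.
Context {R : realType} {d : nat} {Omega : set 'rV[R]_d}.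
Variable T : triangulation Omega.
Local Notation n := (nnodes T).
Local Notation P := (node T).
Local Notation el := (elements T).
Implicit Types (a b : 'I_n -> R) (s : {set 'I_n}).

Lemma closed_simplex_sub_box s : s \in el ->
  closed_simplex P s `<=` box 0 (\sum_i \sum_k `|P i ord0 k|).
Proof.
move=> sel x xs k; have fs := elements_simplex sel.
rewrite mxE subr0 -{1}(sum_lam_vertex fs x) summxE.
apply: (le_trans (ler_norm_sum _ _ _)); apply: ler_sum => i _.
rewrite mxE normrM ger0_norm; last by move/(in_closed_simplex fs) : xs.
apply: (@le_trans _ _ (1 * `|P i ord0 k|)).
  by rewrite ler_wpM2r// lam_le1.
by rewrite mul1r (bigD1 k)//= lerDl sumr_ge0.
Qed.

Lemma leb_simplex_fin s : s \in el -> (leb d (open_simplex P s) < +oo)%E.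
Proof.
move=> sel; have fs := elements_simplex sel.
set M := (\sum_i \sum_k `|P i ord0 k|).
have M0 : 0 <= M by apply: sumr_ge0 => i _; exact: sumr_ge0.
apply: (@le_lt_trans _ _ (leb d (box 0 M))); last by rewrite leb_boxE// ltry.
apply: le_measure; rewrite ?inE.
- exact: measurable_open_simplex.
- exact: measurable_box.
- by move=> x /(open_simplex_closed fs) xs; exact: (closed_simplex_sub_box sel).
Qed.

(** A set of nodes that is not an element gets the empty cell, hence volume 0, so that sums may run
    over all sets of nodes. *)
Definition cell s : set 'rV[R]_d := if s \in el then open_simplex P s else set0.

Lemma measurable_cell s : measurable (cell s).
Proof.
rewrite /cell; case: ifPn => sel; last exact: measurable0.
by apply: measurable_open_simplex; exact: elements_simplex.
Qed.

Lemma leb_cell_fin s : (leb d (cell s) < +oo)%E.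
Proof.
rewrite /cell; case: ifPn => sel; last by rewrite measure0.
exact: leb_simplex_fin.
Qed.

Lemma cell_sub s : cell s `<=` mesh_interior T.
Proof. by rewrite /cell; case: ifPn => // sel x xs; exists s. Qed.

Definition vol s : R := fine (leb d (cell s)).

Lemma vol_ge0 s : 0 <= vol s. Proof. exact: fine_ge0. Qed.

Lemma stepfun_cell (c : {set 'I_n} -> R) s x : s \in el -> open_simplex P s x ->
  stepfun cell c x = c s.
Proof.
move=> sel xs; rewrite /stepfun (bigD1 s)//= {1}/cell sel indicE mem_set// mulr1.
rewrite big1 ?addr0// => t ts; rewrite /cell.
case: ifPn => tel; last by rewrite indic0 mulr0.
rewrite indicE memNset ?mulr0// => xt.
move/eqP : ts; apply; apply/esym; apply: (open_simplex_inj sel tel xs).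
exact: (open_simplex_closed (elements_simplex tel)).
Qed.

Definition energy a b : R := \sum_s vol s * \sum_k grad a s k * grad b s k.

Lemma energyC a b : energy a b = energy b a.
Proof.
apply: eq_bigr => s _; congr (_ * _); apply: eq_bigr => k _; exact: mulrC.
Qed.

Lemma Rintegral_mesh f (c : {set 'I_n} -> R) :
  (forall s x, s \in el -> open_simplex P s x -> f x = c s) ->
  \int[leb d]_(x in mesh_interior T) f x = \sum_s c s * vol s.
Proof.
move=> fc; rewrite (@eq_Rintegral _ _ _ _ _ (stepfun cell c)); last first.
  move=> x; rewrite inE => -[s /= sel xs].
  by rewrite (stepfun_cell _ sel)// (fc s).
apply: Rintegral_stepfun.
- exact: measurable_cell.
- exact: leb_cell_fin.
- exact: cell_sub.
Qed.

Lemma grad_dotE (u z : 'rV[R]_d -> R[i]) : Vh T u -> Vh T z ->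
  let ur := fun j => complex.Re (u (P j)) in let ui := fun j => complex.Im (u (P j)) in
  let zr := fun j => complex.Re (z (P j)) in let zi := fun j => complex.Im (z (P j)) in
  grad_dot (mesh_interior T) u z =
  (energy ur zr + energy ui zi) +i* (energy ui zr - energy ur zi).
Proof.
move=> uV zV ur ui zr zi; rewrite /grad_dot /L2dot /integral_cplx.
have reE k : \int[leb d]_(x in mesh_interior T)
    complex.Re (partial_cplx k u x * conjc (partial_cplx k z x)) =
    \sum_s (grad ur s k * grad zr s k + grad ui s k * grad zi s k) * vol s.
  apply: Rintegral_mesh => s x sel xs.
  rewrite (partial_cplx_Vh k uV sel xs) (partial_cplx_Vh k zV sel xs).
  by rewrite /= mulrN opprK.
have imE k : \int[leb d]_(x in mesh_interior T)
    complex.Im (partial_cplx k u x * conjc (partial_cplx k z x)) =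
    \sum_s (grad ui s k * grad zr s k - grad ur s k * grad zi s k) * vol s.
  apply: Rintegral_mesh => s x sel xs.
  rewrite (partial_cplx_Vh k uV sel xs) (partial_cplx_Vh k zV sel xs).
  by rewrite /= mulrN addrC.
apply: complexP.
  rewrite Re_sum /=; under eq_bigr do rewrite reE.
  rewrite exchange_big/= /energy -big_split/=; apply: eq_bigr => s _.
  by rewrite -mulr_suml big_split/= mulrC mulrDr.
rewrite Im_sum /=; under eq_bigr do rewrite imE.
rewrite exchange_big/= /energy -sumrB; apply: eq_bigr => s _.
by rewrite -mulr_suml sumrB mulrC mulrBr.
Qed.

Definition unit_vec (i : 'I_n) : 'I_n -> R := fun j => (j == i)%:R.

Lemma grad_unit_vec i s k : grad (unit_vec i) s k = grad_lam P s i k.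
Proof.
rewrite /grad /unit_vec (bigD1 i)//= eqxx mul1r big1 ?addr0// => j ji.
by rewrite (negbTE ji) mul0r.
Qed.

Lemma energy_expandr a b : energy a b = \sum_j b j * energy a (unit_vec j).
Proof.
rewrite /energy; under [RHS]eq_bigr do rewrite mulr_sumr.
rewrite exchange_big/=; apply: eq_bigr => s _.
rewrite [in RHS](eq_bigr (fun j => vol s * \sum_k b j * (grad a s k * grad_lam P s j k))); last first.
  move=> j _; rewrite mulrCA; congr (_ * _); rewrite mulr_sumr.
  by apply: eq_bigr => k _; rewrite grad_unit_vec.
rewrite -mulr_sumr; congr (_ * _); rewrite exchange_big/=; apply: eq_bigr => k _.
rewrite {2}/grad mulr_sumr; apply: eq_bigr => j _; ring.
Qed.

Lemma energy_expand a b :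
  energy a b = \sum_i \sum_j a i * b j * energy (unit_vec i) (unit_vec j).
Proof.
rewrite energyC energy_expandr; apply: eq_bigr => i _.
rewrite energyC energy_expandr mulr_sumr; apply: eq_bigr => j _.
by rewrite mulrA.
Qed.

Lemma sum_grad_lam s k : s \in el -> \sum_i grad_lam P s i k = 0.
Proof.
move=> sel; have fs := elements_simplex sel.
have : \sum_i lam P s i (delta_mx ord0 k) = \sum_i lam P s i 0 by rewrite !(sum_lam fs).
move=> /eqP; rewrite -subr_eq0 -sumrB => /eqP E; rewrite -[RHS]E; apply: eq_bigr => i _.
rewrite lam_affineE addrAC subrr add0r (bigD1 k)//= big1 ?addr0.
  by rewrite mxE !eqxx mulr1.
by move=> k' kk'; rewrite mxE (negbTE kk') andbF mulr0.
Qed.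

(** The hats of all nodes, boundary nodes included, add up to 1 on each element, and the gradient of
    a constant vanishes. *)
Lemma sum_energy_unit_vec i : \sum_j energy (unit_vec i) (unit_vec j) = 0.
Proof.
have -> : \sum_j energy (unit_vec i) (unit_vec j) = energy (unit_vec i) (fun=> 1).
  by rewrite [RHS]energy_expandr; apply: eq_bigr => j _; rewrite mul1r.
rewrite /energy big1// => s _; have [sel|sel] := boolP (s \in el); last first.
  by rewrite /vol /cell (negbTE sel) measure0 mul0r.
rewrite big1 ?mulr0// => k _; rewrite [X in _ * X](_ : _ = 0) ?mulr0//.
by rewrite /grad; under eq_bigr do rewrite mul1r; exact: sum_grad_lam.
Qed.

(** Since the rows of the stiffness matrix [K] sum to 0, the form equals -1/2 times the sum of
    [K i j * ((a i - a j) * (b i - b j))]. The weights off the diagonal are nonnegative and the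
    diagonal terms vanish, so the hypothesis on differences compares the two forms term by term. *)
Lemma energy_truncation a b :
  (forall i j, i != j -> energy (unit_vec i) (unit_vec j) <= 0) ->
  (forall i j, (b i - b j) ^+ 2 <= (a i - a j) * (b i - b j)) ->
  energy b b <= energy a b.
Proof.
move=> acute ab.
pose K i j := energy (unit_vec i) (unit_vec j).
have KC i j : K i j = K j i by exact: energyC.
have E a1 a2 : energy a1 a2 = - 2^-1 * \sum_i \sum_j K i j * ((a1 i - a1 j) * (a2 i - a2 j)).
  have -> : \sum_i \sum_j K i j * ((a1 i - a1 j) * (a2 i - a2 j)) =
     - (energy a1 a2 + energy a1 a2) + (\sum_i \sum_j K i j * (a1 i * a2 i) +
      \sum_i \sum_j K i j * (a1 j * a2 j)).
    rewrite {1}energy_expand energyC energy_expand.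
    rewrite -!big_split/= -sumrN -!big_split/=; apply: eq_bigr => i _.
    rewrite -!big_split/= -sumrN -!big_split/=; apply: eq_bigr => j _.
    rewrite -/(K i j); ring.
  rewrite [X in _ + (X + _)]big1; last first.
    by move=> i _; rewrite -mulr_suml sum_energy_unit_vec mul0r.
  rewrite [X in _ + (_ + X)]exchange_big/= [X in _ + (_ + X)]big1; last first.
    move=> i _; rewrite -mulr_suml; under eq_bigr do rewrite KC.
    by rewrite sum_energy_unit_vec mul0r.
  by field.
rewrite !E ler_nM2l ?oppr_lt0 ?invr_gt0//.
apply: ler_sum => i _; apply: ler_sum => j _.
have [->|ij] := eqVneq i j; first by rewrite !subrr !mulr0.
by rewrite ler_wnM2l ?acute// -expr2.
Qed.

(** [nodal_basis] is chosen among functions with given nodal values; [cinterp] shows that one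
    exists, and by [grad_dotE] nodal values are all that matters. *)
Lemma acute_energy i j : (forall i j : 'I_n, i != j ->
    complex.Re (grad_dot (mesh_interior T) (nodal_basis i) (nodal_basis j)) <= 0) ->
  i != j -> energy (unit_vec i) (unit_vec j) <= 0.
Proof.
move=> /[apply].
have nb k : Vh T (nodal_basis k) /\ forall l, nodal_basis k (P l) = (l == k)%:R :> R[i].
  rewrite /nodal_basis; case: xgetP => [phi _ //|/(_ (cinterp (fun l => (l == k)%:R)))].
  case; split; first exact: Vh_cinterp.
  by move=> l; rewrite cinterp_node.
have [Vi ni] := nb i; have [Vj nj] := nb j.
rewrite grad_dotE//= (_ : (fun l => complex.Re (nodal_basis i (P l))) = unit_vec i); last first.
  by apply/funext => l; rewrite ni /unit_vec; case: eqP.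
rewrite (_ : (fun l => complex.Re (nodal_basis j (P l))) = unit_vec j); last first.
  by apply/funext => l; rewrite nj /unit_vec; case: eqP.
rewrite (_ : (fun l => complex.Im (nodal_basis j (P l))) = fun=> 0); last first.
  by apply/funext => l; rewrite nj; case: eqP.
rewrite [X in _ + X](_ : _ = 0) ?addr0//.
by rewrite energy_expandr big1// => l _; rewrite mul0r.
Qed.

End energy.

(** * Chaining through the mesh *)

(** Subadditivity of Lebesgue measure. The extra point [z] costs nothing; in [chain] it is the value
    0 taken outside the mesh. *)
Lemma cover_length (R : realType) (J : finType) (p : pred J) (a b z : R) (c o : J -> R) :
  a <= b -> (forall j, p j -> 0 <= o j) ->
  (forall v, a <= v <= b -> v = z \/ exists2 j, p j & `|v - c j| <= o j) ->
  b - a <= \sum_(j | p j) 2 * o j.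
Proof.
move=> ab o0 H.
pose F j : set R := `[c j - o j, c j + o j]%classic.
have mF j : measurable (F j) by exact: measurable_itv.
have [mU lU] := le_measure_bigsetU lebesgue_measure [seq j <- enum J | p j] mF.
set U := \big[_/_]_(_ <- _) _ in mU lU.
have sub : `[a, b]%classic `<=` [set z] `|` U.
  move=> v /=; rewrite in_itv/= => /H[->|[j pj vj]]; [by left|right].
  rewrite /U -bigcup_seq; exists j; first by rewrite /= mem_filter pj mem_enum.
  by rewrite /F /= in_itv/= -ler_distl.
have : (lebesgue_measure (`[a, b]%classic : set R) <= lebesgue_measure ([set z] `|` U))%E.
  by apply: le_measure => //; rewrite inE; [exact: measurable_itv|exact: measurableU].
have mz : measurable ([set z] : set R) by exact: measurable_set1.
have L2 : (lebesgue_measure ([set z] `|` U) <= lebesgue_measure [set z] + lebesgue_measure U)%E.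
  by apply: measureU2; [exact: mz|exact: mU].
move=> /le_trans /(_ L2).
rewrite [X in (X + _)%E]lebesgue_measure_set1 add0e => /le_trans/(_ lU).
have itvE (x y : R) : x <= y -> lebesgue_measure (`[x, y]%classic : set R) = (y - x)%:E.
  move=> xy; rewrite lebesgue_measure_itv/= lte_fin; case: ltP => [//|yx].
  by rewrite (le_anti (introT andP (conj xy yx))) subrr.
rewrite itvE// big_filter big_enum_cond/=.
rewrite (eq_bigr (fun j => (2 * o j)%:E)); last first.
  move=> j pj; rewrite /F itvE; first by congr EFin; ring.
  by have := o0 _ pj; lra.
by rewrite sumEFin lee_fin.
Qed.

Section chain.
Local Open Scope complex_scope.
Context {R : realType} {d : nat} {Omega : set 'rV[R]_d}.
Variable T : triangulation Omega.
Local Notation n := (nnodes T).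
Local Notation P := (node T).
Local Notation el := (elements T).
Implicit Types (a b : 'I_n -> R) (s : {set 'I_n}).
Variable H : R.
Hypothesis diamH : forall s x y, s \in el -> open_simplex P s x -> open_simplex P s y ->
  forall k, `|x ord0 k - y ord0 k| <= H.

Lemma closed_diam s x y k : s \in el -> closed_simplex P s x -> closed_simplex P s y ->
  `|x ord0 k - y ord0 k| <= H.
Proof.
move=> sel xs ys; have fs := elements_simplex sel; set c := centroid P s.
rewrite leNgt; apply/negP => Hxy.
set D := `|x ord0 k - y ord0 k| in Hxy.
have H0 : 0 <= H by apply: le_trans (diamH sel (centroid_open fs) (centroid_open fs) k).
have D0 : 0 < D by exact: le_lt_trans Hxy.
(* With this [t] the points moved towards the centroid differ by [(1 - t) * D = (D + H) / 2 > H] in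
   coordinate [k], although they lie in the open simplex. *)
pose t := (D - H) / (2 * D).
have t01 : 0 < t <= 1.
  rewrite /t divr_gt0 ?mulr_gt0 ?subr_gt0//= ler_pdivrMr ?mulr_gt0//; lra.
have := diamH sel (open_simplex_toward fs (centroid_open fs) xs t01)
  (open_simplex_toward fs (centroid_open fs) ys t01) k.
rewrite !mxE (_ : _ - _ = (1 - t) * (x ord0 k - y ord0 k)); last by ring.
rewrite normrM -/D ger0_norm; last by rewrite subr_ge0; case/andP: t01.
have -> : (1 - t) * D = (D + H) / 2 by rewrite /t; field; rewrite gt_eqF.
lra.
Qed.

Definition osc a s : R := H * \sum_k `|grad a s k|.

Lemma osc_ge0 a s : s \in el -> 0 <= osc a s.
Proof.
move=> sel; have fs := elements_simplex sel.
rewrite /osc; have [d0|d0] := posnP d.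
  by rewrite big1 ?mulr0// => -[m md]; exfalso; rewrite d0 in md.
rewrite mulr_ge0 ?sumr_ge0//.
exact: le_trans (diamH sel (centroid_open fs) (centroid_open fs) (Ordinal d0)).
Qed.

Lemma interp_osc a s x y : s \in el -> closed_simplex P s x -> closed_simplex P s y ->
  `|interp a x - interp a y| <= osc a s.
Proof.
move=> sel xs ys.
rewrite (interpE a sel xs) (interpE a sel ys).
have aE (z : 'rV[R]_d) : \sum_i a i * lam P s i z =
    \sum_i a i * lam P s i 0 + \sum_k grad a s k * z ord0 k by exact: sum_lam_affineE.
rewrite aE [X in _ - X]aE opprD addrACA subrr add0r -sumrB.
apply: (le_trans (ler_norm_sum _ _ _)); rewrite /osc mulr_sumr; apply: ler_sum => k _.
by rewrite -mulrBr normrM mulrC ler_wpM2r// (closed_diam k sel).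
Qed.

Definition crosses (x y : 'rV[R]_d) s : bool :=
  (s \in el) && `[< exists2 t, 0 <= t <= 1 & closed_simplex P s (x + t *: (y - x)) >].

(* The zero extension of [interp a] is continuous, so along a segment its range
   contains every value between those at the endpoints, and this range is covered by
   the ranges on the elements met by the segment. *)
Lemma chain a x y : (forall j, ~ Omega (P j) -> a j = 0) ->
  `|interp a x - interp a y| <= \sum_(s | crosses x y s) 2 * osc a s.
Proof.
move=> a0; pose h (t : R) : R := interp a (x + t *: (y - x)).
have hc : continuous h.
  move=> t; apply: (@continuous_comp _ _ _ (fun t : R => x + t *: (y - x)) (interp a)).
    apply: (@cvgD _ _ _ (nbhs t)); first exact: cvg_cst.
    by apply: (@cvgZ _ _ _ (nbhs t)); [exact: cvg_id|exact: cvg_cst].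
  exact: interp_continuous.
have h0 : h 0 = interp a x by rewrite /h scale0r addr0.
have h1 : h 1 = interp a y by rewrite /h scale1r addrC subrK.
have /choice [ts tsP] : forall s, exists t : R, crosses x y s ->
    0 <= t <= 1 /\ closed_simplex P s (x + t *: (y - x)).
  move=> s; have [/andP[sel /asboolP[t t01 ts]]|ms] := boolP (crosses x y s).
    by exists t.
  by exists 0.
have cov v : Num.min (h 0) (h 1) <= v <= Num.max (h 0) (h 1) ->
    v = 0 \/ exists2 s, crosses x y s & `|v - h (ts s)| <= osc a s.
  move=> v01; have [t] : exists2 t, t \in `[0, 1] & h t = v.
    by apply: IVT => //; exact: continuous_subspaceT.
  rewrite in_itv/= => t01 <-.
  have [[s /= sel st]|out] := pselect (mesh_union T (x + t *: (y - x))).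
    right; exists s; last first.
      apply: (interp_osc _ sel) => //; apply: (tsP s _).2.
      by rewrite /crosses sel/=; apply/asboolP; exists t.
    by rewrite /crosses sel/=; apply/asboolP; exists t.
  by left; rewrite /h interp_out// => /(@domain_sub _ _ _ T).
have -> : `|interp a x - interp a y| = Num.max (h 0) (h 1) - Num.min (h 0) (h 1).
  rewrite h0 h1; case: leP => h01; first by rewrite distrC ger0_norm ?subr_ge0.
  by rewrite ger0_norm ?subr_ge0 ?ltW.
apply: (cover_length _ _ cov); first by rewrite ge_min le_max lexx.
by move=> s /andP[sel _]; exact: osc_ge0.
Qed.

End chain.

(** * Sampling on a lattice *)

Section lattice.
Local Open Scope complex_scope.
Context {R : realType} {d : nat}.
Variables (N : nat) (L dl : R).
Hypothesis dl0 : 0 < dl.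
Hypothesis L0 : 0 < L.
Hypothesis NL : 2 * L <= dl * N%:R.
Local Notation G := 'rV['I_N.+1]_d.

(** The lattice starts at the corner [-L]; by [2 * L <= dl * N] it reaches beyond [L] in each
    direction, so it covers the cube containing the mesh. *)
Definition pos (z : G) : 'rV[R]_d := \row_k (- L + dl * (z ord0 k)%:R).

Lemma exists_grid_point (c : 'rV[R]_d) : (forall k, `|c ord0 k| <= L) ->
  exists z, box c dl (pos z).
Proof.
move=> cL; pose t k := (c ord0 k + L) / dl.
have t0 k : 0 <= t k.
  by rewrite /t divr_ge0 ?(ltW dl0)//; have := cL k; rewrite ler_norml; lra.
have tN k : t k <= N%:R.
  rewrite /t ler_pdivrMr// mulrC; apply: le_trans NL.
  by have := cL k; rewrite ler_norml; lra.
exists (\row_k inord (Num.truncn (t k))) => k; rewrite !mxE.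
have /andP[t1 t2] := truncn_itv (t0 k).
rewrite inordK; last first.
  by rewrite ltnS -(ler_nat R); exact: le_trans t1 (tN k).
have -> : c ord0 k = - L + dl * t k by rewrite /t; field; rewrite gt_eqF.
have -> : - L + dl * (Num.truncn (t k))%:R - (- L + dl * t k) =
  - (dl * (t k - (Num.truncn (t k))%:R)) by ring.
rewrite normrN ger0_norm; last by rewrite mulr_ge0 ?subr_ge0// ltW.
by rewrite ler_piMr ?(ltW dl0)//; rewrite -natr1 in t2; lra.
Qed.

Lemma pos_diff (m : nat) (z z' : G) k : `|pos z ord0 k - pos z' ord0 k| <= dl * m%:R ->
  (z ord0 k <= z' ord0 k + m)%N /\ (z' ord0 k <= z ord0 k + m)%N.
Proof.
rewrite !mxE opprD addrACA subrr add0r -mulrBr normrM gtr0_norm//.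
rewrite ler_pM2l// ler_norml => /andP[h1 h2].
by split; rewrite -(ler_nat R) natrD; lra.
Qed.

Lemma pos_step (z : G) k : (z ord0 k < N)%N ->
  pos (z + unit_step N k) = pos z + dl *: delta_mx ord0 k.
Proof.
clear dl0 L0 NL => zN; apply/rowP => i; rewrite !mxE.
have [->|ik] := eqVneq i k; last by rewrite mulr0 !addr0.
rewrite eqxx mulr1/= inordK; last by lia.
by rewrite modn_small; [rewrite natrD; ring|lia].
Qed.

(** The edge that closes the torus joins opposite faces of the cube. Both ends have a coordinate of
    absolute value at least [L], hence lie off the mesh, and the edge carries no energy. *)
Lemma pos_wrap (z : G) k : ~~ (z ord0 k < N)%N ->
  L <= pos z ord0 k /\ pos (z + unit_step N k) ord0 k = - L.
Proof.
move=> zN; have zE : z ord0 k = N :> nat by have := ltn_ord (z ord0 k); lia.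
have N0 : (0 < N)%N.
  rewrite lt0n; apply/eqP => N0; move: NL; rewrite N0 mulr0 => h; have := L0; lra.
split; first by rewrite mxE zE; have := NL; lra.
by rewrite !mxE eqxx /= inordK ?ltnS// zE addn1 modnn mulr0 addr0.
Qed.

End lattice.

Section mesh_faber_krahn.
Local Open Scope complex_scope.
Context {R : realType} {d : nat} {Omega : set 'rV[R]_d}.
Variable T : triangulation Omega.
Local Notation n := (nnodes T).
Local Notation P := (node T).
Local Notation el := (elements T).
Implicit Types (a b : 'I_n -> R) (s : {set 'I_n}).
Variables H r : R.
Hypothesis r0 : 0 < r.
Hypothesis diamH : forall s x y, s \in el -> open_simplex P s x -> open_simplex P s y ->
  forall k, `|x ord0 k - y ord0 k| <= H.
Hypothesis ball_r : forall s, s \in el -> exists c, box c r `<=` open_simplex P s.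

(** Two coordinates cannot both exceed 1/2, so cores of distinct nodes are disjoint and meet no tie
    between coordinates. They provide one lattice point per node, and later the lower bounds for
    lumped integrals. *)
Definition core s j : set 'rV[R]_d := [set x | open_simplex P s x /\ 2^-1 < lam P s j x].

Lemma core_box s j : s \in el -> j \in s -> exists c, box c (r / 2) `<=` core s j.
Proof.
move=> sel js; have fs := elements_simplex sel.
have [c cs] := ball_r sel.
(* The homothety of ratio 1/2 centered at [P j] halves the inner cube and replaces the coordinate of
   [j] by [(1 + lam j) / 2 > 1/2]. *)
exists (P j + 2^-1 *: (c - P j)) => y yc.
pose x := P j + 2 *: (y - P j).
have xs : open_simplex P s x.
  apply: cs => k; have := yc k; rewrite !mxE => yk.
  have -> : P j ord0 k + 2 * (y ord0 k - P j ord0 k) - c ord0 k =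
    2 * (y ord0 k - (P j ord0 k + 2^-1 * (c ord0 k - P j ord0 k))) by field.
  by rewrite normrM ger0_norm//; lra.
have yx : y = P j + 2^-1 *: (x - P j).
  by rewrite /x [P j + 2 *: _]addrC addrK scalerA mulVf// scale1r addrC subrK.
have H1 : open_simplex P s y.
  rewrite yx; apply: (open_simplex_toward fs xs (node_closed sel js)).
  by apply/andP; split; lra.
split => //; rewrite yx lam_conv (lam_vertex fs)// eqxx mulr1n.
by have /(in_open_simplex fs)/(_ _ js) := xs; lra.
Qed.

Variables (m : nat).
Hypothesis mH : 4 * H / r + 1 <= m%:R.
(** In lattice steps [dl = r / 2], the number [m] exceeds both [H + dl], the distance between an
    edge and a point of an element it meets, and [2 * H], the distance across two elements with a
    common node. [M] counts the lattice points within [m] steps. *)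
Let M := (m.*2.+1 ^ d)%N.
Let dl := r / 2.
Let dl0 : 0 < dl. Proof. by rewrite divr_gt0. Qed.
Hypothesis H0 : 0 <= H.
Let dlm1 : H + dl <= dl * m%:R.
Proof.
have : dl * (4 * H / r + 1) <= dl * m%:R by rewrite ler_pM2l.
have -> : dl * (4 * H / r + 1) = 2 * H + dl by rewrite /dl; field; rewrite gt_eqF.
by have := H0; lra.
Qed.
Let dlm2 : 2 * H <= dl * m%:R.
Proof.
have : dl * (4 * H / r + 1) <= dl * m%:R by rewrite ler_pM2l.
have -> : dl * (4 * H / r + 1) = 2 * H + dl by rewrite /dl; field; rewrite gt_eqF.
by have := dl0; lra.
Qed.

Variables (N : nat) (L : R).
Hypothesis L0 : 0 < L.
Hypothesis NL : 2 * L <= dl * N%:R.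
Hypothesis meshL : forall x k, mesh_union T x -> `|x ord0 k| < L.
Local Notation G := 'rV['I_N.+1]_d.
Local Notation pos := (@pos R d N L dl).

Lemma core_sub_mesh s j x : s \in el -> core s j x -> mesh_union T x.
Proof.
move=> sel [xs _]; exists s => //.
exact: (open_simplex_closed (elements_simplex sel)).
Qed.

Lemma exists_core_point s j : s \in el -> j \in s -> exists z : G, core s j (pos z).
Proof.
move=> sel js; have [c cs] := core_box sel js.
have r20 : 0 <= r / 2 by rewrite ltW.
have cc : box c (r / 2) c by move=> k; rewrite subrr normr0.
have cL k : `|c ord0 k| <= L.
  by apply/ltW/meshL; apply: (core_sub_mesh sel (cs _ cc)).
by have [z /cs] := exists_grid_point dl0 NL cL; exists z.
Qed.

(** A lattice point in the open element labels elements injectively, so that counting elements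
    becomes counting lattice points. *)
Lemma exists_element_point : exists pe : {set 'I_n} -> G, forall s, s \in el ->
  open_simplex P s (pos (pe s)).
Proof.
suff /choice : forall s, exists z : G, s \in el -> open_simplex P s (pos z).
  by move=> [pe peP]; exists pe.
move=> s; have [sel|] := boolP (s \in el); last by exists 0.
have [card_s _] := elements_simplex sel.
have /card_gt0P [j js] : (0 < #|s|)%N by rewrite card_s.
by have [z [zs _]] := exists_core_point sel js; exists z.
Qed.

Lemma exists_node_point : exists (pn : 'I_n -> G) (sn : 'I_n -> {set 'I_n}),
  forall j, [/\ sn j \in el, j \in sn j & core (sn j) j (pos (pn j))].
Proof.
suff /choice[f fP] : forall j, exists p : G * {set 'I_n},
    [/\ p.2 \in el, j \in p.2 & core p.2 j (pos p.1)].
  by exists (fst \o f), (snd \o f).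
move=> j; have [s sel js] := node_elements j.
by have [z zs] := exists_core_point sel js; exists (z, s).
Qed.

Lemma core_inj s t i j x : s \in el -> t \in el -> core s i x -> core t j x -> i = j.
Proof.
move=> sel tel [xs xi] [xt xj].
have st : s = t.
  by apply: (open_simplex_inj sel tel xs); exact: (open_simplex_closed (elements_simplex tel)).
subst t; have fs := elements_simplex sel.
apply/eqP/negPn/negP => ij.
by have := lam_pair_le1 fs ij (open_simplex_closed fs xs); lra.
Qed.

Variable w : 'I_n -> R.
Hypothesis w0 : forall j, ~ Omega (P j) -> w j = 0.
Let g (z : G) : R := interp w (pos z).

Let D : R := 4 * M%:R ^+ 2 * \sum_(s in el) osc H w s ^+ 2.

(** Double counting: an edge meets at most [M] elements and an element meets at most [M] edges. The
    first bound enters through Cauchy-Schwarz in [chain], the second after exchanging the sums,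
    whence [M ^ 2]; the 4 is the square of the factor 2 in [chain]. *)
Lemma grid_energy k : shift_energy g (unit_step N k) <= D.
Proof.
have [pe peP] := exists_element_point.
pose mt (z : G) s := (z ord0 k < N)%N && crosses (pos z) (pos (z + unit_step N k)) s.
have near_pe z s : mt z s -> forall i, (z ord0 i <= pe s ord0 i + m)%N /\
    (pe s ord0 i <= z ord0 i + m)%N.
  move=> /andP[zN /andP[sel /asboolP[t /andP[t0 t1] ts]]] i.
  apply: (pos_diff (L := L) dl0).
  have h1 := closed_diam diamH i sel ts (open_simplex_closed (elements_simplex sel) (peP s sel)).
  apply: le_trans dlm1; set y := pos z + _ in ts h1.
  apply: (le_trans (ler_distD (y ord0 i) _ _)); rewrite addrC lerD//.
  have -> : pos z ord0 i - y ord0 i = - (t * (dl * (i == k)%:R)).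
    by rewrite /y (pos_step _ _ zN) [pos z + dl *: _]addrC addrK !mxE eqxx/=; ring.
  rewrite normrN normrM normrM (ger0_norm t0) (gtr0_norm dl0).
  have := dl0; case: (i == k); rewrite ?normr1 ?normr0 ?mulr1 ?mulr0 => d0; last exact: ltW.
  by rewrite ler_piMl// ltW.
have cardS z : (#|[set s | mt z s]%SET| <= M)%N.
  rewrite -(@card_in_imset _ _ pe); last first.
    move=> s t; rewrite !inE => /andP[_ /andP[sel _]] /andP[_ /andP[tel _]] E.
    apply: (open_simplex_inj sel tel (peP s sel)); rewrite E.
    by apply: (open_simplex_closed (elements_simplex tel)); exact: peP.
  apply: (card_grid_box (z0 := z)) => z' i /imsetP[s]; rewrite inE => zs ->.
  by have [] := near_pe z s zs i.
have cardZ s : (#|[set z | mt z s]%SET| <= M)%N.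
  apply: (card_grid_box (z0 := pe s)) => z' i; rewrite inE => zs.
  by have [] := near_pe z' s zs i.
have gz z : (g (z + unit_step N k) - g z) ^+ 2 <=
    \sum_(s | mt z s) 4 * M%:R * osc H w s ^+ 2.
  have [zN|zN] := boolP (z ord0 k < N)%N; last first.
    have [h1 h2] := pos_wrap dl0 L0 NL zN.
    have out (x : 'rV[R]_d) : ~ `|x ord0 k| < L -> interp w x = 0.
      by move=> xL; rewrite /interp big1// => i _; rewrite hat_out ?mulr0// => /meshL.
    rewrite /g !out ?subrr ?expr0n/=.
    - by apply: sumr_ge0 => s _; rewrite mulr_ge0 ?sqr_ge0// mulr_ge0.
    - by move=> /(le_lt_trans (ler_norm _)); rewrite ltNge h1.
    - by rewrite h2 normrN gtr0_norm// ltxx.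
  have mtE s : mt z s = crosses (pos z) (pos (z + unit_step N k)) s by rewrite /mt zN.
  have ch := chain diamH (pos z) (pos (z + unit_step N k)) w0.
  apply: (@le_trans _ _ ((\sum_(s | mt z s) 2 * osc H w s) ^+ 2)).
    have S0 : 0 <= \sum_(s | mt z s) 2 * osc H w s.
      apply: sumr_ge0 => s /andP[_ /andP[sel _]].
      by rewrite mulr_ge0// (osc_ge0 diamH).
    rewrite -[leLHS]real_normK ?num_real// distrC ler_sqr ?nnegrE//.
    by rewrite (eq_bigl _ _ mtE).
  apply: (le_trans (sqr_sum_le_card _ _)).
  rewrite mulr_sumr; apply: ler_sum => s _.
  rewrite exprMn mulrA ler_wpM2r ?sqr_ge0// [leRHS]mulrC (_ : 2 ^+ 2 = 4); last by ring.
  rewrite ler_wpM2r// ler_nat; apply: leq_trans (cardS z).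
  by apply: subset_leq_card; apply/fintype.subsetP => s'; rewrite !inE.
apply: (le_trans (ler_sum _ (fun z _ => gz z))).
rewrite (exchange_big_dep (mem el))/=; last by move=> z s _ /andP[_ /andP[]].
rewrite /D [leRHS]mulr_sumr; apply: ler_sum => s sel.
have cZ : #|(fun z => mt z s)|%:R <= M%:R :> R.
  rewrite ler_nat; apply: leq_trans (cardZ s).
  by apply: subset_leq_card; apply/fintype.subsetP => s'; rewrite !inE.
have c0 : 0 <= 4 * M%:R * osc H w s ^+ 2 by rewrite mulr_ge0 ?sqr_ge0// mulr_ge0.
rewrite sumr_const -[leLHS]mulr_natl.
apply: (le_trans (ler_wpM2r c0 cZ)).
by rewrite le_eqVlt; apply/orP; left; apply/eqP; ring.
Qed.

(** Where [g] is nonzero, the lattice point lies in a closed element with a vertex at which [w] is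
    nonzero. The lattice points in elements around [P j] are within [2 * H] of the core point of
    [j], by way of [P j]. *)
Lemma grid_support : (#|[set z | g z != 0%R]%SET| <= #|[set j | w j != 0%R]%SET| * M)%N.
Proof.
have [pn [sn pnP]] := exists_node_point.
pose S j : {set G} :=
  [set z | [exists s, [&& s \in el, j \in s & `[< closed_simplex P s (pos z) >]]]]%SET.
have cS j : (#|S j| <= M)%N.
  apply: (card_grid_box (z0 := pn j)) => z i; rewrite inE => /existsP[s /and3P[sel js /asboolP zs]].
  apply: (pos_diff (L := L) dl0).
  have [tel jt [zt _]] := pnP j.
  have h1 := closed_diam diamH i sel zs (node_closed sel js).
  have h2 := closed_diam diamH i tel (node_closed tel jt)
     (open_simplex_closed (elements_simplex tel) zt).
  apply: le_trans dlm2; apply: (le_trans (ler_distD (P j ord0 i) _ _)).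
  by rewrite (_ : 2 * H = H + H) ?lerD//; ring.
have sub : [set z | g z != 0%R]%SET \subset (\bigcup_(j in [set j | w j != 0%R]%SET) S j)%SET.
  apply/fintype.subsetP => z; rewrite inE => gz.
  have [[s /= sel zs]|out] := pselect (mesh_union T (pos z)); last first.
    by move: gz; rewrite /g /interp big1 ?eqxx// => i _; rewrite hat_out ?mulr0.
  have : exists j, w j * lam P s j (pos z) != 0.
    apply: contrapT => nj; move: gz; rewrite /g (interpE w sel zs) big1 ?eqxx// => j _.
    by apply/eqP/negPn/negP => jj; apply: nj; exists j.
  move=> [j]; rewrite mulf_eq0 negb_or => /andP[wj lj].
  apply/bigcupP; exists j; first by rewrite inE.
  rewrite inE; apply/existsP; exists s; rewrite sel/=; apply/andP; split; last exact/asboolP.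
  by apply: contraNT lj => /(lam_notin (elements_simplex sel) (pos z)) ->.
apply: (leq_trans (subset_leq_card sub)).
rewrite -sum_nat_const.
elim/big_ind2: _ => [|A1 x A2 y h1 h2|j _]; last exact: cS.
  by rewrite cards0.
exact: leq_trans (leq_card_setU _ _) (leq_add h1 h2).
Qed.

(** At the core point of [j] the coordinate of [j] exceeds 1/2 and the other terms are nonnegative,
    so [w j] is at most twice the sample there. Distinct nodes have distinct core points. *)
Lemma grid_level (l : R) : 0 <= l -> (forall j, 0 <= w j) ->
  l ^+ 2 * #|[set j | l <= w j]%SET|%:R <= 4 * \sum_z g z ^+ 2.
Proof.
move=> l0 wge0; have [pn [sn pnP]] := exists_node_point.
have pnI : injective pn.
  move=> i j E; have [sel _ ci] := pnP i; have [tel _ cj] := pnP j.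
  by rewrite E in ci; exact: (core_inj sel tel ci cj).
have gw j : w j <= 2 * g (pn j).
  have [sel js [zs zj]] := pnP j; have fs := elements_simplex sel.
  have zs' := open_simplex_closed fs zs.
  rewrite /g (interpE w sel zs') (bigD1 j)//=.
  apply: (@le_trans _ _ (2 * (w j * lam P (sn j) j (pos (pn j))))).
    rewrite mulrCA ler_peMr//; lra.
  rewrite ler_wpM2l// lerDl sumr_ge0// => i _; rewrite mulr_ge0//.
  by have /(in_closed_simplex fs) := zs'.
apply: (@le_trans _ _ (4 * \sum_j g (pn j) ^+ 2)); last first.
  rewrite ler_wpM2l// -(big_imset (fun z => g z ^+ 2)) /=; last by move=> i j _ _ /pnI.
  rewrite [leRHS](bigID (mem [set pn x | x in 'I_n]%SET))/= lerDl.
  by apply: sumr_ge0 => z _; exact: sqr_ge0.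
rewrite mulr_natr -sumr_const mulr_sumr.
rewrite [leRHS](bigID (mem [set j | l <= w j]%SET))/= ler_wpDr//.
  by apply: sumr_ge0 => z _; rewrite mulr_ge0 ?sqr_ge0.
apply: ler_sum => j; rewrite inE => lj.
have -> : 4 * g (pn j) ^+ 2 = (2 * g (pn j)) ^+ 2 by ring.
by rewrite ler_sqr ?nnegrE// ?(le_trans lj)// (le_trans l0)// (le_trans lj).
Qed.

Lemma osc_energy : (forall s, s \in el -> (2 * r) ^+ d <= vol s) ->
  (2 * r) ^+ d * \sum_(s in el) osc H w s ^+ 2 <= d%:R * H ^+ 2 * energy w w.
Proof.
move=> volr; rewrite mulr_sumr /energy mulr_sumr [leRHS](bigID (mem el))/= ler_wpDr//.
  apply: sumr_ge0 => s _; rewrite !mulr_ge0 ?sqr_ge0 ?vol_ge0//.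
  by apply: sumr_ge0 => k _; rewrite -expr2 sqr_ge0.
apply: ler_sum => s sel.
have S0 : 0 <= \sum_k grad w s k * grad w s k.
  by apply: sumr_ge0 => k _; rewrite -expr2 sqr_ge0.
have O : osc H w s ^+ 2 <= d%:R * H ^+ 2 * \sum_k grad w s k * grad w s k.
  have CS : (\sum_k `|grad w s k|) ^+ 2 <= d%:R * \sum_k grad w s k * grad w s k.
    apply: (le_trans (sqr_sum_le_card _ _)); rewrite cardT size_enum_ord ler_wpM2l//.
    by apply: ler_sum => k _; rewrite real_normK ?num_real// expr2.
  rewrite /osc exprMn; apply: (le_trans (ler_wpM2l (sqr_ge0 H) CS)).
  by rewrite mulrA [H ^+ 2 * _]mulrC.
apply: (@le_trans _ _ ((2 * r) ^+ d * (d%:R * H ^+ 2 * \sum_k grad w s k * grad w s k))).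
  by rewrite ler_wpM2l// exprn_ge0// mulr_ge0// ltW.
rewrite mulrCA ler_wpM2l//; first by rewrite mulr_ge0// sqr_ge0.
by rewrite ler_wpM2r// volr.
Qed.
End mesh_faber_krahn.

(** Take the integer part of [K^(1/d)] plus one; it is at most twice [K^(1/d)] because [K >= 1], and
    squaring gives the 4. *)
Lemma nat_root (R : realType) (d K : nat) : (0 < d)%N ->
  exists n : nat, (K <= n ^ d)%N /\ n%:R ^+ 2 <= 4 * K%:R `^ (2 / d%:R) :> R.
Proof.
move=> d0; have [->|K0] := posnP K.
  by exists 0%N; split => //; rewrite expr0n mulr_ge0// powR_ge0.
have dR : (d%:R : R) != 0 by rewrite pnatr_eq0 -lt0n.
pose al : R := K%:R `^ (d%:R^-1).
have al0 : 0 <= al by exact: powR_ge0.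
have al1 : 1 <= al.
  rewrite -(powRr0 K%:R) /al ler_powR ?ler1n// invr_ge0//.
have alK : al ^+ d = K%:R by rewrite -powR_mulrn// -powRrM mulVf// powRr1.
have /andP[t1 t2] := truncn_itv al0.
exists (Num.truncn al).+1; split.
  rewrite -(ler_nat R) natrX -alK lerXn2r ?nnegrE//; exact: ltW.
have -> : 4 * K%:R `^ (2 / d%:R) = (2 * al) ^+ 2.
  rewrite exprMn mulrC [2 / _]mulrC powRrM -/al powR_mulrn// mulrC; congr (_ * _).
  by ring.
rewrite lerXn2r ?nnegrE//; first by rewrite mulr_ge0.
by rewrite -natr1; lra.
Qed.

(** * Faber-Krahn inequality on the mesh *)

Section mesh_faber_krahn.
Local Open Scope complex_scope.
Context {R : realType} {d : nat} {Omega : set 'rV[R]_d}.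
Variable T : triangulation Omega.
Local Notation n := (nnodes T).
Local Notation P := (node T).
Local Notation el := (elements T).
Implicit Types (s : {set 'I_n}).
Variables H r : R.
Hypothesis r0 : 0 < r.
Hypothesis diamH : forall s x y, s \in el -> open_simplex P s x -> open_simplex P s y ->
  forall k, `|x ord0 k - y ord0 k| <= H.
Hypothesis ball_r : forall s, s \in el -> exists c, box c r `<=` open_simplex P s.

Lemma vol_lower s : s \in el -> (2 * r) ^+ d <= vol s.
Proof.
move=> sel; have [c cs] := ball_r sel.
rewrite -lee_fin -(leb_boxE c) ?(ltW r0)// /vol fineK; last first.
  by rewrite ge0_fin_numE// leb_cell_fin.
apply: le_measure; rewrite ?inE.
- exact: measurable_box.
- exact: measurable_cell.
- by rewrite /cell sel.
Qed.

Lemma mesh_bounded : exists L : R, 0 < L /\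
  forall x k, mesh_union T x -> `|x ord0 k| < L.
Proof.
exists (1 + \sum_i \sum_k `|P i ord0 k|); split.
  by rewrite ltr_pwDl// sumr_ge0// => i _; exact: sumr_ge0.
move=> x k [s /= sel xs]; have := closed_simplex_sub_box sel xs k.
by rewrite mxE subr0 => /le_lt_trans; apply; rewrite ltrDr.
Qed.

(** The constant 128 is the product of 4 from [grid_level], 2 from the torus, 4 from [grid_energy]
    and 4 from [nat_root]; [d ^ 3] combines [d ^ 2] from the torus with [d] from [osc_energy]. *)
Lemma faber_krahn (m M : nat) (w : 'I_n -> R) (l : R) : (0 < d)%N -> 0 <= H ->
  4 * H / r + 1 <= m%:R ->
  (forall j, ~ Omega (P j) -> w j = 0) -> (forall j, 0 <= w j) -> 0 <= l ->
  M = (m.*2.+1 ^ d)%N ->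
  (2 * r) ^+ d * (l ^+ 2 * #|[set j | l <= w j]%SET|%:R) <=
  128 * d%:R ^+ 3 * M%:R ^+ 2 * (2 * (#|[set j | w j != 0%R]%SET| * M))%:R `^ (2 / d%:R) *
  H ^+ 2 * energy w w.
Proof.
move=> d0 H0 mH w0 wge0 l0 ME.
set K := (2 * (#|[set j | w j != 0%R]%SET| * M))%N.
have [nn [nK n2]] := nat_root R K d0.
have [L [L0 meshL]] := mesh_bounded.
have dl0 : 0 < r / 2 by rewrite divr_gt0.
(* The torus has to hold the box containing the mesh as well as the cube of translations of side
   [nn]. *)
pose N := maxn nn (Num.truncn (2 * L / (r / 2))).+1.
have NL : 2 * L <= r / 2 * N%:R.
  rewrite -ler_pdivrMl// mulrC.
  have t0 : 0 <= 2 * L / (r / 2) by rewrite divr_ge0 ?mulr_ge0// ltW.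
  have /andP[_ t2] := truncn_itv t0.
  by apply: (le_trans (ltW t2)); rewrite ler_nat /N leq_maxr.
have nN : (nn <= N.+1)%N by rewrite /N; lia.
pose g (z : 'rV['I_N.+1]_d) : R := interp w (pos L (r / 2) z).
have sg : (2 * #|[set z | g z != 0%R]%SET| <= nn ^ d)%N.
  apply: leq_trans nK; rewrite /K leq_mul2l/= ME.
  exact: (grid_support r0 diamH ball_r mH NL meshL).
have ge k := grid_energy r0 diamH ball_r mH H0 L0 NL meshL w0 k.
have fk := torus_faber_krahn nN ge sg; rewrite -ME in fk.
have lev := grid_level r0 ball_r NL meshL l0 wge0.
have ose := osc_energy r0 H0 w vol_lower.
apply: (@le_trans _ _ ((2 * r) ^+ d * (4 * \sum_z g z ^+ 2))).
  by rewrite ler_wpM2l// exprn_ge0// mulr_ge0// ltW.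
set O := \sum_(s in el) _ in fk ose.
have r20 : 0 <= (2 * r) ^+ d by rewrite exprn_ge0// mulr_ge0// ltW.
have E0 : 0 <= d%:R * H ^+ 2 * energy w w.
  by apply: le_trans ose; rewrite mulr_ge0// sumr_ge0// => s _; exact: sqr_ge0.
apply: (@le_trans _ _ (32 * d%:R ^+ 2 * M%:R ^+ 2 * nn%:R ^+ 2 * ((2 * r) ^+ d * O))).
  have := ler_wpM2l (mulr_ge0 r20 (ler0n R 4)) fk.
  rewrite mulrA => /le_trans; apply; rewrite le_eqVlt; apply/orP; left; apply/eqP.
  move: ((2 * r) ^+ d) (nn%:R) (M%:R) (d%:R) => x1 x2 x3 x4; ring.
have cst0 : 0 <= 32 * d%:R ^+ 2 * M%:R ^+ 2 :> R by rewrite !mulr_ge0// sqr_ge0.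
apply: (le_trans (ler_wpM2l (mulr_ge0 cst0 (sqr_ge0 _)) ose)).
have := ler_wpM2l cst0 (ler_wpM2r E0 n2).
rewrite mulrA => /le_trans; apply; rewrite le_eqVlt; apply/orP; left; apply/eqP.
move: (d%:R) (M%:R) (K%:R `^ _) => x3 x2 x1; ring.
Qed.
End mesh_faber_krahn.

(** * Mass lumping *)

Section lumping.
Local Open Scope complex_scope.
Context {R : realType} {d : nat} {Omega : set 'rV[R]_d}.
Variable T : triangulation Omega.
Local Notation n := (nnodes T).
Local Notation P := (node T).
Local Notation el := (elements T).
Implicit Types (a b : 'I_n -> R) (s : {set 'I_n}).

Definition bary_cell s j : set 'rV[R]_d :=
  cell s `&` [set x | forall i, i \in s -> lam P s i x <= lam P s j x].

Lemma bary_domainE j : @bary_domain R d Omega T j =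
  \bigcup_(s in [set s | (s \in el) && (j \in s)]) bary_cell s j.
Proof.
apply/seteqP; split => x.
  move=> [s [l [sel js bl l0 lj]]]; have fs := elements_simplex sel.
  have lE := barycentric_uniq fs bl.
  exists s; first by rewrite /= sel js.
  split; last by move=> i si; rewrite -!lE lj.
  by rewrite /cell sel; apply/(in_open_simplex fs) => i si; rewrite -lE l0.
move=> [s /= /andP[sel js] [+ xj]]; have fs := elements_simplex sel.
rewrite /cell sel => /(in_open_simplex fs) xs.
by exists s, (lam P s ^~ x); split => //; exact: barycentric_lam.
Qed.

Lemma measurable_bary_cell s j : measurable (bary_cell s j).
Proof.
apply: measurableI; first exact: measurable_cell.
have -> : [set x | forall i, i \in s -> lam P s i x <= lam P s j x] =
   \bigcap_(i in [set` s]) [set x | lam P s j x - lam P s i x \in `[0, +oo[].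
  apply/seteqP; split => x H i si.
    by rewrite /= in_itv/= andbT subr_ge0 H.
  by have := H i si; rewrite /= in_itv/= andbT subr_ge0.
apply: fin_bigcap_measurable; first exact: finite_finset.
move=> i _; rewrite -[X in measurable X]setTI.
have mf : measurable_fun setT (fun x : 'rV[R]_d => lam P s j x - lam P s i x).
  by apply: measurable_funB; exact: measurable_lam.
exact: (mf measurableT _ (measurable_itv `[0, +oo[)).
Qed.

Lemma measurable_bary_domain j : measurable (@bary_domain R d Omega T j).
Proof.
rewrite bary_domainE; apply: fin_bigcup_measurable; first exact: finite_finset.
by move=> s _; exact: measurable_bary_cell.
Qed.

Lemma bary_domain_sub_cell j x : bary_domain j x ->
  exists s, [/\ s \in el, j \in s & open_simplex P s x].
Proof.
rewrite bary_domainE => -[s /= /andP[sel js] [+ _]].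
by rewrite /cell sel; exists s.
Qed.

Lemma bary_domain_sub j : @bary_domain R d Omega T j `<=` Omega.
Proof. by move=> x /bary_domain_sub_cell [s [sel _ /(elements_sub sel)]]. Qed.

Lemma leb_bary_domain_le H j :
  (forall s x y, s \in el -> open_simplex P s x -> open_simplex P s y ->
    forall k, `|x ord0 k - y ord0 k| <= H) -> 0 <= H ->
  (leb d (@bary_domain R d Omega T j) <= ((2 * H) ^+ d)%:E)%E.
Proof.
move=> diamH H0; rewrite -(leb_boxE (P j) H0).
apply: le_measure; rewrite ?inE; [exact: measurable_bary_domain|exact: measurable_box|].
move=> x /bary_domain_sub_cell [s [sel js xs]] k.
apply: (closed_diam diamH k sel); last exact: node_closed.
exact: (open_simplex_closed (elements_simplex sel)).
Qed.

Lemma leb_bary_domain_fin j : (leb d (@bary_domain R d Omega T j) < +oo)%E.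
Proof.
have [L [L0 meshL]] := mesh_bounded T.
apply: (@le_lt_trans _ _ (leb d (box 0 L))); last by rewrite leb_boxE ?ltry// ltW.
apply: le_measure; rewrite ?inE; [exact: measurable_bary_domain|exact: measurable_box|].
move=> x /bary_domain_sub_cell [s [sel js xs]] k; rewrite mxE subr0; apply/ltW/meshL.
by exists s => //; exact: (open_simplex_closed (elements_simplex sel)).
Qed.

Definition nodal_Re (v : 'rV[R]_d -> R[i]) : 'I_n -> R := fun j => complex.Re (v (P j)).
Definition nodal_Im (v : 'rV[R]_d -> R[i]) : 'I_n -> R := fun j => complex.Im (v (P j)).

Lemma lumpingE v : Sh T v -> forall x, lumping T v x =
  stepfun (@bary_domain R d Omega T) (nodal_Re v) x +i*
  stepfun (@bary_domain R d Omega T) (nodal_Im v) x.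
Proof.
move=> vS x; rewrite /lumping.
have -> : \sum_(j | P j \in Omega) v (P j) * (\1_(bary_domain j) x)%:C =
    \sum_j v (P j) * (\1_(bary_domain j) x)%:C.
  rewrite [RHS](bigID (fun j => P j \in Omega))/= [X in _ + X]big1 ?addr0// => j jO.
  by rewrite (Sh_node0 vS) ?mul0r// => Oj; move/negP : jO; apply; rewrite inE.
by apply: complexP; rewrite ?Re_sum ?Im_sum; apply: eq_bigr => j _;
  rewrite ?ReM_real ?ImM_real.
Qed.

Definition gram a b : R := \sum_i \sum_j a i * b j *
  fine (leb d (@bary_domain R d Omega T i `&` @bary_domain R d Omega T j)).

Lemma gramDl a b c : gram (fun j => a j + b j) c = gram a c + gram b c.
Proof.
rewrite /gram -big_split/=; apply: eq_bigr => i _; rewrite -big_split/=.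
by apply: eq_bigr => j _; ring.
Qed.

Lemma gramNl a c : gram (fun j => - a j) c = - gram a c.
Proof.
rewrite /gram -sumrN; apply: eq_bigr => i _; rewrite -sumrN.
by apply: eq_bigr => j _; ring.
Qed.

Lemma gramZl (t : R) a c : gram (fun j => t * a j) c = t * gram a c.
Proof.
rewrite /gram mulr_sumr; apply: eq_bigr => i _; rewrite mulr_sumr.
by apply: eq_bigr => j _; ring.
Qed.

Lemma lumped_dotE (u z : 'rV[R]_d -> R[i]) : Sh T u -> Sh T z ->
  lumped_dot T u z =
  (gram (nodal_Re u) (nodal_Re z) + gram (nodal_Im u) (nodal_Im z)) +i*
  (gram (nodal_Im u) (nodal_Re z) - gram (nodal_Re u) (nodal_Im z)).
Proof.
move=> uS zS; rewrite /lumped_dot /L2dot /integral_cplx.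
pose A := @bary_domain R d Omega T.
have ip (a b c e : 'I_n -> R) :
    \int[leb d]_(x in Omega) (stepfun A a x * stepfun A b x + stepfun A c x * stepfun A e x) =
    gram a b + gram c e.
  apply: Rintegral_stepfunMD.
  - exact: measurable_bary_domain.
  - exact: leb_bary_domain_fin.
  - exact: bary_domain_sub.
congr (_ +i* _).
  rewrite -ip; apply: eq_Rintegral => x _.
  by rewrite (lumpingE uS) (lumpingE zS)/= mulrN opprK.
rewrite -gramNl -ip; apply: eq_Rintegral => x _.
by rewrite (lumpingE uS) (lumpingE zS)/= stepfunN mulrN mulNr addrC.
Qed.

End lumping.

(** * Coercivity of mass lumping and existence of the discrete Laplacian *)

Section discrete_laplacian.
Local Open Scope complex_scope.
Context {R : realType} {d : nat} {Omega : set 'rV[R]_d}.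
Variable T : triangulation Omega.
Local Notation n := (nnodes T).
Local Notation P := (node T).
Local Notation el := (elements T).
Implicit Types (a b : 'I_n -> R) (s : {set 'I_n}).
Local Notation bary := (@bary_domain R d Omega T).
Variables r : R.
Hypothesis r0 : 0 < r.
Hypothesis ball_r : forall s, s \in el -> exists c, box c r `<=` open_simplex P s.

Lemma core_sub_bary s j x : s \in el -> j \in s -> core s j x -> bary j x.
Proof.
move=> sel js [xs xj]; have fs := elements_simplex sel.
rewrite bary_domainE; exists s; first by rewrite /= sel js.
split; first by rewrite /cell sel.
move=> i si; have [->//|ij] := eqVneq i j.
by have := lam_pair_le1 fs ij (open_simplex_closed fs xs); lra.
Qed.

Lemma core_bary_inj s i j x : s \in el -> core s j x -> bary i x -> i = j.
Proof.
move=> sel [xs xj]; rewrite bary_domainE => -[t /= /andP[tel it] [xt xi]].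
rewrite /cell tel in xt.
have st : s = t.
  by apply: (open_simplex_inj sel tel xs); exact: (open_simplex_closed (elements_simplex tel)).
subst t; have fs := elements_simplex sel.
have js : j \in s.
  by apply/negPn/negP => /(lam_notin fs x) h; move: xj; rewrite h; lra.
apply/eqP/negPn/negP => ij; have lij := xi j js.
by have := lam_pair_le1 fs ij (open_simplex_closed fs xs); lra.
Qed.

Lemma stepfun_bary_core a s j x : s \in el -> j \in s -> core s j x ->
  stepfun bary a x = a j.
Proof.
move=> sel js xj; rewrite /stepfun (bigD1 j)//= indicE mem_set ?mulr1; last first.
  exact: (core_sub_bary sel js).
rewrite big1 ?addr0// => i /eqP ij; rewrite indicE memNset ?mulr0//.
by move=> /(core_bary_inj sel xj).
Qed.

Lemma measurable_core s j : s \in el -> measurable (@core R d Omega T s j).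
Proof.
move=> sel; have fs := elements_simplex sel.
have -> : @core R d Omega T s j =
    open_simplex P s `&` [set x | lam P s j x \in `]2^-1, +oo[].
  by apply/seteqP; split => x [h1 h2]; split => //; move: h2; rewrite /= in_itv/= andbT.
apply: measurableI; first exact: measurable_open_simplex.
rewrite -[X in measurable X]setTI.
exact: (@measurable_lam R d n P s j measurableT _ (measurable_itv `]2^-1, +oo[)).
Qed.

Lemma leb_core_fin s j : s \in el -> (leb d (@core R d Omega T s j) < +oo)%E.
Proof.
move=> sel; apply: le_lt_trans (leb_simplex_fin sel).
apply: le_measure; rewrite ?inE; first exact: measurable_core.
  by apply: measurable_open_simplex; exact: elements_simplex.
by move=> x [].
Qed.

Lemma leb_core_ge s j : s \in el -> j \in s -> r ^+ d <= fine (leb d (@core R d Omega T s j)).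
Proof.
move=> sel js; have [c cs] := core_box ball_r sel js.
rewrite -lee_fin fineK; last by rewrite ge0_fin_numE// leb_core_fin.
rewrite (_ : r ^+ d = (2 * (r / 2)) ^+ d); last by congr (_ ^+ _); field.
rewrite -(leb_boxE c); last by rewrite ltW// divr_gt0.
by apply: le_measure; rewrite ?inE; [exact: measurable_box|exact: measurable_core|].
Qed.

(** One core is kept for each node. These cores are disjoint and have measure at least [r ^+ d], so
    the step function with value [b j] on the core of [j] stays below [G]. *)
Lemma core_integral_le (G : 'rV[R]_d -> R) b : measurable_fun setT G ->
  (forall x, 0 <= G x) -> (forall j, 0 <= b j) ->
  (forall s j x, s \in el -> j \in s -> core s j x -> b j <= G x) ->
  ((r ^+ d * \sum_j b j)%:E <= \int[leb d]_x (G x)%:E)%E.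
Proof.
move=> mG G0 b0 bG.
have /choice[sn snP] : forall j, exists s, s \in el /\ j \in s.
  by move=> j; have [s] := node_elements j; exists s.
pose A j := core (sn j) j.
have mA j : measurable (A j) by apply: measurable_core; have [] := snP j.
have fA j : (leb d (A j) < +oo)%E by apply: leb_core_fin; have [] := snP j.
apply: (@le_trans _ _ (\int[leb d]_x (stepfun A b x)%:E)%E).
  rewrite integral_stepfun// lee_fin mulr_sumr; apply: ler_sum => j _.
  by rewrite mulrC ler_wpM2l// leb_core_ge//; have [] := snP j.
apply: ge0_le_integral => //.
- by move=> x _; rewrite lee_fin sumr_ge0// => j _; rewrite mulr_ge0.
- by apply/measurable_EFinP; exact: measurable_stepfun.
- exact/measurable_EFinP.
move=> x _; rewrite lee_fin.
have [[j xj]|out] := pselect (exists j, A j x); last first.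
  by rewrite stepfun_out// => j xj; apply: out; exists j.
have [sel js] := snP j.
apply: le_trans (bG _ _ _ sel js xj).
rewrite /stepfun (bigD1 j)//= indicE mem_set// mulr1 big1 ?addr0//.
move=> i /eqP ij; rewrite indicE memNset ?mulr0// => xi; have [tel it] := snP i.
exact/ij/(core_inj tel sel xi xj).
Qed.

(* The characteristic functions of the barycentric domains overlap where coordinates tie,
   so their Gram matrix is not visibly diagonal; it is positive definite because each
   domain contains its core, and cores meet no other domain. *)
Lemma gram_ge a : r ^+ d * \sum_j a j ^+ 2 <= gram a a.
Proof.
rewrite -lee_fin /gram -integral_stepfunM.
- apply: core_integral_le.
  + by apply: measurable_funM; apply: measurable_stepfun; exact: measurable_bary_domain.
  + by move=> x; rewrite -expr2 sqr_ge0.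
  + by move=> j; exact: sqr_ge0.
  + by move=> s j x sel js xj; rewrite !(stepfun_bary_core _ sel js xj) expr2.
- exact: measurable_bary_domain.
- exact: leb_bary_domain_fin.
Qed.

(** The Gram system of the interior nodes is completed by an identity block at the other nodes. A
    kernel vector vanishes at the latter because of that block, and at the former by [gram_ge]. *)
Lemma gram_solve b : exists w : 'I_n -> R, (forall j, ~ Omega (P j) -> w j = 0) /\
  forall z, (forall j, ~ Omega (P j) -> z j = 0) -> gram w z = \sum_j z j * b j.
Proof.
pose int j := `[< Omega (P j) >].
pose m i j := fine (leb d (bary i `&` bary j)).
pose G : 'M[R]_n := \matrix_(i, j)
  (if int i && int j then m i j else ((i == j) && ~~ int i)%:R).
have Gout (u : 'rV[R]_n) j : ~~ int j -> (u *m G) 0 j = u 0 j.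
  move=> jO; rewrite mxE (bigD1 j)//= mxE (negbTE jO) andbF eqxx/= mulr1.
  rewrite big1 ?addr0// => i ij; rewrite mxE (negbTE jO) andbF (negbTE ij) mulr0//.
have Gin (u : 'rV[R]_n) j : (forall i, ~~ int i -> u 0 i = 0) -> int j ->
    (u *m G) 0 j = \sum_i u 0 i * m i j.
  move=> u0 jO; rewrite mxE; apply: eq_bigr => i _; rewrite mxE jO andbT.
  by case: ifPn => // /u0 ->; rewrite !mul0r.
have gramE (u : 'rV[R]_n) (z : 'I_n -> R) : (forall i, ~~ int i -> u 0 i = 0) ->
    (forall i, ~~ int i -> z i = 0) ->
    gram (u 0) z = \sum_j z j * (u *m G) 0 j.
  move=> u0 z0; rewrite /gram exchange_big/=; apply: eq_bigr => j _.
  have [jO|/z0 ->] := boolP (int j).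
    by rewrite Gin// mulr_sumr; apply: eq_bigr => i _; rewrite mulrCA mulrA.
  by rewrite mul0r big1// => i _; rewrite mulr0 mul0r.
have Gfree : row_free G.
  apply: inj_row_free => u uG.
  have u0 i : ~~ int i -> u 0 i = 0 by move=> iO; rewrite -Gout// uG mxE.
  have := gram_ge (u 0); rewrite (gramE u (u 0) u0 u0) uG.
  rewrite [leRHS]big1; last by move=> j _; rewrite mxE mulr0.
  rewrite pmulr_rle0 ?exprn_gt0// => S0.
  have S0' : 0 <= \sum_j u 0 j ^+ 2 by apply: sumr_ge0 => j _; exact: sqr_ge0.
  have /eqP : \sum_j u 0 j ^+ 2 = 0 by apply/eqP; rewrite eq_le S0 S0'.
  rewrite psumr_eq0; last by move=> j _; exact: sqr_ge0.
  move=> /allP Z; apply/rowP => j; rewrite mxE; apply/eqP.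
  by have := Z j (mem_index_enum j); rewrite /= sqrf_eq0.
rewrite row_free_unit in Gfree.
pose w : 'rV[R]_n := (\row_j (if int j then b j else 0)) *m invmx G.
have wG : w *m G = \row_j (if int j then b j else 0) by rewrite mulmxKV.
have w0 i : ~~ int i -> w 0 i = 0 by move=> iO; rewrite -Gout// wG mxE (negbTE iO).
exists (w 0); split; first by move=> j jO; apply: w0; apply/negP => /asboolP.
move=> z z0.
have z0' i : ~~ int i -> z i = 0.
  by move=> iO; apply: z0 => Oi; move/negP : iO; apply; apply/asboolP.
rewrite gramE// wG; apply: eq_bigr => j _; rewrite mxE.
by case: ifPn => // /z0' ->; rewrite !mul0r.
Qed.

Lemma nodal_cinterp (w : 'I_n -> R[i]) :
  nodal_Re (cinterp w) = (fun j => complex.Re (w j)) /\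
  nodal_Im (cinterp w) = (fun j => complex.Im (w j)).
Proof.
by split; apply/funext => j; rewrite /nodal_Re /nodal_Im cinterp_node.
Qed.

Lemma discrete_laplacian_exists v : Sh T v -> exists w, Sh T w /\
  forall z, Sh T z -> lumped_dot T w z = - grad_dot (mesh_interior T) v z.
Proof.
move=> vS.
have [wr [wr0 wrP]] := gram_solve (fun j => - energy (nodal_Re v) (unit_vec j)).
have [wi [wi0 wiP]] := gram_solve (fun j => - energy (nodal_Im v) (unit_vec j)).
pose w := cinterp (fun j => wr j +i* wi j).
have wS : Sh T w by apply: Sh_cinterp => j jO; rewrite wr0// wi0.
exists w; split => // z zS.
rewrite lumped_dotE//; have [-> ->] := nodal_cinterp (fun j => wr j +i* wi j).
have z0 j : ~ Omega (P j) -> nodal_Re z j = 0 /\ nodal_Im z j = 0.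
  by move=> jO; rewrite /nodal_Re /nodal_Im (Sh_node0 zS jO).
have E (w1 : 'I_n -> R) (v1 z1 : 'I_n -> R) :
    (forall z, (forall j, ~ Omega (P j) -> z j = 0) ->
       gram w1 z = \sum_j z j * - energy v1 (unit_vec j)) ->
    (forall j, ~ Omega (P j) -> z1 j = 0) -> gram w1 z1 = - energy v1 z1.
  move=> h z10; rewrite h// [in RHS]energy_expandr -sumrN.
  by apply: eq_bigr => j _; rewrite mulrN.
rewrite grad_dotE; [|by have [] := vS|by have [] := zS].
have zr0 j : ~ Omega (P j) -> nodal_Re z j = 0 by move=> /z0[].
have zi0 j : ~ Omega (P j) -> nodal_Im z j = 0 by move=> /z0[].
rewrite !(E wr _ _ wrP)// !(E wi _ _ wiP)//.
by apply: complexP; rewrite /= /nodal_Re /nodal_Im; ring.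
Qed.

Lemma discrete_laplacianP v : Sh T v -> Sh T (discrete_laplacian T v) /\
  forall z, Sh T z ->
    lumped_dot T (discrete_laplacian T v) z = - grad_dot (mesh_interior T) v z.
Proof.
move=> /discrete_laplacian_exists [w wP]; rewrite /discrete_laplacian.
by case: xgetP => [f _ //|/(_ w)].
Qed.

End discrete_laplacian.

(** * Norms *)

Section complex_norm.
Local Open Scope complex_scope.
Context {R : rcfType}.
Implicit Types x y : R[i].

Lemma normcE x : Normc.normc x = Num.sqrt (complex.Re x ^+ 2 + complex.Im x ^+ 2).
Proof. by case: x. Qed.

Lemma normc_ge0 x : 0 <= Normc.normc x.
Proof. by rewrite normcE sqrtr_ge0. Qed.

Lemma normc_le_sum x : Normc.normc x <= `|complex.Re x| + `|complex.Im x|.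
Proof.
have s0 : 0 <= `|complex.Re x| + `|complex.Im x| by rewrite addr_ge0.
have <- : Num.sqrt ((`|complex.Re x| + `|complex.Im x|) ^+ 2) =
    `|complex.Re x| + `|complex.Im x| by rewrite sqrtr_sqr ger0_norm.
rewrite normcE ler_sqrt ?sqr_ge0//.
by rewrite sqrrD !real_normK ?num_real// lerD2r lerDl mulrn_wge0// mulr_ge0.
Qed.

(** For a unit number c, [|x|^2 - Re(c x)^2] is the square of [Im(c x)]. *)
Lemma Re_rotate_le (c x : R[i]) : Normc.normc c = 1 ->
  `|complex.Re c * complex.Re x - complex.Im c * complex.Im x| <= Normc.normc x.
Proof.
move=> c1; rewrite normcE -sqrtr_sqr ler_sqrt; last by rewrite addr_ge0 ?sqr_ge0.
have c2 : complex.Re c ^+ 2 + complex.Im c ^+ 2 = 1.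
  have := congr1 (fun t => t ^+ 2) c1.
  by rewrite /= normcE sqr_sqrtr ?expr1n// addr_ge0 ?sqr_ge0.
rewrite -[leRHS]mul1r -c2.
rewrite -subr_ge0; have : 0 <= (complex.Re c * complex.Im x + complex.Im c * complex.Re x) ^+ 2.
  exact: sqr_ge0.
by congr (_ <= _); ring.
Qed.

(** Take the conjugate of [x] divided by its modulus, or 1 when [x] is 0. *)
Lemma exists_rotation x : exists c : R[i], Normc.normc c = 1 /\
  complex.Re c * complex.Re x - complex.Im c * complex.Im x = Normc.normc x.
Proof.
have [x0|x0] := eqVneq (Normc.normc x) 0.
  exists 1; split; first by rewrite normcE /= expr1n expr0n addr0 sqrtr1.
  have := x0; rewrite {1}normcE => /eqP; rewrite sqrtr_eq0 => h.
  have := sqr_ge0 (complex.Re x); have := sqr_ge0 (complex.Im x) => h1 h2.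
  have /eqP : complex.Re x ^+ 2 = 0 by lra.
  have /eqP : complex.Im x ^+ 2 = 0 by lra.
  by rewrite !sqrf_eq0 x0 => /eqP -> /eqP ->; rewrite !mulr0 subrr.
set N := Normc.normc x in x0 *.
have N2 : N ^+ 2 = complex.Re x ^+ 2 + complex.Im x ^+ 2.
  by rewrite /N normcE sqr_sqrtr// addr_ge0 ?sqr_ge0.
have E : complex.Re x ^+ 2 + complex.Im x ^+ 2 != 0 by rewrite -N2 sqrf_eq0.
exists ((complex.Re x / N) +i* (- complex.Im x / N)); split => /=.
  rewrite (_ : _ + _ = 1) ?sqrtr1// !exprMn sqrrN exprVn N2 -mulrDl mulfV//.
rewrite mulrAC [X in _ - X]mulrAC mulNr mulNr opprK -mulrDl -!expr2 -N2 expr2 mulfK//.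
Qed.
End complex_norm.

Section norms.
Local Open Scope complex_scope.
Context {R : realType} {d : nat} {Omega : set 'rV[R]_d}.
Variable T : triangulation Omega.
Local Notation n := (nnodes T).
Local Notation P := (node T).
Local Notation el := (elements T).
Implicit Types (a b : 'I_n -> R) (s : {set 'I_n}).
Local Notation bary := (@bary_domain R d Omega T).

Definition lump_abs (v : 'rV[R]_d -> R[i]) (x : 'rV[R]_d) : R := Normc.normc (lumping T v x).

Lemma lump_abs_ge0 v x : 0 <= lump_abs v x. Proof. exact: normc_ge0. Qed.

Lemma measurable_lump_abs v : Sh T v -> measurable_fun setT (lump_abs v).
Proof.
move=> vS.
have -> : lump_abs v = Num.sqrt \o (fun x => stepfun bary (nodal_Re v) x ^+ 2 +
    stepfun bary (nodal_Im v) x ^+ 2).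
  by apply/funext => x; rewrite /lump_abs lumpingE.
apply: measurableT_comp.
  by apply: continuous_measurable_fun; exact: sqrt_continuous.
have mb := measurable_bary_domain (T := T).
by apply: measurable_funD; apply: measurable_funX; exact: measurable_stepfun.
Qed.

Lemma lump_abs_out v x : ~ mesh_union T x -> lump_abs v x = 0.
Proof.
move=> xD; rewrite /lump_abs /lumping big1 ?normcE/= ?expr0n ?addr0 ?sqrtr0// => j _.
rewrite indicE memNset ?mulr0// => /bary_domain_sub_cell [s [sel _ xs]].
by apply: xD; exists s => //; exact: (open_simplex_closed (elements_simplex sel)).
Qed.

Lemma lumped_normE q v : lumped_norm T q v = Lnorm (leb d) q%:E (EFin \o lump_abs v).
Proof.
rewrite /lumped_norm /Lnorm_cplx; congr Lnorm; apply/funext => x /=; congr EFin.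
rewrite patchE; case: ifPn => // xO.
rewrite /lump_abs /lumping big1 ?normcE/= ?expr0n ?addr0 ?sqrtr0// => j _.
rewrite indicE memNset ?mulr0// => /(@bary_domain_sub _ _ _ T) h.
by move/negP: xO; apply; rewrite inE.
Qed.

Lemma lump_abs_bounded v : Sh T v -> exists B : R, 0 <= B /\ forall x, lump_abs v x <= B.
Proof.
move=> vS.
exists (\sum_j (`|@nodal_Re _ _ _ T v j| + `|@nodal_Im _ _ _ T v j|)); split.
  by apply: sumr_ge0 => j _; rewrite addr_ge0.
have le1 a x : `|stepfun bary a x| <= \sum_j `|a j|.
  apply: (le_trans (ler_norm_sum _ _ _)); apply: ler_sum => j _.
  by rewrite normrM ler_piMr// indicE; case: (_ \in _); rewrite ?normr1 ?normr0.
move=> x; rewrite /lump_abs lumpingE//; apply: (le_trans (normc_le_sum _)) => /=.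
by rewrite big_split/= lerD.
Qed.

Lemma lumped_norm_integral q v :
  lumped_norm T q v = ((\int[leb d]_x (lump_abs v x `^ q)%:E) `^ q^-1)%E.
Proof.
rewrite lumped_normE unlock; congr (_ `^ _)%E; apply: eq_integral => x _.
by rewrite /= ger0_norm ?lump_abs_ge0.
Qed.

Lemma measurable_lump_abs_powR q v : Sh T v ->
  measurable_fun setT (fun x => lump_abs v x `^ q).
Proof.
move=> vS; apply: (measurableT_comp (measurable_powR q)).
exact: measurable_lump_abs.
Qed.

Lemma lumped_integral_fin q v : 0 < q -> Sh T v ->
  (\int[leb d]_x (lump_abs v x `^ q)%:E < +oo)%E.
Proof.
move=> q0 vS.
have [B [B0 vB]] := lump_abs_bounded vS.
have [L [L0 meshL]] := mesh_bounded T.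
have mB : measurable (box (0 : 'rV[R]_d) L) by exact: measurable_box.
apply: (@le_lt_trans _ _ (\int[leb d]_x ((B `^ q)%:E * (\1_(box 0 L) x)%:E))%E).
  apply: ge0_le_integral => //.
  - by move=> x _; rewrite lee_fin powR_ge0.
  - by apply/measurable_EFinP; exact: measurable_lump_abs_powR.
  - by apply/measurable_EFinP; apply: measurable_funM => //; exact: measurable_indic.
  - move=> x _ /=; rewrite -EFinM lee_fin.
    have [xD|xD] := pselect (mesh_union T x); last first.
      by rewrite lump_abs_out// powR0 ?gt_eqF// mulr_ge0// powR_ge0.
    rewrite indicE mem_set ?mulr1; last first.
      by move=> k; rewrite mxE subr0; apply/ltW/meshL.
    by apply: ge0_ler_powR; rewrite ?nnegrE ?lump_abs_ge0// ltW.
rewrite ge0_integralZl//.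
- rewrite (_ : (\int[leb d]_x (\1_(box 0 L) x)%:E)%E = ((2 * L) ^+ d)%:E) -?EFinM ?ltry//.
  by rewrite integral_indic// setIT; exact: (leb_boxE 0 (ltW L0)).
- exact/measurable_EFinP.
- by rewrite lee_fin powR_ge0.
Qed.

Definition lnorm q v : R := fine (lumped_norm T q v).

Lemma lnorm_ge0 q v : 0 <= lnorm q v.
Proof. by rewrite /lnorm fine_ge0// lumped_normE Lnorm_ge0. Qed.

Lemma lumped_norm_fineE q v : 0 < q -> Sh T v -> lumped_norm T q v = (lnorm q v)%:E.
Proof.
move=> q0 vS; rewrite /lnorm fineK// ge0_fin_numE; last by rewrite lumped_normE Lnorm_ge0.
by rewrite lumped_norm_integral; apply: poweR_lty; exact: lumped_integral_fin.
Qed.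

Lemma lnorm_powR q v : 0 < q -> Sh T v ->
  (\int[leb d]_x (lump_abs v x `^ q)%:E)%E = (lnorm q v `^ q)%:E.
Proof.
move=> q0 vS; rewrite -poweR_EFin -lumped_norm_fineE// lumped_norm_integral.
rewrite -poweRrM mulVf ?gt_eqF// poweRe1//.
by apply: integral_ge0 => x _; rewrite lee_fin powR_ge0.
Qed.

(** On the core of [j] the lumped function is constantly [v (P j)], so the cores alone bound the
    integral from below. *)
Lemma sum_normc_le r q v : 0 < r ->
  (forall s, s \in el -> exists c, box c r `<=` open_simplex P s) ->
  0 < q -> Sh T v ->
  r ^+ d * \sum_j Normc.normc (v (P j)) `^ q <= lnorm q v `^ q.
Proof.
move=> r0 ball_r q0 vS; rewrite -lee_fin -lnorm_powR//.
apply: (core_integral_le r0 ball_r).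
- exact: measurable_lump_abs_powR.
- by move=> x; exact: powR_ge0.
- by move=> j; exact: powR_ge0.
move=> s j x sel js xj; rewrite /lump_abs lumpingE// !(stepfun_bary_core _ sel js xj).
by rewrite /nodal_Re /nodal_Im; case: (v (P j)).
Qed.

Lemma leb_bary_bigcup_le H (A : {set 'I_n}) : 0 <= H ->
  (forall s x y, s \in el -> open_simplex P s x -> open_simplex P s y ->
    forall k, `|x ord0 k - y ord0 k| <= H) ->
  let S := \big[setU/set0]_(j <- enum A) bary j in
  measurable S /\ (leb d S <= ((2 * H) ^+ d * #|A|%:R)%:E)%E.
Proof.
move=> H0 diamH S.
have [mS lS] := le_measure_bigsetU (leb d) (enum A) (measurable_bary_domain (T := T)).
split => //; apply: (le_trans lS).
apply: (@le_trans _ _ (\sum_(j <- enum A) ((2 * H) ^+ d)%:E)%E).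
  by apply: lee_sum => j _; exact: leb_bary_domain_le.
by rewrite sumEFin big_enum/= sumr_const mulr_natr.
Qed.

(** Hoelder's inequality against the indicator of the union of the domains of [A], whose measure is
    at most [(2 * H) ^+ d] per node. The factor [d + 1] accounts for ties: at a given point only the
    domains of the vertices of its element contribute. *)
Lemma gram_hoelder H q (v : 'rV[R]_d -> R[i]) (f z : 'I_n -> R) (l : R) (A : {set 'I_n}) :
  0 <= H ->
  (forall s x y, s \in el -> open_simplex P s x -> open_simplex P s y ->
    forall k, `|x ord0 k - y ord0 k| <= H) ->
  1 < q -> 0 <= l -> Sh T v -> (forall x, `|stepfun bary f x| <= lump_abs v x) ->
  (forall j, 0 <= z j <= l) -> (forall j, j \notin A -> z j = 0) ->
  gram (T := T) f z <= d.+1%:R * l * lnorm q v * ((2 * H) ^+ d * #|A|%:R) `^ (1 - q^-1).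
Proof.
move=> H0 diamH q1 l0 vS fv zl zA.
have q0 : 0 < q by lra.
have [mS lS] := leb_bary_bigcup_le A H0 diamH; set S := \big[setU/set0]_(_ <- _) _ in mS lS.
have z0 x : 0 <= stepfun bary z x.
  by apply: sumr_ge0 => j _; rewrite mulr_ge0//; case/andP: (zl j).
have zS x : stepfun bary z x <= d.+1%:R * l * \1_S x.
  have SE : S x <-> exists2 j, j \in A & bary j x.
    rewrite /S -bigcup_seq; split=> [[j /= jA xj]|[j jA xj]].
      by exists j => //; rewrite mem_enum in jA.
    by exists j => //=; rewrite mem_enum.
  have [xS|xS] := pselect (S x); last first.
    rewrite indicE memNset// mulr0 /stepfun big1// => j _.
    have [jA|/zA ->] := boolP (j \in A); last by rewrite mul0r.
    by rewrite indicE memNset ?mulr0// => xj; apply: xS; apply/SE; exists j.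
  rewrite indicE mem_set// mulr1.
  have [j0 _ /bary_domain_sub_cell [s [sel js xs]]] := SE.1 xS.
  rewrite /stepfun (bigID (mem s))/= [X in _ + X]big1 ?addr0; last first.
    move=> j jns; rewrite indicE memNset ?mulr0// => /bary_domain_sub_cell [t [tel jt xt]].
    move: jns; rewrite (open_simplex_inj sel tel xs) ?jt//.
    exact: (open_simplex_closed (elements_simplex tel)).
  have [cs _] := elements_simplex sel.
  rewrite -cs mulr_natl -sumr_const; apply: ler_sum => j _.
  have /andP[zj0 zjl] := zl j; apply: le_trans zjl.
  by rewrite ler_piMr// indicE; case: (_ \in _).
have q'0 : 0 < 1 - q^-1 by rewrite subr_gt0 invf_lt1.
have q'0' : 0 < (1 - q^-1)^-1 by rewrite invr_gt0.
have qq' : q^-1 + ((1 - q^-1)^-1)^-1 = 1 by rewrite invrK addrC subrK.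
have hol := @hoelder _ _ _ (leb d) (lump_abs v) (\1_S) q (1 - q^-1)^-1
  (measurable_lump_abs vS) (measurable_indic mS) q0 q'0' qq'.
have N1 : (Lnorm (leb d) 1 (EFin \o (lump_abs v \* \1_S)%R) =
    \int[leb d]_x (lump_abs v x * \1_S x)%R%:E)%E.
  rewrite Lnorm1; apply: eq_integral => x _.
  by rewrite /= ger0_norm// mulr_ge0// lump_abs_ge0.
have Nq : Lnorm (leb d) q%:E (EFin \o lump_abs v) = (lnorm q v)%:E.
  by rewrite -lumped_normE lumped_norm_fineE.
have Nq' : (Lnorm (leb d) ((1 - q^-1)^-1)%:E (EFin \o \1_S) <=
    (((2 * H) ^+ d * #|A|%:R) `^ (1 - q^-1))%:E)%E.
  rewrite unlock invrK -poweR_EFin.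
  have -> : (\int[leb d]_x (`|(EFin \o \1_S) x| `^ (1 - q^-1)^-1) = leb d S)%E.
    rewrite -[S in RHS]setIT -integral_indic//; apply: eq_integral => x _ /=.
    rewrite indicE; case: (_ \in _); rewrite ?normr1 ?normr0 ?powR1// powR0//.
    by rewrite gt_eqF.
  have Sfin : leb d S \is a fin_num.
    by rewrite ge0_fin_numE//; apply: le_lt_trans lS _; rewrite ltry.
  move: lS; rewrite -(fineK Sfin) lee_fin !poweR_EFin lee_fin => lS'.
  by apply: ge0_ler_powR => //; rewrite ?nnegrE ?(le_trans _ lS') ?fine_ge0// ltW.
rewrite N1 Nq in hol.
have mfz : measurable_fun setT (fun x => stepfun bary f x * stepfun bary z x).
  by apply: measurable_funM; apply: measurable_stepfun; exact: measurable_bary_domain.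
have l10 : 0 <= d.+1%:R * l by rewrite mulr_ge0.
rewrite -lee_fin /gram -integral_stepfunM; last 2 first.
- exact: measurable_bary_domain.
- exact: leb_bary_domain_fin.
apply: (@le_trans _ _ (\int[leb d]_x ((d.+1%:R * l)%:E * (lump_abs v x * \1_S x)%R%:E))%E).
  apply: (le_trans (lee_abs _)); apply: (le_trans (le_abse_integral _ _ _)) => //.
    exact/measurable_EFinP.
  apply: ge0_le_integral => //.
  - by apply: measurableT_comp => //; exact/measurable_EFinP.
  - apply: measurable_funeM; apply/measurable_EFinP; apply: measurable_funM.
      exact: measurable_lump_abs.
    exact: measurable_indic.
  - move=> x _; rewrite /= -EFinM lee_fin normrM (ger0_norm (z0 x)) mulrCA.
    by apply: ler_pM.
rewrite ge0_integralZl//.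
- rewrite -mulrA [leRHS]EFinM; apply: lee_wpmul2l; first by rewrite lee_fin.
  apply: (le_trans hol); rewrite EFinM; apply: lee_wpmul2l; first by rewrite lee_fin lnorm_ge0.
  exact: Nq'.
- apply/measurable_EFinP; apply: measurable_funM; first exact: measurable_lump_abs.
  exact: measurable_indic.
- by move=> x _; rewrite lee_fin mulr_ge0// lump_abs_ge0.
Qed.

End norms.

(** * Mesh constants *)

Section euclidean_norm.
Local Open Scope complex_scope.
Context {R : realType} {d : nat}.
Implicit Types x y : 'rV[R]_d.

Lemma coord_le_enorm x k : `|x ord0 k| <= enorm x.
Proof.
rewrite /enorm -sqrtr_sqr ler_sqrt; last by apply: sumr_ge0 => i _; exact: sqr_ge0.
by rewrite (bigD1 k)//= lerDl sumr_ge0// => i _; exact: sqr_ge0.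
Qed.

Lemma enorm_ge0 x : 0 <= enorm x. Proof. exact: sqrtr_ge0. Qed.

Lemma enorm_le x (t : R) : 0 <= t -> (forall k, `|x ord0 k| <= t) -> enorm x <= d%:R * t.
Proof.
move=> t0 xt; rewrite /enorm -[leRHS]ger0_norm ?mulr_ge0// -[leRHS]sqrtr_sqr.
rewrite ler_sqrt ?sqr_ge0//.
apply: (@le_trans _ _ (\sum_(i < d) t ^+ 2)).
  apply: ler_sum => i _; rewrite -real_normK ?num_real//.
  by rewrite lerXn2r ?nnegrE// xt.
rewrite sumr_const card_ord exprMn -[leLHS]mulr_natl ler_wpM2r ?sqr_ge0//.
by rewrite -natrX ler_nat; case: d => // d'; rewrite expnS expn1 leq_pmulr.
Qed.

Lemma enorm_eq0 x y : enorm (x - y) = 0 -> x = y.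
Proof.
move=> e0; apply/rowP => k; have := coord_le_enorm (x - y) k.
by rewrite e0 normr_le0 !mxE subr_eq0 => /eqP.
Qed.
End euclidean_norm.

Section mesh_constants.
Local Open Scope complex_scope.
Context {R : realType} {d : nat} {Omega : set 'rV[R]_d}.
Variable T : triangulation Omega.
Local Notation n := (nnodes T).
Local Notation P := (node T).
Local Notation el := (elements T).
Implicit Types (s : {set 'I_n}).

Lemma le_h_elt s x y : s \in el -> open_simplex P s x -> open_simplex P s y ->
  enorm (x - y) <= h_elt s.
Proof.
move=> sel xs ys; rewrite /h_elt /diameter; apply: ub_le_sup; last by exists x, y.
have [L [L0 meshL]] := mesh_bounded T.
exists (d%:R * (L + L)) => _ [x' [y' [x's y's ->]]].
have fs := elements_simplex sel.
apply: enorm_le => [|k]; first by rewrite addr_ge0// ltW.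
rewrite !mxE; apply: (le_trans (ler_normB _ _)); apply: lerD; apply/ltW/meshL.
  by exists s => //; exact: (open_simplex_closed fs).
by exists s => //; exact: (open_simplex_closed fs).
Qed.

Lemma h_elt_le s : s \in el -> h_elt s <= mesh_size T.
Proof. by move=> sel; rewrite /mesh_size; apply: le_bigmax_cond. Qed.

Lemma mesh_diam s x y : s \in el -> open_simplex P s x -> open_simplex P s y ->
  forall k, `|x ord0 k - y ord0 k| <= mesh_size T.
Proof.
move=> sel xs ys k; apply: le_trans (h_elt_le sel); apply: le_trans (le_h_elt sel xs ys).
by have := coord_le_enorm (x - y) k; rewrite !mxE.
Qed.

Lemma h_elt_gt0 s : (0 < d)%N -> s \in el -> 0 < h_elt s.
Proof.
move=> d0 sel; have fs := elements_simplex sel.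
have [card_s _] := fs.
have /card_gt0P [j js] : (0 < #|s|)%N by rewrite card_s.
set c := centroid P s.
have cs : open_simplex P s c by exact: centroid_open.
have ys : open_simplex P s (P j + 2^-1 *: (c - P j)).
  apply: (open_simplex_toward fs cs (node_closed sel js)).
  by apply/andP; split; lra.
apply: lt_le_trans (le_h_elt sel cs ys).
rewrite lt_def enorm_ge0 andbT; apply/eqP => e0.
have E := enorm_eq0 e0.
have := congr1 (lam P s j) E; rewrite lam_conv (lam_vertex fs)// eqxx mulr1n.
rewrite (lam_centroid fs js) => h.
have h1 : d.+1%:R^-1 = 1 :> R by move: (d.+1%:R^-1) h => t; lra.
have : d.+1%:R = 1%:R :> R by apply: invr_inj; rewrite h1 invr1.
by move/eqP; rewrite eqr_nat; lia.
Qed.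

(** The inradius is at least [H / (gamma * nu)], so some inscribed ball has radius above half of
    that. The Euclidean norm is at most [d] times the maximum norm, so the cube lies in a ball of
    radius [H / (4 * gamma * nu)]. *)
Lemma mesh_ball nu gamma s : (0 < d)%N -> 0 < nu -> 0 < gamma -> s \in el ->
  h_elt s <= nu * rho_elt s -> mesh_size T <= gamma * h_elt s ->
  exists c, box c (mesh_size T / (4 * d%:R * gamma * nu)) `<=` open_simplex P s.
Proof.
move=> d0 nu0 ga0 sel hr Hh.
have hs0 := h_elt_gt0 d0 sel.
have rho0 : 0 < rho_elt s by rewrite -(pmulr_rgt0 _ nu0); exact: lt_le_trans hr.
have dR : 0 < d%:R :> R by rewrite ltr0n.
set H := mesh_size T in Hh *.
have H0 : 0 < H by apply: lt_le_trans hs0 (h_elt_le sel).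
have Hrho : H / (gamma * nu) <= rho_elt s.
  rewrite ler_pdivrMr ?mulr_gt0//; apply: (le_trans Hh).
  by apply: (le_trans (ler_wpM2l (ltW ga0) hr)); rewrite mulrA mulrC.
move: rho0 Hrho; rewrite /rho_elt /inradius; set E := [set _ | _] => rho0 Hrho.
(* [sup] takes the value 0 on a set without supremum, so a positive inradius guarantees that there
   is one. *)
have supE : has_sup E.
  by apply: contrapT => h; move: rho0; rewrite sup_out// ltxx.
have rho2 : 0 < sup E / 2 by rewrite divr_gt0.
have [rr [rr0 [c cK]] hrr] := sup_adherent rho2 supE.
exists c => y yc; apply: cK => /=.
apply: (@le_lt_trans _ _ (d%:R * (H / (4 * d%:R * gamma * nu)))).
  apply: enorm_le => [|k]; first by rewrite divr_ge0 ?mulr_ge0// ltW.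
  by rewrite !mxE; exact: yc.
have -> : d%:R * (H / (4 * d%:R * gamma * nu)) = (H / (gamma * nu)) / 4.
  by field; rewrite !gt_eqF.
lra.
Qed.

Lemma mesh_size_gt0 : (0 < d)%N -> Omega !=set0 -> 0 < mesh_size T.
Proof.
move=> d0 [x /(@domain_sub _ _ _ T) [s /= sel _]].
exact: lt_le_trans (h_elt_gt0 d0 sel) (h_elt_le sel).
Qed.

End mesh_constants.

(** * The discrete estimate *)

Section estimate.
Local Open Scope complex_scope.
Context {R : realType} {d : nat} {Omega : set 'rV[R]_d}.
Variable T : triangulation Omega.
Local Notation n := (nnodes T).
Local Notation P := (node T).
Local Notation el := (elements T).
Implicit Types (s : {set 'I_n}).
Local Notation bary := (@bary_domain R d Omega T).

Lemma energy_combl (x y : R) (a b z : 'I_n -> R) :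
  energy (fun j => x * a j - y * b j) z = x * energy a z - y * energy b z.
Proof.
rewrite !(energyC _ z) !(energy_expandr z) !mulr_sumr -sumrB.
by apply: eq_bigr => j _; ring.
Qed.

Lemma gram_combl (x y : R) (a b z : 'I_n -> R) :
  gram (T := T) (fun j => x * a j - y * b j) z = x * gram (T := T) a z - y * gram (T := T) b z.
Proof.
by rewrite -(gramZl x) -(gramZl y) -gramNl -gramDl.
Qed.

Lemma gram0r (a : 'I_n -> R) : gram (T := T) a (fun=> 0) = 0.
Proof. by rewrite /gram big1// => i _; rewrite big1// => j _; rewrite mulr0 mul0r. Qed.

Lemma energy0r (a : 'I_n -> R) : energy (T := T) a (fun=> 0) = 0.
Proof. by rewrite energy_expandr big1// => l _; rewrite mul0r. Qed.

(** Against a real test function the complex identity splits into one for real parts and one for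
    imaginary parts; the real part of the rotated function is a real combination of the two. *)
Lemma laplacian_energy (v w : 'rV[R]_d -> R[i]) (c : R[i]) (z : 'I_n -> R) :
  Sh T v -> Sh T w ->
  (forall z, Sh T z -> lumped_dot T w z = - grad_dot (mesh_interior T) v z) ->
  (forall j, ~ Omega (P j) -> z j = 0) ->
  energy (fun j => complex.Re c * nodal_Re v j - complex.Im c * nodal_Im v j) z =
  - gram (T := T) (fun j => complex.Re c * nodal_Re w j - complex.Im c * nodal_Im w j) z.
Proof.
move=> vS wS wP z0.
have zS : Sh T (cinterp (T := T) (fun j => (z j)%:C)).
  by apply: Sh_cinterp => j /z0 ->.
have := wP _ zS; rewrite lumped_dotE// grad_dotE; [|by have [] := vS|by have [] := zS].
have [-> ->] := nodal_cinterp (T := T) (fun j => (z j)%:C).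
rewrite -[fun j => complex.Re (cinterp _ _)]/(nodal_Re _).
rewrite -[fun j => complex.Im (cinterp _ _)]/(nodal_Im _).
have [-> ->] := nodal_cinterp (T := T) (fun j => (z j)%:C).
rewrite /= !gram0r !energy0r !addr0 !subr0 => -[h1 h2].
by rewrite energy_combl gram_combl h1 h2 /nodal_Re /nodal_Im; ring.
Qed.

Definition trunc (k l : R) (a : R) : R := Num.min (Num.max (a - k) 0) l.

Lemma trunc_bounds k l a : 0 <= l -> 0 <= trunc k l a <= l.
Proof. by move=> l0; rewrite /trunc le_min ge_min le_max !lexx l0 !orbT. Qed.

Lemma trunc_eq0 k l a : 0 <= l -> a <= k -> trunc k l a = 0.
Proof.
move=> l0 ak; rewrite /trunc; have [h1|h1] := leP (a - k) 0; last by exfalso; lra.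
by have [//|h2] := leP 0 l; exfalso; lra.
Qed.

Lemma trunc_max k l a : 0 <= l -> k + l <= a -> l <= trunc k l a.
Proof. by move=> l0 ka; rewrite /trunc le_min lexx andbT le_max; apply/orP; left; lra. Qed.

Lemma trunc_lipschitz k l a b : b <= a -> 0 <= trunc k l a - trunc k l b <= a - b.
Proof.
move=> ba; rewrite /trunc.
have [h1|h1] := leP (a - k) 0; have [h2|h2] := leP (b - k) 0.
- by rewrite subrr lexx subr_ge0.
- by exfalso; lra.
- by have [h3|h3] := leP (a - k) l; have [h4|h4] := leP 0 l; apply/andP; split; lra.
- by have [h3|h3] := leP (a - k) l; have [h4|h4] := leP (b - k) l; apply/andP; split; lra.
Qed.

(** Truncation is nondecreasing and 1-Lipschitz. *)
Lemma trunc_contract k l a b :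
  (trunc k l a - trunc k l b) ^+ 2 <= (a - b) * (trunc k l a - trunc k l b).
Proof.
have [ab|/ltW ab] := leP b a.
  have /andP[h1 h2] := trunc_lipschitz k l ab.
  by rewrite expr2 ler_wpM2r.
have /andP[h1 h2] := trunc_lipschitz k l ab.
have -> : (a - b) * (trunc k l a - trunc k l b) = (b - a) * (trunc k l b - trunc k l a) by ring.
by rewrite -sqrrN opprB expr2 ler_wpM2r.
Qed.

Variables (H ka q : R) (m M : nat).
Hypothesis d0 : (0 < d)%N.
Hypothesis H0 : 0 < H.
Hypothesis ka0 : 0 < ka.
Hypothesis diamH : forall s x y, s \in el -> open_simplex P s x -> open_simplex P s y ->
  forall k, `|x ord0 k - y ord0 k| <= H.
Hypothesis ball_r : forall s, s \in el -> exists c, box c (H * ka) `<=` open_simplex P s.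
Hypothesis mH : 4 / ka + 1 <= m%:R.
Hypothesis ME : M = (m.*2.+1 ^ d)%N.
Hypothesis q1 : 1 < q.
Hypothesis dq : d%:R / 2 < q.
Hypothesis acute : forall i j : 'I_n, i != j ->
  complex.Re (grad_dot (mesh_interior T) (nodal_basis i) (nodal_basis j)) <= 0.

(** Faber-Krahn constant at [r = H * ka], times the constants of [gram_hoelder], divided by the
    volume factor [(2 * ka) ^+ d]; no power of [H] survives. *)
Let K1 : R := 128 * d%:R ^+ 3 * M%:R ^+ 2 * (2 * M)%:R `^ (2 / d%:R) * d.+1%:R *
   (2 ^+ d) `^ (1 - q^-1) / (2 * ka) ^+ d.

Let phi (a : 'I_n -> R) (k : R) : R := H ^+ d * #|[set j | k < a j]%SET|%:R.

Lemma level_decay (v : 'rV[R]_d -> R[i]) (f a : 'I_n -> R) (k l : R) :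
  Sh T v -> (forall x, `|stepfun bary f x| <= lump_abs T v x) ->
  (forall j, ~ Omega (P j) -> a j = 0) ->
  (forall z, (forall j, ~ Omega (P j) -> z j = 0) -> energy a z = gram (T := T) f z) ->
  0 <= k -> 0 < l ->
  l * phi a (k + l) <= K1 * lnorm T q v * phi a k `^ (1 + (2 / d%:R - q^-1)).
Proof.
move=> vS fv a0 af k0 l0.
pose z j := trunc k l (a j).
have z0 j : ~ Omega (P j) -> z j = 0 by move=> /a0 aj; rewrite /z trunc_eq0 ?aj// ltW.
pose A := [set j | k < a j]%SET.
have zl j : 0 <= z j <= l by apply: trunc_bounds; exact: ltW.
have zA j : j \notin A -> z j = 0.
  by rewrite inE -leNgt => ak; rewrite /z trunc_eq0// ltW.
have e1 : energy z z <= gram (T := T) f z.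
  rewrite -af//; apply: energy_truncation => i j; last exact: trunc_contract.
  exact: acute_energy.
have e2 := gram_hoelder (ltW H0) diamH q1 (ltW l0) vS fv zl zA.
have mH' : 4 * H / (H * ka) + 1 <= m%:R.
  by rewrite (_ : 4 * H / (H * ka) = 4 / ka)//; field; rewrite !gt_eqF.
have r0 : 0 < H * ka by rewrite mulr_gt0.
have zge0 j : 0 <= z j by case/andP: (zl j).
have := faber_krahn r0 diamH ball_r d0 (ltW H0) mH' z0 zge0 (ltW l0) ME.
set B := [set j | l <= z j]%SET; set A' := [set j | z j != 0%R]%SET => fk.
set F := lnorm T q v in e2 *.
have F0 : 0 <= F by exact: lnorm_ge0.
set Y := phi a k.
have Y0 : 0 <= Y by rewrite /Y /phi mulr_ge0// exprn_ge0// ltW.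
have dR : 0 < d%:R :> R by rewrite ltr0n.
have q1' : 0 < 1 - q^-1 by rewrite subr_gt0 invf_lt1 ?(lt_trans ltr01 q1).
have cB : H ^+ d * #|[set j | (k + l < a j)%R]%SET|%:R <= H ^+ d * #|B|%:R.
  rewrite ler_wpM2l ?exprn_ge0 ?(ltW H0)// ler_nat.
  apply: subset_leq_card; apply/fintype.subsetP => j; rewrite !inE => /ltW kla.
  by apply: trunc_max => //; exact: ltW.
have cA : (#|A'| <= #|A|)%N.
  apply: subset_leq_card; apply/fintype.subsetP => j; rewrite inE.
  by apply: contraNT => /zA ->.
(* [H ^+ 2] is the power [2 / d] of [H ^+ d]: this absorbs the mesh size into [phi]. *)
have pA : (2 * (#|A'| * M))%:R `^ (2 / d%:R) * H ^+ 2 <= (2 * M)%:R `^ (2 / d%:R) * Y `^ (2 / d%:R).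
  have -> : Y `^ (2 / d%:R) = #|A|%:R `^ (2 / d%:R) * H ^+ 2.
    rewrite /Y /phi powRM ?exprn_ge0 ?(ltW H0)// mulrC; congr (_ * _).
    rewrite -powR_mulrn ?(ltW H0)// -powRrM mulrCA mulfV ?gt_eqF// mulr1.
    by rewrite powR_mulrn// ltW.
  rewrite mulrA -powRM// ler_wpM2r ?sqr_ge0//.
  apply: ge0_ler_powR; rewrite ?nnegrE ?mulr_ge0 ?divr_ge0//.
  by rewrite -natrM ler_nat mulnA mulnAC leq_mul2l cA orbT.
have e3 : energy z z <= d.+1%:R * l * F * ((2 ^+ d) `^ (1 - q^-1) * Y `^ (1 - q^-1)).
  apply: (le_trans e1); apply: (le_trans e2).
  have -> : (2 * H) ^+ d * #|A|%:R = 2 ^+ d * Y by rewrite /Y /phi exprMn mulrA.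
  by rewrite powRM ?exprn_ge0.
(* Faber-Krahn brings the exponent [2 / d] and Hoelder [1 - 1 / q]; their sum exceeds 1 exactly when
   [q > d / 2]. *)
have YY : Y `^ (2 / d%:R) * Y `^ (1 - q^-1) = Y `^ (1 + (2 / d%:R - q^-1)).
  rewrite -powRD; first by congr (_ `^ _); ring.
  by rewrite gt_eqF// addr_gt0// divr_gt0.
have ez0 : 0 <= energy z z.
  apply: sumr_ge0 => s _; rewrite mulr_ge0 ?vol_ge0// sumr_ge0// => i _.
  by rewrite -expr2 sqr_ge0.
have C0 : 0 <= 128 * d%:R ^+ 3 * M%:R ^+ 2 :> R by rewrite !mulr_ge0 ?exprn_ge0.
have P0 : 0 <= (2 * M)%:R `^ (2 / d%:R) * Y `^ (2 / d%:R) by rewrite mulr_ge0 ?powR_ge0.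
have main : (2 * (H * ka)) ^+ d * (l ^+ 2 * #|B|%:R) <=
   128 * d%:R ^+ 3 * M%:R ^+ 2 * (((2 * M)%:R `^ (2 / d%:R) * Y `^ (2 / d%:R)) *
    (d.+1%:R * l * F * ((2 ^+ d) `^ (1 - q^-1) * Y `^ (1 - q^-1)))).
  apply: (le_trans fk); rewrite -[leLHS]mulrA -[leLHS]mulrA ler_wpM2l//.
  by rewrite mulrA ler_pM// mulr_ge0 ?powR_ge0 ?sqr_ge0.
have k2 : 0 < (2 * ka) ^+ d by rewrite exprn_gt0// mulr_gt0.
rewrite -(ler_pM2l k2) -(ler_pM2l l0).
apply: (@le_trans _ _ (l * ((2 * ka) ^+ d * (l * (H ^+ d * #|B|%:R))))).
  by rewrite ler_wpM2l ?(ltW l0)// ler_wpM2l ?(ltW k2)// ler_wpM2l ?(ltW l0).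
have -> : l * ((2 * ka) ^+ d * (l * (H ^+ d * #|B|%:R))) = (2 * (H * ka)) ^+ d * (l ^+ 2 * #|B|%:R).
  have -> : (2 * (H * ka)) ^+ d = H ^+ d * (2 * ka) ^+ d by rewrite mulrCA exprMn.
  by move: (H ^+ d) ((2 * ka) ^+ d) => x1 x2; ring.
apply: (le_trans main); rewrite -YY /K1 le_eqVlt; apply/orP; left; apply/eqP.
move: k2; move: ((2 * ka) ^+ d) (Y `^ _) (Y `^ (2 / d%:R)) ((2 * M)%:R `^ _)
  ((2 ^+ d) `^ _) => x1 x2 x3 x4 x5 x10.
by field; rewrite gt_eqF.
Qed.
Lemma phi_ge0 a k : 0 <= phi a k.
Proof. by rewrite /phi mulr_ge0// exprn_ge0// ltW. Qed.

Lemma phi_homo a : {homo phi a : x y / x <= y >-> y <= x}.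
Proof.
move=> x y xy; rewrite /phi ler_wpM2l ?exprn_ge0 ?(ltW H0)// ler_nat.
apply: subset_leq_card; apply/fintype.subsetP => j; rewrite !inE.
exact: le_lt_trans.
Qed.

Lemma phi_markov (v : 'rV[R]_d -> R[i]) (a : 'I_n -> R) k : Sh T v -> 0 < k ->
  (forall j, a j <= Normc.normc (v (P j))) ->
  phi a k <= (ka ^+ d)^-1 * (lnorm T q v / k) `^ q.
Proof.
move=> vS k0 av.
have q0 : 0 < q by exact: lt_trans ltr01 q1.
have r0 : 0 < H * ka by rewrite mulr_gt0.
have kd : 0 < ka ^+ d by rewrite exprn_gt0.
have kq : 0 < k `^ q by rewrite powR_gt0.
have := sum_normc_le r0 ball_r q0 vS.
rewrite powRM ?invr_ge0 ?lnorm_ge0 ?(ltW k0)//.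
have -> : k^-1 `^ q = (k `^ q)^-1.
  by rewrite -[k^-1]powR_inv1 ?(ltW k0)// -powRrM mulN1r powRN.
move: (lnorm T q v `^ q) => V h.
rewrite mulrA ler_pdivlMr// mulrC -ler_pdivrMl ?invr_gt0// invrK; apply: le_trans h.
have -> : ka ^+ d * (k `^ q * phi a k) =
    (H * ka) ^+ d * (k `^ q * #|[set j | (k < a j)%R]%SET|%:R).
  by rewrite /phi exprMn; ring.
rewrite ler_wpM2l ?exprn_ge0 ?(ltW r0)// mulr_natr -sumr_const.
rewrite [leRHS](bigID (mem [set j | (k < a j)%R]%SET))/= ler_wpDr//.
  by apply: sumr_ge0 => j _; exact: powR_ge0.
apply: ler_sum => j; rewrite inE => /ltW kj.
apply: ge0_ler_powR; rewrite ?nnegrE ?normc_ge0 ?(ltW q0) ?(ltW k0)//.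
exact: le_trans kj (av j).
Qed.

Let th : R := d%:R / (2 * q).

Let be : R := 2 / d%:R - q^-1.

(** The height required by [stampacchia], with [phi] replaced by its bound from [phi_markov]. It
    depends on [d], [ka], [q] and [M] only, hence not on the mesh. *)
Definition discrete_constant : R :=
  2 * K1 * 2 `^ (be^-1) * ((ka ^+ d)^-1) `^ be.

Let K1_ge0 : 0 <= K1.
Proof.
by rewrite /K1 !mulr_ge0 ?invr_ge0 ?powR_ge0 ?exprn_ge0// ltW// mulr_gt0.
Qed.

Lemma discrete_constant_ge0 : 0 <= discrete_constant.
Proof.
by apply: mulr_ge0 (powR_ge0 _ _); apply: mulr_ge0 (powR_ge0 _ _); exact: mulr_ge0.
Qed.

Lemma node_estimate (v : 'rV[R]_d -> R[i]) j0 : Sh T v ->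
  Normc.normc (v (P j0)) <= (1 + discrete_constant) *
    lnorm T q (discrete_laplacian T v) `^ th * lnorm T q v `^ (1 - th).
Proof.
move=> vS.
have q0 : 0 < q by exact: lt_trans ltr01 q1.
have dR : 0 < d%:R :> R by rewrite ltr0n.
have r0 : 0 < H * ka by rewrite mulr_gt0.
have kd : 0 < ka ^+ d by rewrite exprn_gt0.
have th01 : 0 < th < 1.
  rewrite /th divr_gt0 ?mulr_gt0//= ltr_pdivrMr ?mulr_gt0// mul1r.
  by move: dq; rewrite ltr_pdivrMr// mulrC.
have be0 : 0 < be.
  rewrite /be subr_gt0 -[2 / _]invrK ltf_pV2 ?posrE ?invr_gt0 ?divr_gt0//.
  by rewrite invf_div.
(* Matches the exponent of Markov's bound raised to [be] with the one expected by
   [le_interpolation], and so produces [d / (2 * q)]. *)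
have qbe : q * be = th^-1 - 1 by rewrite /be /th; field; rewrite !gt_eqF.
have K10 := K1_ge0.
have Kge0 := discrete_constant_ge0.
have [wS wP] := discrete_laplacianP r0 ball_r vS.
set w := discrete_laplacian T v in wS wP *.
have [c [c1 cv]] := exists_rotation (v (P j0)).
pose a j := complex.Re c * nodal_Re (T := T) v j - complex.Im c * nodal_Im (T := T) v j.
pose f j := - (complex.Re c * nodal_Re (T := T) w j - complex.Im c * nodal_Im (T := T) w j).
have a0 j : ~ Omega (P j) -> a j = 0.
  by move=> jO; rewrite /a /nodal_Re /nodal_Im (Sh_node0 vS jO)/= !mulr0 subrr.
have af z : (forall j, ~ Omega (P j) -> z j = 0) -> energy a z = gram (T := T) f z.
  by move=> z0; rewrite (laplacian_energy c vS wS wP z0) -gramNl.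
have fw x : `|stepfun bary f x| <= lump_abs T w x.
  have -> : stepfun bary f x = - (complex.Re c * complex.Re (lumping T w x) -
      complex.Im c * complex.Im (lumping T w x)).
    rewrite lumpingE//= stepfunN; congr (- _).
    rewrite /stepfun !mulr_sumr -sumrB; apply: eq_bigr => j _; ring.
  by rewrite normrN; exact: Re_rotate_le.
have av j : a j <= Normc.normc (v (P j)).
  by apply: (le_trans (ler_norm _)); exact: Re_rotate_le.
rewrite -cv -[complex.Re _ * _ - _]/(a j0).
apply: le_interpolation => //; try exact: lnorm_ge0.
move=> k0 k00.
apply/ler_addgt0Pr => e e0.
set F := lnorm T q w; set V := lnorm T q v.
have F0 : 0 <= F by exact: lnorm_ge0.
have V0 : 0 <= V by exact: lnorm_ge0.
have p2 : 0 < 2 `^ (- be^-1) :> R by rewrite powR_gt0.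
(* The smallest height allowed by [stampacchia], plus [e] so that it stays positive when [F] or
   [phi a k0] vanishes. *)
pose D := 2 * (K1 * F) * (phi a k0 `^ be) / 2 `^ (- be^-1) + e.
have D0 : 0 < D.
  rewrite ltr_wpDl// divr_ge0 ?(ltW p2)//.
  by apply: mulr_ge0 (powR_ge0 _ _); apply: mulr_ge0 => //; exact: mulr_ge0.
have : phi a (k0 + D) = 0.
  apply: (stampacchia (M := K1 * F) be0) => //.
  - by rewrite mulr_ge0.
  - exact: phi_ge0.
  - exact: phi_homo.
  - by move=> k l kk0 l0; apply: (level_decay wS) => //; exact: le_trans (ltW k00) kk0.
  - rewrite /D mulrDr [_ * (_ / _)]mulrC divfK ?gt_eqF// lerDl.
    by rewrite mulr_ge0// ltW.
move/eqP; rewrite /phi mulf_eq0 expf_eq0 (gt_eqF H0) andbF/= pnatr_eq0 cards_eq0 => /eqP set00.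
have aD : a j0 <= k0 + D.
  rewrite leNgt; apply/negP => h.
  by have := finset.in_set0 j0; rewrite -set00 inE h.
apply: (le_trans aD); rewrite /D addrA lerD2r lerD2l.
have pm := phi_markov vS k00 av.
have kd' : 0 <= (ka ^+ d)^-1 by rewrite invr_ge0 ltW.
have pb : phi a k0 `^ be <= ((ka ^+ d)^-1) `^ be * (V / k0) `^ (th^-1 - 1).
  rewrite -qbe powRrM -powRM ?powR_ge0//.
  by apply: ge0_ler_powR; rewrite ?nnegrE ?phi_ge0 ?mulr_ge0 ?powR_ge0// ltW.
rewrite -powRN opprK /discrete_constant.
apply: (@le_trans _ _ (2 * (K1 * F) *
    (((ka ^+ d)^-1) `^ be * (V / k0) `^ (th^-1 - 1)) * 2 `^ be^-1)).
  rewrite ler_wpM2r ?powR_ge0// ler_wpM2l//.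
  by apply: mulr_ge0 => //; exact: mulr_ge0.
by rewrite le_eqVlt; apply/orP; left; apply/eqP; ring.
Qed.

End estimate.

(** Rotated so that its value at [x] is the modulus, the function is there a convex combination of
    rotated nodal values, each bounded by a modulus. *)
Lemma nodal_sup_le {R : realType} {d : nat} {Omega : set 'rV[R]_d}
    (T : triangulation Omega) (v : 'rV[R]_d -> R[i]) (B : R) x :
  Sh T v -> (forall j, Normc.normc (v (node T j)) <= B) -> Omega x ->
  Normc.normc (v x) <= B.
Proof.
move=> [vV _] vB /(@domain_sub _ _ _ T) [s /= sel xs].
have fs := elements_simplex sel.
have [c [c1 <-]] := exists_rotation (v x).
have [-> ->] := Vh_expansion vV sel xs.
rewrite !mulr_sumr -sumrB -[leRHS]mulr1 -(sum_lam fs x) mulr_sumr.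
apply: ler_sum => j _; rewrite !mulrA -mulrBl ler_wpM2r//.
  by move/(in_closed_simplex fs) : xs.
apply: le_trans (vB j); apply: (le_trans (ler_norm _)); exact: Re_rotate_le.
Qed.

Lemma Lnormy_le {R : realType} {d : nat} (Omega : set 'rV[R]_d)
    (v : 'rV[R]_d -> R[i]) (B : R) : 0 <= B ->
  (forall x, Omega x -> Normc.normc (v x) <= B) ->
  (Lnorm_cplx Omega +oo v <= B%:E)%E.
Proof.
move=> B0 vB; rewrite /Lnorm_cplx unlock; case: ifPn => _; last by rewrite lee_fin.
apply/ess_supP; apply: nearW => x /=; rewrite lee_fin patchE.
case: ifPn => [|_]; last by rewrite normr0.
by rewrite inE ger0_norm ?normc_ge0// => /vB.
Qed.



Theorem lemma24 (R : realType) (d : nat) (hd : d = 2%N \/ d = 3%N)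
    (Omega : set 'rV[R]_d) (hOmega : polyhedral_domain Omega)
    (mu : R) (hmu : shape_assumption Omega mu)
    (I : Type) (T : I -> triangulation Omega) (hreg : regular_family T)
    (q : R) (hq : mu_ d mu < q < mu)
    (hinv : inverse_assumption T) (hacute : acute_family T) :
  exists C : R, 0 < C /\
    forall (h : I) (v : 'rV[R]_d -> R[i]), Sh (T h) v ->
      (Lnorm_cplx Omega +oo v <=
         C%:E * lumped_norm (T h) q (discrete_laplacian (T h) v) `^ (d%:R / (2 * q))
              * lumped_norm (T h) q v `^ (1 - d%:R / (2 * q)))%E.
Proof.
have d0 : (0 < d)%N by case: hd => ->.
have [nu [nu0 Hnu]] := hreg.
have [gamma [ga0 Hga]] := hinv.
have dq : d%:R / 2 < q by case/andP: hq; rewrite /mu_ gt_max => /andP[].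
have d2 : 2 <= d%:R :> R by rewrite (ler_nat R 2); case: hd => ->.
(* From [q > d / 2] and [d >= 2]; Hoelder's inequality in [gram_hoelder] needs it. *)
have q1 : 1 < q by lra.
have dR : 0 < d%:R :> R by lra.
(* The half-width in [mesh_ball] relative to the mesh size. It involves [d], [nu] and [gamma] only,
   so [m], [M] and the final constant are fixed before [h]. *)
pose ka : R := (4 * d%:R * gamma * nu)^-1.
have ka0 : 0 < ka by rewrite invr_gt0 !mulr_gt0.
pose m := (Num.truncn (4 / ka + 1)).+1.
pose M := (m.*2.+1 ^ d)%N.
have mk : 4 / ka + 1 <= m%:R.
  have k0 : 0 <= 4 / ka + 1 by rewrite addr_ge0// divr_ge0// ltW.
  by have /andP[_ /ltW] := truncn_itv k0.
pose K := @discrete_constant R d ka q M.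
have K0 : 0 <= K by exact: discrete_constant_ge0.
exists (1 + K); split; first by rewrite ltr_pwDl.
move=> h v vS.
have [nonempty _ _] := hOmega.
have H0 := mesh_size_gt0 (T h) d0 nonempty.
have ball s : s \in elements (T h) ->
    exists c, box c (mesh_size (T h) * ka) `<=` open_simplex (node (T h)) s.
  by move=> sel; apply: (mesh_ball d0 nu0 ga0 sel); [exact: Hnu|exact: Hga].
have q0 : 0 < q by lra.
have r0 : 0 < mesh_size (T h) * ka by rewrite mulr_gt0.
have [wS _] := discrete_laplacianP r0 ball vS.
rewrite !lumped_norm_fineE// !poweR_EFin -!EFinM.
apply: Lnormy_le; first by rewrite !mulr_ge0 ?powR_ge0// addr_ge0.
move=> x; apply: (nodal_sup_le vS) => j.
exact: (node_estimate d0 H0 ka0 (@mesh_diam _ _ _ (T h)) ball mk erefl q1 dq (hacute h) j vS).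
Qed.
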